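(* Let $G=(V,E)$ be a graph and let $T\subseteq V$ be a set of terminals, and let $B=T\times T$ (all pairs of distinct terminals), so that $T(B)=T$. There is an algorithm that enumerates all the minimal node multiway cuts of $(G,T)$ with delay $O(|T(B)|\cdot|V|\cdot|E|)$, and there is an algorithm that enumerates all the minimal edge multiway cuts of $(G,T)$ with delay $O(|T(B)|\cdot|V|\cdot|E|^2)$.
   Context: Graphs are finite, undirected, connected, without self-loops or parallel edges. For a set $B$ of terminal pairs (unordered pairs of vertices), $T(B)$ denotes the set of vertices occurring in pairs of $B$. A node multicut of $(G,B)$ is a set $M\subseteq V\setminus T(B)$ such that in $G-M$ no pair $\{s,t\}\in B$ is joined by a path; an edge multicut is a set $M\subseteq E$ such that in $G-M$ no pair $\{s,t\}\in B$ is joined by a path. When $B$ consists of all pairs of distinct vertices of a set $T$, node/edge multicuts are called node/edge multiway cuts of $(G,T)$. A multicut is minimal if no proper subset of it is a multicut. An enumeration algorithm has delay $f$ if it outputs all solutions without duplication and the running time before the first output, between any two consecutive outputs, and after the last output is at most $f$. *)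

(* Defs.v *)
From mathcomp Require Import all_boot.

Set Implicit Arguments.
Unset Strict Implicit.
Unset Printing Implicit Defensive.

(** * Graphs and multicuts *)

Record graph (n : nat) := Graph {
  adj :> rel 'I_n;
  adj_sym : symmetric adj;
  adj_irr : irreflexive adj;
  adj_conn : forall u v, connect adj u v
}.

(* An unordered pair {u, v}, be it an edge or a terminal pair, is [set u; v]. *)
Definition edges n (G : graph n) : {set {set 'I_n}} :=
  [set [set p.1; p.2] | p : 'I_n * 'I_n & G p.1 p.2].

Definition terminals n (B : {set {set 'I_n}}) : {set 'I_n} := cover B.

Definition all_pairs n (T : {set 'I_n}) : {set {set 'I_n}} :=
  [set [set p.1; p.2] | p : 'I_n * 'I_n &
     [&& p.1 \in T, p.2 \in T & p.1 != p.2]].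

Lemma terminals_all_pairs n (T : {set 'I_n}) :
  1 < #|T| -> terminals (all_pairs T) = T.
Proof.
move=> T_gt1; apply/setP => x; apply/bigcupP/idP.
  case=> A /imsetP [[u v]]; rewrite inE /= => /and3P [uT vT _] ->.
  by rewrite !inE => /orP [] /eqP ->.
move=> xT; have : 0 < #|T :\ x| by move: T_gt1; rewrite (cardsD1 x) xT.
rewrite card_gt0 => /set0Pn [y]; rewrite !inE => /andP [y_neq_x yT].
exists [set x; y]; last by rewrite !inE eqxx.
by apply/imsetP; exists (x, y); rewrite ?inE //= xT yT eq_sym.
Qed.

Definition del_nodes n (G : graph n) (M : {set 'I_n}) : rel 'I_n :=
  [rel u v | [&& G u v, u \notin M & v \notin M]].

Definition del_edges n (G : graph n) (M : {set {set 'I_n}}) : rel 'I_n :=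
  [rel u v | G u v && ([set u; v] \notin M)].

Definition separates n (e : rel 'I_n) (B : {set {set 'I_n}}) : bool :=
  [forall s, forall t, ([set s; t] \in B) ==> ~~ connect e s t].

Definition node_multicut n (G : graph n) (B : {set {set 'I_n}})
    (M : {set 'I_n}) : bool :=
  (M \subset ~: terminals B) && separates (del_nodes G M) B.

Definition edge_multicut n (G : graph n) (B M : {set {set 'I_n}}) : bool :=
  (M \subset edges G) && separates (del_edges G M) B.

Definition node_multiway_cut n (G : graph n) (T : {set 'I_n}) :=
  node_multicut G (all_pairs T).

Definition edge_multiway_cut n (G : graph n) (T : {set 'I_n}) :=
  edge_multicut G (all_pairs T).

(** * Random access machines *)

(* The memory is a family of unbounded arrays of natural numbers; a program
   uses finitely many of them, and a scalar variable is the cell 0 of one. *)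
Definition store := nat -> nat -> nat.

Definition upd (s : store) (a i v : nat) : store :=
  fun b j => if (b == a) && (j == i) then v else s b j.

Inductive binop := Add | Sub | Mul | Div | Eq | Lt.

Definition binop_fun (o : binop) : nat -> nat -> nat :=
  match o with
  | Add => addn
  | Sub => subn
  | Mul => muln
  | Div => divn
  | Eq => fun x y => x == y
  | Lt => fun x y => x < y
  end.

Inductive expr :=
  | Num of nat
  | Get of nat & expr
  | Bin of binop & expr & expr.

Fixpoint eval (s : store) (e : expr) : nat :=
  match e with
  | Num k => k
  | Get a i => s a (eval s i)
  | Bin o e1 e2 => binop_fun o (eval s e1) (eval s e2)
  end.

(* [Out e] appends the value of [e] to the solution being written, and [End]
   completes this solution. *)
Inductive cmd :=
  | Skip
  | Assign of nat & expr & expr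
  | Out of expr
  | End
  | Seq of cmd & cmd
  | If of expr & cmd & cmd
  | While of expr & cmd.

(* Every event takes one unit of time. The expressions of a program have
   constant size, so that charging one unit for the evaluation of an expression
   is charging a unit per operation, up to a constant factor. *)
Inductive event := Write of nat | Test | Print of nat | Complete.

Inductive exec : cmd -> store -> seq event -> store -> Prop :=
  | ExecSkip s : exec Skip s [::] s
  | ExecAssign a i e s :
      exec (Assign a i e) s [:: Write (eval s e)] (upd s a (eval s i) (eval s e))
  | ExecOut e s : exec (Out e) s [:: Print (eval s e)] s
  | ExecEnd s : exec End s [:: Complete] s
  | ExecSeq c1 c2 s1 s2 s3 tr1 tr2 :
      exec c1 s1 tr1 s2 -> exec c2 s2 tr2 s3 ->
      exec (Seq c1 c2) s1 (tr1 ++ tr2) s3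
  | ExecIf e c1 c2 s s' tr :
      exec (if eval s e != 0 then c1 else c2) s tr s' ->
      exec (If e c1 c2) s (Test :: tr) s'
  | ExecWhileStop e c s :
      eval s e = 0 -> exec (While e c) s [:: Test] s
  | ExecWhileStep e c s1 s2 s3 tr1 tr2 :
      eval s1 e != 0 -> exec c s1 tr1 s2 -> exec (While e c) s2 tr2 s3 ->
      exec (While e c) s1 (Test :: tr1 ++ tr2) s3.

Lemma exec_det c s tr1 s1 tr2 s2 :
  exec c s tr1 s1 -> exec c s tr2 s2 -> tr1 = tr2 /\ s1 = s2.
Proof.
move=> ex1; elim: ex1 tr2 s2 => {c s tr1 s1}.
- by move=> s tr2 s2 ex2; inversion ex2.
- by move=> a i e s tr2 s2 ex2; inversion ex2.
- by move=> e s tr2 s2 ex2; inversion ex2.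
- by move=> s tr2 s2 ex2; inversion ex2.
- move=> c1 c2 s1 s2 s3 t1 t2 _ IH1 _ IH2 tr2 s4 ex2.
  inversion ex2 as [| | | |? ? ? s2' ? t1' t2' H1 H2| | |]; subst.
  by have [-> ?] := IH1 _ _ H1; subst; have [-> ->] := IH2 _ _ H2.
- move=> e c1 c2 s s' tr _ IH tr2 s2 ex2.
  inversion ex2 as [| | | | |? ? ? ? ? ? H| |]; subst.
  by have [-> ->] := IH _ _ H.
- move=> e c s e0 tr2 s2 ex2.
  inversion ex2 as [| | | | | |? ? ? _e0|? ? ? ? ? ? ? en0]; subst => //.
  by move: en0; rewrite e0.
- move=> e c s1 s2 s3 t1 t2 en0 _ IH1 _ IH2 tr2 s4 ex2.
  inversion ex2 as [| | | | | |? ? ? e0|? ? ? ? ? t1' t2' _en H1 H2]; subst.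
    by move: en0; rewrite e0.
  by have [-> ?] := IH1 _ _ H1; subst; have [-> ->] := IH2 _ _ H2.
Qed.

(* Words have O(log (N + t)) bits, N being the size of the input and t the time
   elapsed: a value written at time t is at most polynomial in N + t. Hence so
   are the addresses and the intermediate values of the expressions. Without
   this bound, a whole set could be packed in one cell. *)
Definition word_bounded (C N : nat) (tr : seq event) : Prop :=
  forall t v, onth tr t = Some (Write v) -> v <= C * (N + t.+1) ^ C.

(** * Enumeration with bounded delay *)

Definition is_complete (ev : event) : bool :=
  if ev is Complete then true else false.

Definition printed (tr : seq event) : seq nat :=
  pmap (fun ev => if ev is Print v then Some v else None) tr.

(* [w] lists the elements of [M] once each, in any order. *)
Definition lists (X : finType) (code : X -> nat) (M : {set X}) (w : seq nat) :=
  perm_eq w [seq code x | x <- enum M].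

(* The trace consists of one block per solution, which ends when the solution
   is completed, and of a [tail] after the last solution. *)
Definition enumerates_with_delay (X : finType) (code : X -> nat)
    (sol : pred {set X}) (delay : nat) (tr : seq event) : Prop :=
  exists (Ms : seq {set X}) (blocks : seq (seq event)) (tail : seq event),
    [/\ uniq Ms /\ (forall M, (M \in Ms) = sol M),
        tr = flatten [seq rcons b Complete | b <- blocks] ++ tail,
        ~~ has is_complete (flatten blocks ++ tail),
        all2 (lists code) Ms [seq printed b | b <- blocks] /\ printed tail = [::]
      & all (fun b => size (rcons b Complete) <= delay) blocks
        /\ size tail <= delay].

Definition edge_list n (G : graph n) (es : seq ('I_n * 'I_n)) : Prop :=
  perm_eq [seq [set p.1; p.2] | p <- es] (enum (edges G)).

Definition terminal_list n (T : {set 'I_n}) (ts : seq 'I_n) : Prop :=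
  perm_eq ts (enum T).

(* All cells that do not hold the input are initially 0. *)
Definition input n (es : seq ('I_n * 'I_n)) (ts : seq 'I_n) : store :=
  fun a i => nth 0 (nth [::]
    [:: [:: n; size es; size ts];
        [seq val p.1 | p <- es];
        [seq val p.2 | p <- es];
        [seq val v | v <- ts]] a) i.

Definition node_code n (v : 'I_n) : nat := v.

(* In solutions, an edge is denoted by its rank in the input. *)
Definition edge_code n (es : seq ('I_n * 'I_n)) (e : {set 'I_n}) : nat :=
  index e [seq [set p.1; p.2] | p <- es].

(* The program [P] and the constant [C] do not depend on the instance. The
   delay O(f) is rendered as C * (f + 1) so as to make sense when f = 0, that
   is, when there are no terminal pairs. *)
Definition enumeration_algorithm (X : nat -> finType)
    (code : forall n, seq ('I_n * 'I_n) -> X n -> nat)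
    (sol : forall n, graph n -> {set 'I_n} -> pred {set X n})
    (delay : forall n, graph n -> {set 'I_n} -> nat) : Prop :=
  exists (P : cmd) (C : nat),
  forall n (G : graph n) (T : {set 'I_n}) es ts,
    edge_list G es -> terminal_list T ts ->
    exists tr s,
      [/\ exec P (input es ts) tr s,
          word_bounded C (n + #|edges G|) tr
        & enumerates_with_delay (code n es) (sol n G T)
            (C * (delay n G T).+1) tr].

(* Main.v *)
Require Import Defs.
From mathcomp Require Import all_boot.
From mathcomp Require Import zify.
From Stdlib Require Import FunctionalExtensionality.
Import Defs.

Set Implicit Arguments.
Unset Strict Implicit.
Unset Printing Implicit Defensive.

(* A minimal multiway cut is determined by the classes of the terminals, that is,
   by disjoint connected sets, one around each terminal: it consists of the
   vertices adjacent to two classes (node version), or of the edges between two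
   classes, which then cover the graph (edge version). From a solution, a
   vertex v and a class i, a neighbouring solution is obtained as follows: v is
   moved to the class i, the vertices of the other classes that conflict with v
   (its neighbours for the node version) are discarded, each class is cut down to
   the component of its terminal, and a breadth-first search makes the classes
   grow again greedily, a vertex being blocked when it meets a second class.
   This takes linear time.

   For a target solution g, call P(f) the set of the vertices that are connected
   to a terminal by a path on which the classes of f and g agree. If P(f) does not
   contain all the classes of g, then some v outside P(f) is adjacent to a vertex
   of P(f) in the same class i of g, and moving v to the class i yields f' such
   that P(f') contains P(f) and v. Hence every solution is reached from any other
   one, and it suffices to traverse this graph on the solutions, a trie telling
   which ones have been met. The k n neighbours of a solution cost
   O(k n (n + m)) = O(k n m) time between two outputs. *)

(** * Time and memory of programs *)

(** The order of work gives the delay: a solution is printed before its neighbours are computed, and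
    the solutions found meanwhile wait in memory. Exactly one solution is thus processed between two
    outputs, and the moves that lead back to known solutions are part of this single processing. The
    obstacle in the growth is that blocking a vertex must not cut the path that joins a class to its
    terminal. Only vertices not yet scanned get blocked: this follows from the first-in first-out
    order and, in the node version, from the absence of edges between two seed classes. The trie
    reads a labelling as a word of length n over the k + 2 labels, so a lookup costs O(n) and no
    cell has to hold a set. Memory is initially zero, so a new trie node costs no initialisation.
    With at most one terminal the empty set is the only solution; with two adjacent terminals there
    is no node multiway cut, which is tested beforehand. Otherwise k is at least 2, and
    connectedness gives n <= 2m, so that linear time is O(m). Both versions meet the bound O(knm),
    and this implies the bound stated for edges. *)

Definition runs c (Q : store -> Prop) b s :=
  exists tr s', [/\ exec c s tr s', size tr <= b & Q s'].

Lemma runs_mono c (Q Q' : store -> Prop) b b' s :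
  runs c Q b s -> (forall s', Q s' -> Q' s') -> b <= b' -> runs c Q' b' s.
Proof.
move=> [tr [s' [ex szb Qs]]] QQ' bb'; exists tr, s'.
by split=> //; [exact: leq_trans szb bb' | exact: QQ'].
Qed.

Lemma runs_seq c1 c2 (R Q : store -> Prop) b1 b2 s :
  runs c1 R b1 s -> (forall s', R s' -> runs c2 Q b2 s') ->
  runs (Seq c1 c2) Q (b1 + b2) s.
Proof.
move=> [tr1 [s1 [ex1 sz1 R1]]] /(_ _ R1) [tr2 [s2 [ex2 sz2 Q2]]].
exists (tr1 ++ tr2), s2; split=> //; first exact: ExecSeq ex1 ex2.
by rewrite size_cat leq_add.
Qed.

Lemma runs_seq_le c1 c2 (R Q : store -> Prop) b1 b2 b s :
  runs c1 R b1 s -> b1 + b2 <= b -> (forall s', R s' -> runs c2 Q b2 s') ->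
  runs (Seq c1 c2) Q b s.
Proof. by move=> run1 leb run2; apply: runs_mono (runs_seq run1 run2) _ leb. Qed.

Lemma runs_skip (Q : store -> Prop) b s : Q s -> runs Skip Q b s.
Proof. by move=> Qs; exists [::], s; split=> //; apply: ExecSkip. Qed.

Lemma runs_if e c1 c2 (Q : store -> Prop) b s :
  runs (if eval s e != 0 then c1 else c2) Q b s -> runs (If e c1 c2) Q b.+1 s.
Proof.
by move=> [tr [s' [ex szb Qs]]]; exists (Test :: tr), s'; split=> //; apply: ExecIf.
Qed.

(* The first argument of [I] is the remaining budget. *)
Lemma runs_while e c (I : nat -> store -> Prop) (Q : store -> Prop) b s :
  (forall b s, I b s -> eval s e != 0 ->
     exists b1 b2, b1 + b2 < b /\ runs c (I b2) b1 s) ->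
  (forall b s, I b s -> eval s e = 0 -> 0 < b /\ Q s) ->
  I b s -> runs (While e c) Q b s.
Proof.
move=> step stop; elim/ltn_ind: b s => b IH s Ibs.
have [e0|en0] := eqVneq (eval s e) 0.
  have [b_gt0 Qs] := stop _ _ Ibs e0.
  by exists [:: Test], s; split=> //; apply: ExecWhileStop.
have [b1 [b2 [ltb [tr1 [s1 [ex1 sz1 I1]]]]]] := step _ _ Ibs en0.
have [|tr2 [s2 [ex2 sz2 Q2]]] := IH b2 _ s1 I1.
  by apply: leq_ltn_trans ltb; rewrite leq_addl.
exists (Test :: tr1 ++ tr2), s2; split=> //; first exact: ExecWhileStep ex1 ex2.
by rewrite /= size_cat; apply: leq_trans ltb; rewrite ltnS leq_add.
Qed.

Fixpoint written c : seq nat :=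
  match c with
  | Assign a _ _ => [:: a]
  | Seq c1 c2 | If _ c1 c2 => written c1 ++ written c2
  | While _ c => written c
  | _ => [::]
  end.

Lemma exec_frame c s tr s' a :
  exec c s tr s' -> a \notin written c -> s' a = s a.
Proof.
move=> ex; elim: ex => {c s tr s'} //=.
- move=> b i e s; rewrite inE => /negPf ab.
  by apply: functional_extensionality => j; rewrite /upd ab.
- by move=> c1 c2 s1 s2 s3 t1 t2 _ IH1 _ IH2;
    rewrite mem_cat negb_or => /andP [/IH1 <- /IH2].
- move=> e c1 c2 s s' tr _ IH; rewrite mem_cat negb_or => /andP [a1 a2].
  by apply: IH; case: ifP.
- by move=> e c s1 s2 s3 t1 t2 _ _ IH1 _ IH2 ac; rewrite IH2 // IH1.
Qed.

Lemma runs_frame c (Q : store -> Prop) b s :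
  runs c Q b s ->
  runs c (fun s' => Q s' /\ forall a, a \notin written c -> s' a = s a) b s.
Proof.
move=> [tr [s' [ex szb Qs]]]; exists tr, s'; split=> //; split=> // a.
exact: exec_frame ex.
Qed.

Lemma runs_frame_in (l : seq nat) c (Q : store -> Prop) b s :
  runs c Q b s -> all (mem l) (written c) ->
  runs c (fun s' => Q s' /\ forall a, a \notin l -> s' a = s a) b s.
Proof.
move=> /runs_frame/runs_mono run /allP sub; apply: run => // s' [Qs' fr]; split=> // a al.
by apply: fr; apply: contraNN al => /sub.
Qed.

Fixpoint quiet c : bool :=
  match c with
  | Out _ | End => false
  | Seq c1 c2 | If _ c1 c2 => quiet c1 && quiet c2
  | While _ c => quiet c
  | _ => true
  end.

Lemma printed_cat tr1 tr2 : printed (tr1 ++ tr2) = printed tr1 ++ printed tr2.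
Proof. exact: pmap_cat. Qed.

Lemma exec_quiet c s tr s' :
  exec c s tr s' -> quiet c -> printed tr = [::] /\ ~~ has is_complete tr.
Proof.
move=> ex; elim: ex => {c s tr s'} //=.
- move=> c1 c2 s1 s2 s3 t1 t2 _ IH1 _ IH2 /andP [/IH1 [p1 h1] /IH2 [p2 h2]].
  by rewrite printed_cat p1 p2 has_cat negb_or h1 h2.
- by move=> e c1 c2 s s' tr _ IH /andP [q1 q2]; apply: IH; case: ifP.
- move=> e c s1 s2 s3 t1 t2 _ _ IH1 _ IH2 qc.
  have [[p1 h1] [p2 h2]] := (IH1 qc, IH2 qc).
  by rewrite /printed /= -/(printed _) printed_cat p1 p2 has_cat negb_or h1 h2.
Qed.

(* The value of a slow expression exceeds a bound on the memory by at most 1,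
   so that the values in memory grow at most linearly in time. *)
Fixpoint bounded_expr e : bool :=
  match e with
  | Num k => k <= 1
  | Get _ _ => true
  | Bin Sub e _ | Bin Div e _ => bounded_expr e
  | Bin Eq _ _ | Bin Lt _ _ => true
  | _ => false
  end.

Definition slow_expr e : bool :=
  match e with
  | Bin Add (Get _ _) (Num 1) => true
  | _ => bounded_expr e
  end.

Fixpoint slow c : bool :=
  match c with
  | Assign _ _ e => slow_expr e
  | Seq c1 c2 | If _ c1 c2 => slow c1 && slow c2
  | While _ c => slow c
  | _ => true
  end.

Lemma eval_bounded_expr s K e :
  (forall a i, s a i <= K) -> 0 < K -> bounded_expr e -> eval s e <= K.
Proof.
move=> sK K_gt0; elim: e => [k|a e _|o e1 IH1 e2 _] /=.
- by move/leq_trans; apply.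
- by move=> _; apply: sK.
- case: o => //= [/IH1|/IH1|_|_].
  + by apply: leq_trans; rewrite leq_subr.
  + by apply: leq_trans; rewrite leq_div.
  + by case: eqP.
  + by case: ltnP.
Qed.

Lemma eval_slow_expr s K e :
  (forall a i, s a i <= K) -> 0 < K -> slow_expr e -> eval s e <= K.+1.
Proof.
move=> sK K_gt0.
have bnd e' : bounded_expr e' -> eval s e' <= K.+1.
  by move/(eval_bounded_expr sK K_gt0)/leqW.
case: e => [k|a e|[] e1 e2]; try exact: bnd.
case: e1 => [k|a e|o e1 e3] //; case: e2 => [[|[|k]]|b e'|o' e' e''] //= _.
by rewrite addn1 ltnS.
Qed.

Lemma exec_slow c s tr s' K :
  exec c s tr s' -> slow c -> 0 < K -> (forall a i, s a i <= K) ->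
  (forall a i, s' a i <= K + size tr) /\
  (forall t v, onth tr t = Some (Write v) -> v <= K + t.+1).
Proof.
move=> ex; elim: ex K => {c s tr s'} /=.
- by move=> s K _ _ sK; split=> [a i|t v]; rewrite ?addn0 ?onth0n.
- move=> b i e s K sl K_gt0 sK.
  have eK := eval_slow_expr sK K_gt0 sl; split.
    by move=> a j; rewrite /upd; case: ifP => _; rewrite addn1 // leqW.
  by case=> [|[|t]] v //= [<-]; rewrite addn1.
- by move=> e s K _ _ sK; split=> [a i|[|[|t]] v] //=; rewrite addn1 leqW.
- by move=> s K _ _ sK; split=> [a i|[|[|t]] v] //=; rewrite addn1 leqW.
- move=> c1 c2 s1 s2 s3 t1 t2 _ IH1 _ IH2 K /andP [/IH1 {}IH1 /IH2 {}IH2] K_gt0 sK.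
  have [s2K w1] := IH1 _ K_gt0 sK.
  have [|s3K w2] := IH2 _ _ s2K; first by rewrite ltn_addr.
  split=> [a i|t v]; first by rewrite size_cat addnA.
  rewrite onth_cat; case: ltnP => [_ /w1 //|le_t /w2].
  by rewrite -addnA addnS subnKC.
- move=> e c1 c2 s s' tr _ IH K /andP [sl1 sl2] K_gt0 sK.
  have [||s'K w] := IH K.+1 _ (ltn0Sn _); first by case: ifP.
    by move=> a i; rewrite leqW.
  split=> [a i|[|t] v] //=; first by rewrite addnS -addSn.
  by move/w; rewrite addSnnS.
- by move=> e c s _ K _ _ sK; split=> [a i|[|[|t]] v] //=; rewrite addn1 leqW.
- move=> e c s1 s2 s3 t1 t2 _ _ IH1 _ IH2 K sl K_gt0 sK.
  have [|s2K w1] := IH1 K.+1 sl (ltn0Sn _); first by move=> a i; rewrite leqW.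
  have [|s3K w2] := IH2 (K.+1 + size t1) sl _ s2K; first by rewrite ltn_addr.
  split=> [a i|[|t] v] //=.
    by rewrite size_cat addnS -addSn addnA.
  rewrite onth_cat; case: ltnP => [_ /w1|le_t /w2]; first by rewrite addSnnS.
  by rewrite -addnA addnS subnKC // addSnnS.
Qed.

Lemma exec_word_bounded c s tr s' N K :
  exec c s tr s' -> slow c -> (forall a i, s a i <= N + K) -> 0 < K ->
  word_bounded K.+2 N tr.
Proof.
move=> ex sl sK K_gt0 t v.
have [|_ w /w] := exec_slow ex sl _ sK; first by rewrite addn_gt0 K_gt0 orbT.
move/leq_trans; apply.
have le1 : N + K + t.+1 <= K.+2 * (N + t.+1).
  by nia.
apply: leq_trans le1 _; rewrite leq_mul2l /= -{1}[N + _]expn1.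
by rewrite leq_pexp2l // addnS.
Qed.

(** Weakest precondition of silent loop-free commands, obtained by computation. It is [False] on the
    other commands, so that [runs_wp] holds for all of them. *)
Fixpoint wp c (Q : store -> Prop) s : Prop :=
  match c with
  | Skip => Q s
  | Assign a i e => Q (upd s a (eval s i) (eval s e))
  | Seq c1 c2 => wp c1 (wp c2 Q) s
  | If e c1 c2 => if eval s e != 0 then wp c1 Q s else wp c2 Q s
  | _ => False
  end.

Lemma wp_if e c1 c2 Q s b : (eval s e != 0) = b ->
  (if b then wp c1 Q s else wp c2 Q s) -> wp (If e c1 c2) Q s.
Proof. by move=> /= ->. Qed.

(** The costs of the two branches of a test are added rather than compared: the result is a constant
    of the program in any case. *)
Fixpoint straight_cost c : nat :=
  match c with
  | Assign _ _ _ => 1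
  | Seq c1 c2 => straight_cost c1 + straight_cost c2
  | If _ c1 c2 => (straight_cost c1 + straight_cost c2).+1
  | _ => 0
  end.

Lemma runs_wp c Q s : wp c Q s -> runs c Q (straight_cost c) s.
Proof.
elim: c Q s => //= [|a i e|c1 IH1 c2 IH2|e c1 IH1 c2 IH2] Q s.
- exact: runs_skip.
- move=> Qs; exists [:: Write (eval s e)], (upd s a (eval s i) (eval s e)).
  by split=> //; apply: ExecAssign.
- by move/IH1 => run1; apply: runs_seq run1 _ => s' /IH2.
- move=> H; apply: runs_if; case: ifP H => _.
    by move/IH1/runs_mono; apply=> //; rewrite leq_addr.
  by move/IH2/runs_mono; apply=> //; rewrite leq_addl.
Qed.

Definition For a lim c :=
  Seq (Assign a (Num 0) (Num 0))
    (While (Bin Lt (Get a (Num 0)) lim)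
       (Seq c (Assign a (Num 0) (Bin Add (Get a (Num 0)) (Num 1))))).

(** The invariant must survive any write to the counter. The body may also assume that the arrays it
    does not write are as in [s], so [I] need not mention them. The cost counts the initial
    assignment, the last test, and a test and an increment per iteration. *)
Lemma runs_for a lim c (I : nat -> store -> Prop) N b s :
  a \notin written c ->
  (forall j s v, I j s -> I j (upd s a 0 v)) ->
  (forall j s', I j s' ->
     (forall d, d \notin a :: written c -> s' d = s d) -> eval s' lim = N) ->
  I 0 s ->
  (forall j s', j < N -> s' a 0 = j ->
     (forall d, d \notin a :: written c -> s' d = s d) ->
     I j s' -> runs c (I j.+1) b s') ->
  runs (For a lim c) (I N) (2 + N * b.+2) s.
Proof.
move=> ac updI evlim I0 step.
pose frame s' := forall d, d \notin a :: written c -> s' d = s d.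
have frame_upd s' v : frame s' -> frame (upd s' a 0 v).
  move=> fr d dac; rewrite -(fr _ dac); apply: functional_extensionality => i.
  by move: dac; rewrite inE negb_or /upd => /andP [/negPf ->].
pose J b' s' := exists j, [/\ j <= N, s' a 0 = j, frame s', I j s' & b' = 1 + (N - j) * b.+2].
rewrite -[X in runs _ _ X]/(1 + (1 + N * b.+2)).
apply: (runs_seq (R := J (1 + N * b.+2))) => [|s1 J1].
  apply: (@runs_wp (Assign a (Num 0) (Num 0))) => /=.
  exists 0; split; rewrite ?subn0 //; [by rewrite /upd !eqxx| |exact: updI].
  exact: frame_upd.
apply: (runs_while (I := J)) J1 => {s1} [b' s1|b' s1].
  move=> [j [leN aj fr Ij ->]] /=; rewrite (evlim _ _ Ij fr) aj eqb0 negbK => ltN.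
  exists (b + 1), (1 + (N - j.+1) * b.+2); split; first nia.
  apply: runs_seq (runs_frame (step _ _ ltN aj fr Ij)) _ => s2 [I2 fr2].
  apply: (@runs_wp (Assign _ _ _)) => /=; rewrite fr2 // aj addn1.
  exists j.+1; split=> //; rewrite ?/upd ?eqxx //; last exact: updI.
  apply: frame_upd => d dac; rewrite -fr // fr2 //.
  by move: dac; rewrite inE negb_or => /andP [].
move=> [j [leN aj fr Ij ->]] /=; rewrite (evlim _ _ Ij fr) aj.
case: ltnP => // leNj _; split=> //.
by have -> : N = j by apply/eqP; rewrite eqn_leq leN leNj.
Qed.

(** * Minimal multiway cuts as labellings *)

(** The tool by which paths are moved from one relation to another: [P] is carried along the path
    and guarantees that each of its steps is also a step of [e']. *)
Lemma connect_inv (X : finType) (e e' : rel X) (P : pred X) x y :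
  (forall u v, P u -> e u v -> P v /\ e' u v) ->
  P x -> connect e x y -> P y /\ connect e' x y.
Proof.
move=> step Px /connectP [p]; elim: p x Px => [|z p IH] x Px /=.
  by move=> _ ->.
move=> /andP [/(step _ _ Px) [Pz xz] ep] /(IH _ Pz ep) [Py zy].
by split=> //; apply: connect_trans zy; apply: connect1.
Qed.

Lemma set2_inj (X : finType) (x y a b : X) :
  [set x; y] = [set a; b] -> (x = a /\ y = b) \/ (x = b /\ y = a).
Proof.
move=> eq2.
have /set2P hx : x \in [set a; b] by rewrite -eq2 set21.
have /set2P hy : y \in [set a; b] by rewrite -eq2 set22.
have /set2P ha : a \in [set x; y] by rewrite eq2 set21.
have /set2P hb : b \in [set x; y] by rewrite eq2 set22.
by case: hx hy ha hb => ? [] ? [] ? [] ?; subst; auto.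
Qed.

Lemma mem_pairs (X : finType) (r : rel X) x y : symmetric r ->
  ([set x; y] \in [set [set p.1; p.2] | p : X * X & r p.1 p.2]) = r x y.
Proof.
move=> r_sym; apply/imsetP/idP => [[[a b]]|rxy]; last by exists (x, y); rewrite ?inE.
by rewrite inE /= => rab /set2_inj [] [-> ->]; rewrite // r_sym.
Qed.

Lemma adjC n (G : graph n) x y : G x y = G y x.
Proof. exact: adj_sym. Qed.

Lemma mem_edges n (G : graph n) x y : ([set x; y] \in edges G) = G x y.
Proof. by apply: (@mem_pairs _ G); apply: adj_sym. Qed.

Lemma mem_all_pairs n (T : {set 'I_n}) s t :
  ([set s; t] \in all_pairs T) = [&& s \in T, t \in T & s != t].
Proof.
apply: (@mem_pairs _ [rel s t | [&& s \in T, t \in T & s != t]]) => a b /=.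
by rewrite andbCA eq_sym.
Qed.

Lemma separatesP n (e : rel 'I_n) (T : {set 'I_n}) :
  reflect (forall s t, s \in T -> t \in T -> connect e s t -> s = t)
          (separates e (all_pairs T)).
Proof.
apply: (iffP 'forall_forallP) => [sep s t sT tT est|sep s t].
  apply/eqP; apply: contraTT est => neq_st.
  by apply: (implyP (sep s t)); rewrite mem_all_pairs sT tT.
rewrite mem_all_pairs; apply/implyP => /and3P [sT tT].
by apply: contraNN => /(sep _ _ sT tT) ->.
Qed.

Lemma del_nodes_sym n (G : graph n) M : symmetric (del_nodes G M).
Proof. by move=> x y; rewrite /del_nodes /= adjC; congr (_ && _); rewrite andbC. Qed.

Lemma del_edges_sym n (G : graph n) M : symmetric (del_edges G M).
Proof. by move=> x y; rewrite /del_edges /= adjC setUC. Qed.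

Section Labels.

Variables (n : nat) (G : graph n) (ts : seq 'I_n).
Hypothesis uniq_ts : uniq ts.
Local Notation k := (size ts).
Implicit Types (f g : 'I_n -> nat) (x y z t : 'I_n).

Definition term_label x := if x \in ts then (index x ts).+1 else 0.

Definition classed f x := 0 < f x <= k.

Definition same f : rel 'I_n := [rel x y | G x y && (f x == f y)].

Definition anchored f x := [exists t in ts, connect (same f) t x].

(* [f x] is [i.+1] when [x] lies in the class of the [i]-th terminal. When [nd]
   holds, [k.+1] marks the vertices of the node multiway cut, and [0] those that
   no terminal reaches. *)
Record valid (nd : bool) f : Prop := Valid {
  valid_le : forall x, f x <= k + nd;
  valid_ts : {in ts, f =1 term_label};
  valid_anchored : forall x, classed f x -> anchored f x;
  valid_out : forall x y, G x y -> classed f x -> f y != 0;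
  valid_nonadj : nd -> forall x y, G x y -> classed f x -> classed f y -> f x = f y;
  valid_blocked : nd -> forall x, f x = k.+1 ->
    exists y z, [/\ G x y /\ G x z, classed f y, classed f z & f y <> f z]
}.

Lemma term_label_gt0 t : t \in ts -> 0 < term_label t.
Proof. by rewrite /term_label => ->. Qed.

Lemma term_label_le t : term_label t <= k.
Proof. by rewrite /term_label; case: ifP => // tts; rewrite index_mem. Qed.

Lemma term_label_inj s t : s \in ts -> t \in ts ->
  term_label s = term_label t -> s = t.
Proof. by rewrite /term_label => sts tts; rewrite sts tts => -[] /index_inj ->. Qed.

Lemma term_label0 x : (term_label x == 0) = (x \notin ts).
Proof. by rewrite /term_label; case: ifP. Qed.

Lemma same_label f x y : connect (same f) x y -> f x = f y.
Proof.
move=> xy; have [|/eqP ->] // :=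
  connect_inv (e' := same f) (P := [pred z | f x == f z]) _ (eqxx _) xy.
by move=> u v /eqP fxu /andP [Guv /eqP fuv]; rewrite /same /= Guv fxu fuv eqxx.
Qed.

Lemma anchoredP f x :
  reflect (exists2 t, t \in ts & connect (same f) t x) (anchored f x).
Proof. exact: exists_inP. Qed.

Section Valid.

Variables (nd : bool) (f : 'I_n -> nat).
Hypothesis vf : valid nd f.

Lemma classed_ts t : t \in ts -> classed f t.
Proof.
by move=> tts; rewrite /classed (valid_ts vf) // term_label_gt0 // term_label_le.
Qed.

End Valid.

(** Without the label [k.+1], a nonzero label is that of a class. By [valid_out], being in a class
    then spreads along edges from a terminal to the whole connected graph. *)
Lemma valid_edge_classed f x : valid false f -> 0 < k -> classed f x.
Proof.
move=> vf; case Dts: ts => [|t ts'] // _.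
have tts : t \in ts by rewrite Dts mem_head.
have ct := classed_ts vf tts.
have [|] // := connect_inv (e' := G) (P := classed f) _ ct (adj_conn G t x).
move=> u v cu Guv; split=> //; rewrite /classed lt0n (valid_out vf Guv cu).
by have := valid_le vf v; rewrite addn0.
Qed.

Definition node_cut f := [set x | f x == k.+1].

Lemma nodeC_classed f x : valid true f -> f x != 0 -> x \notin node_cut f -> classed f x.
Proof.
move=> vf f0; rewrite inE => fk; rewrite /classed lt0n f0.
by have := valid_le vf x; rewrite addn1 leq_eqVlt (negPf fk).
Qed.

Lemma classed_nodeC f x : classed f x -> x \notin node_cut f.
Proof. by rewrite inE => /andP [_]; apply: contraTneq => ->; rewrite ltnn. Qed.

Definition edge_cut f : {set {set 'I_n}} :=
  [set [set p.1; p.2] | p : 'I_n * 'I_n & G p.1 p.2 && (f p.1 != f p.2)].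

Lemma mem_edge_cut f x y : ([set x; y] \in edge_cut f) = G x y && (f x != f y).
Proof.
apply: (@mem_pairs _ [rel x y | G x y && (f x != f y)]) => a b /=.
by rewrite adjC eq_sym.
Qed.

Section Cuts.

Variable T : {set 'I_n}.
Hypothesis eqT : ts =i T.
Hypothesis k_gt1 : 1 < k.

Let terminalsE : terminals (all_pairs T) = T.
Proof.
apply: terminals_all_pairs; rewrite -(eq_card eqT).
by move/card_uniqP: uniq_ts => ->.
Qed.

(** Off the cut, a path from a terminal keeps its label, by [valid_out] and [valid_nonadj], so it
    meets no other terminal. Conversely a cut vertex touches two classes, and putting it back joins
    their terminals. *)
Lemma node_cut_minimal f : valid true f -> minset (node_multiway_cut G T) (node_cut f).
Proof.
move=> vf.
have tsC t : t \in T -> t \notin node_cut f.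
  by rewrite -eqT => /(classed_ts vf); apply: classed_nodeC.
apply/minsetP; split.
  rewrite /node_multiway_cut /node_multicut terminalsE; apply/andP; split.
    by apply/subsetP => x; rewrite in_setC; apply: contraL => /tsC.
  apply/separatesP => s t sT tT st.
  have sts : s \in ts by rewrite eqT.
  have tts : t \in ts by rewrite eqT.
  have Ps : [pred z | classed f z & f z == f s] s by rewrite /= eqxx (classed_ts vf).
  have [u v /andP [cu /eqP fu] /and3P [Guv uM vM]|/andP [_ /eqP fts] _] :=
      connect_inv (e' := G) _ Ps st.
    have cv := nodeC_classed vf (valid_out vf Guv cu) vM.
    split=> //; rewrite /= cv -fu eq_sym; exact/eqP/(valid_nonadj vf).
  by apply: term_label_inj => //; rewrite -(valid_ts vf sts) -(valid_ts vf tts).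
move=> B /andP [_ /separatesP sepB] subB; apply/eqP; rewrite eqEsubset subB.
apply/subsetP => x xM; apply/negPn/negP => xB.
have fxk : f x = k.+1 by move: xM; rewrite inE => /eqP.
have [y [z [[Gxy Gxz] cy cz neq_f]]] := valid_blocked vf isT fxk.
have outB u : classed f u -> u \notin B.
  by move/classed_nodeC; apply: contraNN => /(subsetP subB).
have anch u : classed f u -> G x u ->
    exists t, [/\ t \in T, f t = f u & connect (del_nodes G B) t x].
  move=> cu Gxu; have /anchoredP [t tts tu] := valid_anchored vf cu.
  exists t; split; [by rewrite -eqT|exact: same_label|].
  have [|_ tu'] := connect_inv (e' := del_nodes G B) (P := classed f) _ (classed_ts vf tts) tu.
    move=> a b ca /andP [Gab /eqP fab].
    have cb : classed f b by rewrite /classed -fab.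
    by split=> //; rewrite /del_nodes /= Gab !outB.
  apply: connect_trans tu' (connect1 _).
  by rewrite /del_nodes /= adjC Gxu xB outB.
have [t1 [t1T ft1 t1x]] := anch _ cy Gxy.
have [t2 [t2T ft2 t2x]] := anch _ cz Gxz.
case: neq_f; rewrite -ft1 -ft2; congr (f _); apply: sepB => //.
apply: connect_trans t1x _; rewrite sym_connect_sym //; exact: del_nodes_sym.
Qed.

(** Labels are constant along uncut edges. Every vertex is joined to a terminal inside its class, so
    putting back an edge between two classes joins their terminals. *)
Lemma edge_cut_minimal f : valid false f -> minset (edge_multiway_cut G T) (edge_cut f).
Proof.
move=> vf; have k_gt0 := ltnW k_gt1.
apply/minsetP; split.
  apply/andP; split.
    apply/subsetP => e /imsetP [[x y]]; rewrite inE /= => /andP [Gxy _] ->.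
    by rewrite mem_edges.
  apply/separatesP => s t; rewrite -!eqT => sts tts st.
  have [u v /eqP fu /andP [Guv uvM]|/eqP fts _] :=
      connect_inv (e' := G) (P := [pred z | f z == f s]) _ (eqxx _) st.
    by move: uvM; rewrite mem_edge_cut Guv negbK /= => /eqP <-; rewrite fu.
  by apply: term_label_inj => //; rewrite -(valid_ts vf sts) -(valid_ts vf tts).
move=> B /andP [_ /separatesP sepB] subB; apply/eqP; rewrite eqEsubset subB.
apply/subsetP => e eM; apply/negPn/negP => eB.
case/imsetP: eM eB => -[x y]; rewrite inE /= => /andP [Gxy neq_f] -> xyB.
have anch u : exists t, [/\ t \in T, f t = f u & connect (del_edges G B) t u].
  have cu := valid_edge_classed u vf k_gt0.
  have /anchoredP [t tts tu] := valid_anchored vf cu.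
  exists t; split; [by rewrite -eqT|exact: same_label|].
  apply: connect_sub tu => a b /andP [Gab fab]; apply: connect1.
  rewrite /del_edges /= Gab; apply: contraTN fab => /(subsetP subB).
  by rewrite mem_edge_cut Gab.
have [t1 [t1T ft1 t1x]] := anch x.
have [t2 [t2T ft2 t2y]] := anch y.
case/eqP: neq_f; rewrite -ft1 -ft2; congr (f _); apply: sepB => //.
apply: connect_trans t1x _; apply: (@connect_trans _ _ y).
  by apply: connect1; rewrite /del_edges /= Gxy xyB.
by rewrite sym_connect_sym //; exact: del_edges_sym.
Qed.

(** The [e]-path must leave the [e']-component of [s], which by [step] is possible only at a vertex
    satisfying [P]. Here [e'] is the graph minus a minimal cut, [e] has one element of the cut
    restored, and [P] says that this element is at hand. *)
Lemma minimal_multicut_path (e e' : rel 'I_n) (P : pred 'I_n) s t :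
  (forall u v, connect e' s u -> e u v -> e' u v \/ P u) ->
  connect e s t -> ~~ connect e' s t -> exists2 y, connect e' s y & P y.
Proof.
move=> step est; case: (pickP [pred y | connect e' s y & P y]) => [y /andP [sy Py] _|noP].
  by exists y.
case/negP; have [u v su euv|] // := connect_inv (e' := e') _ (connect0 e' s) est.
have [e'uv|Pu] := step _ _ su euv; last by have := noP u; rewrite /= su Pu.
by split=> //; apply: connect_trans su (connect1 _).
Qed.

(** The choice made by [pick] is arbitrary, but when [e] separates the terminals at most one of them
    qualifies. *)
Definition component_label (e : rel 'I_n) x :=
  if [pick t in ts | connect e t x] is Some t then term_label t else 0.

Lemma component_label_le e x : component_label e x <= k.
Proof. by rewrite /component_label; case: pickP => // t _; exact: term_label_le. Qed.

Lemma component_labelE e t x : connect_sym e ->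
  (forall s t, s \in T -> t \in T -> connect e s t -> s = t) ->
  t \in ts -> connect e t x -> component_label e x = term_label t.
Proof.
move=> e_sym sep tts tx; rewrite /component_label.
case: pickP => [t' /andP [t'ts t'x]|/(_ t)]; last by rewrite /= tts tx.
congr term_label; apply: sep; rewrite -?eqT //.
by apply: connect_trans t'x _; rewrite e_sym.
Qed.

Lemma component_labelP e x : component_label e x != 0 ->
  exists t, [/\ t \in ts, connect e t x & component_label e x = term_label t].
Proof.
by rewrite /component_label; case: pickP => // t /andP [tts tx] _; exists t.
Qed.

(** The labelling marks [M] with [k.+1] and the other vertices with the terminal of their component
    in [G - M]. Minimality of [M] is what yields [valid_blocked]. *)
Lemma node_cut_surj (M : {set 'I_n}) :
  minset (node_multiway_cut G T) M -> exists2 f, valid true f & node_cut f = M.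
Proof.
case/minsetP => /andP []; rewrite terminalsE => MT /separatesP sep minM.
pose e := del_nodes G M.
have e_sym : connect_sym e by apply/sym_connect_sym/del_nodes_sym.
have lab t x := component_labelE (t := t) (x := x) e_sym sep.
have tM t : t \in ts -> t \notin M.
  by rewrite eqT; apply: contraL => /(subsetP MT); rewrite inE.
pose f x := if x \in M then k.+1 else component_label e x.
have fM x : (f x == k.+1) = (x \in M).
  rewrite /f; case: ifP; rewrite ?eqxx // => _.
  by apply: ltn_eqF; rewrite ltnS component_label_le.
have classedP x : classed f x ->
    exists t, [/\ t \in ts, connect e t x, x \notin M & f x = term_label t].
  rewrite /classed /f; case: ifP => xM; first by rewrite ltnn.
  case/andP; rewrite lt0n => /component_labelP [t [tts tx ->]] _.
  by exists t.
have eM t x : t \in ts -> connect e t x -> x \notin M.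
  move=> tts tx; have [|] // := connect_inv (e' := e) (P := [pred x | x \notin M]) _ (tM _ tts) tx.
  by move=> u v uM uv; split=> //; case/and3P: uv.
have fE t x : t \in ts -> connect e t x -> f x = term_label t.
  by move=> tts tx; rewrite /f (negPf (eM _ _ tts tx)) (lab _ _ tts tx).
have cE t x : t \in ts -> connect e t x -> classed f x.
  by move=> tts tx; rewrite /classed (fE _ _ tts tx) term_label_gt0 ?term_label_le.
have stepE t x y : t \in ts -> connect e t x -> G x y -> y \notin M -> connect e t y.
  move=> tts tx Gxy yM; apply: (connect_trans tx (connect1 _)).
  by rewrite /e /del_nodes /= Gxy yM (eM _ _ tts tx).
exists f; last by apply/setP => x; rewrite inE fM.
split=> [x|t tts|x cx|x y Gxy cx|_ x y Gxy cx cy|_ x fx].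
- by rewrite addn1 /f; case: ifP => // _; rewrite leqW // component_label_le.
- by apply: fE.
- have [t [tts tx _ _]] := classedP _ cx; apply/anchoredP; exists t => //.
  have [u v tu uv|] // := connect_inv (e' := same f) (P := connect e t) _ (connect0 e t) tx.
  have tv := connect_trans tu (connect1 uv).
  split=> //; rewrite /same /= (fE _ _ tts tu) (fE _ _ tts tv) eqxx andbT.
  by case/and3P: uv.
- have [t [tts tx _ _]] := classedP _ cx.
  case: (boolP (y \in M)) => yM; first by rewrite /f yM.
  by have /cE := stepE _ _ _ tts tx Gxy yM; move=> /(_ tts) /andP []; rewrite lt0n.
- have [t [tts tx _ ->]] := classedP _ cx; have [_ [_ _ yM _]] := classedP _ cy.
  by rewrite (fE _ _ tts (stepE _ _ _ tts tx Gxy yM)).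
- have xM : x \in M by rewrite -fM fx.
  have /existsP [s /existsP [t]] : ~~ separates (del_nodes G (M :\ x)) (all_pairs T).
    apply/negP => sepx; have := setD11 x M; rewrite (minM (M :\ x)) ?xM ?subD1set //.
    by rewrite /node_multiway_cut /node_multicut terminalsE (subset_trans (subD1set _ _)).
  rewrite negb_imply negbK mem_all_pairs => /andP [/and3P [sT tT neq_st] st].
  have sts : s \in ts by rewrite eqT.
  have tts : t \in ts by rewrite eqT.
  (* A path that is available once [x] is restored can leave the component of [a] in [G - M] only by
     stepping onto [x]. *)
  have nbr a b : a \in ts -> b \in T -> a != b -> connect (del_nodes G (M :\ x)) a b ->
      exists2 y, connect e a y & G y x.
    move=> ats bT neq_ab ab; apply: minimal_multicut_path ab _.
      move=> u v au /and3P [Guv _ vMx].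
      move: vMx; rewrite !inE negb_and negbK => /orP [/eqP <-|vM]; first by right.
      by left; rewrite /e /del_nodes /= Guv vM (eM _ _ ats au).
    by apply: contra neq_ab => /sep -> //; rewrite -eqT.
  have [y sy Gyx] := nbr _ _ sts tT neq_st st.
  have [||z tz Gzx] := nbr t s tts sT; first by rewrite eq_sym.
    by rewrite sym_connect_sym //; apply: del_nodes_sym.
  exists y, z; rewrite 2!(adjC G x) (cE _ _ sts sy) (cE _ _ tts tz).
  rewrite (fE _ _ sts sy) (fE _ _ tts tz); split=> //.
  by move/(term_label_inj sts tts) => eq_st; rewrite eq_st eqxx in neq_st.
Qed.

(** Each vertex is labelled by the terminal of its component in [G - M]. By minimality every
    component contains a terminal, so that the label 0 never occurs. *)
Lemma edge_cut_surj (M : {set {set 'I_n}}) :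
  minset (edge_multiway_cut G T) M -> exists2 f, valid false f & edge_cut f = M.
Proof.
case/minsetP => /andP [ME /separatesP sep] minM.
pose e := del_edges G M.
have e_sym : connect_sym e by apply/sym_connect_sym/del_edges_sym.
have lab t x := component_labelE (t := t) (x := x) e_sym sep.
pose f x := component_label e x.
(* Restoring the edge joins two terminals [s] and [t]. The path leaves the component of [s] at one
   end of the edge and, read backwards, that of [t] at one end; these ends differ, as otherwise [s]
   and [t] would be joined in [G - M]. *)
have crossing x y : [set x; y] \in M -> exists s t,
    [/\ s \in ts, t \in ts, s <> t, connect e s x & connect e t y].
  move=> xyM.
  have /existsP [s /existsP [t]] : ~~ separates (del_edges G (M :\ [set x; y])) (all_pairs T).
    apply/negP => sepx; have := setD11 [set x; y] M.
    rewrite (minM (M :\ _)) ?xyM ?subD1set //.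
    by rewrite /edge_multiway_cut /edge_multicut sepx (subset_trans (subD1set _ _)).
  rewrite negb_imply negbK mem_all_pairs => /andP [/and3P [sT tT neq_st] st].
  have sts : s \in ts by rewrite eqT.
  have tts : t \in ts by rewrite eqT.
  have nbr a b : a \in T -> b \in T -> a != b ->
      connect (del_edges G (M :\ [set x; y])) a b ->
      exists2 z, connect e a z & z \in [:: x; y].
    move=> aT bT neq_ab ab; apply: minimal_multicut_path ab _.
      move=> u v au /andP [Guv]; rewrite in_setD1 negb_and negbK => /orP [/eqP uv|uvM].
        by right; have := set21 u v; rewrite uv !inE.
      by left; rewrite /e /del_edges /= Guv.
    by apply: contra neq_ab => /sep ->.
  have [z1 sz1 z1P] := nbr _ _ sT tT neq_st st.
  have [||z2 tz2 z2P] := nbr t s tT sT; first by rewrite eq_sym.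
    by rewrite sym_connect_sym //; apply: del_edges_sym.
  have neq_z : z1 <> z2.
    move=> eqz; case/eqP: neq_st; apply: sep => //.
    by apply: connect_trans sz1 _; rewrite eqz e_sym.
  move: z1P z2P sz1 tz2; rewrite !inE => /orP [] /eqP ez1 /orP [] /eqP ez2; subst=> // sz tz.
    by exists s, t; split=> //; apply/eqP.
  by exists t, s; split=> //; apply/eqP; rewrite eq_sym.
(* Walking from a terminal in [G], an uncut edge stays in the component, and the far end of a cut
   edge lies in a terminal component by [crossing]. *)
have reached x : exists2 t, t \in ts & connect e t x.
  have [t tts] : exists t, t \in ts by case: (ts) k_gt1 => // t ts' _; exists t; exact: mem_head.
  apply/exists_inP; pose P z := [exists t in ts, connect e t z].
  have Pt : P t by apply/exists_inP; exists t.
  have [u v /exists_inP [s sts su] Guv|] // := connect_inv (e' := G) _ Pt (adj_conn G t x).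
  split=> //; case: (boolP ([set u; v] \in M)) => uvM; apply/exists_inP.
    by have [_ [t' [_ t'ts _ _ tv]]] := crossing _ _ uvM; exists t'.
  exists s => //; apply: (connect_trans su (connect1 _)).
  by rewrite /e /del_edges /= Guv.
have fE t x : t \in ts -> connect e t x -> f x = term_label t by exact: lab.
exists f.
  split=> // [x|t tts|x _|x y _ _].
  - by rewrite addn0 component_label_le.
  - by apply: fE.
  - have [t tts tx] := reached x; apply/anchoredP; exists t => //.
    have [u v tu uv|] // := connect_inv (e' := same f) (P := connect e t) _ (connect0 e t) tx.
    have tv := connect_trans tu (connect1 uv).
    split=> //; rewrite /same /= (fE _ _ tts tu) (fE _ _ tts tv) eqxx andbT.
    by case/andP: uv.
  - by have [t tts /(fE _ _ tts) ->] := reached y; rewrite -lt0n term_label_gt0.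
apply/setP => e0; apply/idP/idP => [|e0M].
  case/imsetP => -[x y]; rewrite inE /= => /andP [Gxy neq_f] ->.
  apply: contraTT neq_f => xyM; have [t tts tx] := reached x.
  have ty : connect e t y.
    by apply: (connect_trans tx (connect1 _)); rewrite /e /del_edges /= Gxy.
  by rewrite (fE _ _ tts tx) (fE _ _ tts ty) eqxx.
have /imsetP [[x y]] := subsetP ME _ e0M; rewrite inE /= => Gxy De0.
rewrite De0 mem_edge_cut Gxy; rewrite De0 in e0M.
have [s [t [sts tts neq_st sx ty]]] := crossing _ _ e0M.
rewrite (fE _ _ sts sx) (fE _ _ tts ty); apply/eqP.
by move/(term_label_inj sts tts).
Qed.

End Cuts.

(** Along a path inside a class of the first labelling no vertex is cut, so the second labelling,
    which agrees at the terminal, must follow it by [valid_out] and [valid_nonadj]. A vertex that is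
    neither cut nor in a class has label 0. *)
Lemma node_cut_inj f g : valid true f -> valid true g ->
  node_cut f = node_cut g -> f =1 g.
Proof.
have main f' g' x : valid true f' -> valid true g' -> node_cut f' = node_cut g' ->
    classed f' x -> g' x = f' x.
  move=> vf vg eq_cut cx; have /anchoredP [t tts tx] := valid_anchored vf cx.
  have Pt : [pred z | classed f' z & g' z == f' z] t.
    by rewrite /= (classed_ts vf) // (valid_ts vf) // (valid_ts vg) // eqxx.
  have [u v /andP [cu /eqP gu] /andP [Guv /eqP fuv]|/andP [_ /eqP ->]] // :=
    connect_inv (e' := G) _ Pt tx.
  have cv : classed f' v by rewrite /classed -fuv.
  have cgu : classed g' u by rewrite /classed gu.
  split=> //; rewrite /= cv -fuv -gu eq_sym; apply/eqP/(valid_nonadj vg) => //.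
  apply: nodeC_classed (valid_out vg Guv cgu) _ => //.
  by rewrite -eq_cut classed_nodeC.
move=> vf vg eq_cut x.
case: (boolP (classed f x)) => [cfx|ncfx]; first by rewrite (main f g).
case: (boolP (classed g x)) => [cgx|ncgx]; first by rewrite (main g f).
have [xf|xf] := boolP (x \in node_cut f).
  by move: (xf); rewrite {1}eq_cut; move: xf; rewrite !inE => /eqP -> /eqP ->.
have f0 : f x = 0 by apply/eqP; apply: contraNT ncfx => fx; apply: nodeC_classed.
have g0 : g x = 0.
  by apply/eqP; apply: contraNT ncgx => gx; apply: nodeC_classed; rewrite -?eq_cut.
by rewrite f0 g0.
Qed.

Lemma edge_cut_inj f g : 0 < k -> valid false f -> valid false g ->
  edge_cut f = edge_cut g -> f =1 g.
Proof.
move=> k_gt0 vf vg eq_cut x.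
have /anchoredP [t tts tx] := valid_anchored vf (valid_edge_classed x vf k_gt0).
have Pt : [pred z | g z == f z] t by rewrite /= (valid_ts vf) // (valid_ts vg).
have [u v /eqP gu /andP [Guv /eqP fuv]|/eqP ->] // := connect_inv (e' := G) _ Pt tx.
split=> //; have := mem_edge_cut f u v.
rewrite eq_cut mem_edge_cut Guv fuv eqxx /= => /negbFE /eqP guv.
by rewrite -guv gu fuv.
Qed.

(* Moves [v] to the class [i]. In the node version, the vertices of the other
   classes that [v] sees leave their classes, and nothing moves if one of them
   is a terminal. *)
Definition movable (nd : bool) f v i :=
  (v \notin ts) && (nd ==> all (fun y => G v y ==> (f y == i.+1)) ts).

Definition seed_label (nd : bool) f v i x :=
  if (x == v) && movable nd f v i then i.+1
  else if nd && [&& G v x, f x != i.+1 & x \notin ts] then 0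
  else if nd && (f x == k.+1) then 0 else f x.

(** What the growth requires of its starting labels. In the node version seed classes must not
    touch, since a seed vertex is never to be blocked. *)
Definition seed (nd : bool) f :=
  {in ts, f =1 term_label} /\
  (nd -> forall x y, G x y -> f x != 0 -> f y != 0 -> f x = f y).

(** The only new label is that of [v]. Its neighbours outside the class [i] have been discarded,
    except terminals, and [movable] excludes such terminals. All other labels come from [f], where
    two classes are not adjacent. *)
Lemma seed_seed_label nd f v i : valid nd f -> seed nd (seed_label nd f v i).
Proof.
move=> vf; split=> [t tts|].
  rewrite /seed_label tts /= !andbF.
  case: andP => [[/eqP Dt]|_]; first by rewrite /movable -Dt tts.
  rewrite (valid_ts vf) //; case: andP => // -[_ /eqP lt_k].
  by have := term_label_le t; rewrite lt_k ltnn.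
case: nd vf => // vf _ x y Gxy.
have vcase z : seed_label true f v i z != 0 ->
    (z = v /\ movable true f v i /\ seed_label true f v i z = i.+1) \/
    [/\ classed f z, seed_label true f v i z = f z & G v z -> f z = i.+1 \/ z \in ts].
  rewrite /seed_label /=; case: andP => [[/eqP -> mv] _|_]; first by left.
  case: ifP => // Gvz; case: ifP => // fzk fz; right; split=> //.
    by apply: nodeC_classed; rewrite // inE fzk.
  move=> Gz; move: Gvz; rewrite Gz /=; case: eqP => [->|_ /=]; first by left.
  by move/negbT; rewrite negbK; right.
have moved z : movable true f v i -> G v z -> f z = i.+1 \/ z \in ts -> f z = i.+1.
  move=> /andP [_ /allP mv] Gvz [//|/mv]; by rewrite Gvz => /eqP.
move=> /vcase [[ex [mv ->]]|[cx -> Gvx]] /vcase [[ey [mv' ->]]|[cy -> Gvy]] //.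
- by rewrite ex in Gxy; rewrite (moved y) //; apply: Gvy.
- by rewrite ey adjC in Gxy; rewrite (moved x) //; apply: Gvx.
- exact: valid_nonadj vf isT _ _ Gxy cx cy.
Qed.

(** Only the anchored part of [h] is imposed: the vertices that the move cuts off from their
    terminal are labelled afresh. *)
Definition extends (nd : bool) f h := valid nd f /\ forall x, anchored h x -> f x = h x.

(** * Every solution is reached from any other *)

Section Reachability.

Variable nd : bool.

Definition agree f g : rel 'I_n := [rel x y | [&& G x y, f x == f y & g x == g y]].

(** The set P(f) of the overview, for the target [g]. It is enough that both labels be constant
    along the path, since they coincide at the terminal. *)
Definition common f g := [set x | [exists t in ts, connect (agree f g) t x]].

Lemma commonP f g x :
  reflect (exists2 t, t \in ts & connect (agree f g) t x) (x \in common f g).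
Proof. by rewrite inE; exact: exists_inP. Qed.

Lemma common_eq f g x : valid nd f -> valid nd g -> x \in common f g ->
  f x = g x /\ classed g x.
Proof.
move=> vf vg /commonP [t tts tx].
have Pt : [pred z | (f z == g z) && classed g z] t.
  by rewrite /= (valid_ts vf) // (valid_ts vg) // eqxx (classed_ts vg).
have [u v /andP [/eqP fu cu] /and3P [Guv /eqP fuv /eqP guv]|/andP [/eqP fx cx]] // :=
  connect_inv (e' := G) _ Pt tx.
by split=> //; rewrite /= -fuv -guv fu eqxx /classed -guv.
Qed.

(** The move does not damage P(f). In the node version the neighbours of [v] in P(f) have the label
    of [v] in [g], by validity of [g], so they are not discarded. The terminals lie in P(f), so [v]
    is not a terminal and is movable. *)
Lemma seed_label_common f g w v i : valid nd f -> valid nd g ->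
  w \in common f g -> v \notin common f g -> G w v -> g v = g w -> g w = i.+1 ->
  forall x, (x \in common f g) || (x == v) -> seed_label nd f v i x = g x.
Proof.
move=> vf vg wP vP Gwv gvw gw.
have [_ cw] := common_eq vf vg wP.
have cv : classed g v by rewrite /classed gvw.
have tsP t : t \in ts -> t \in common f g by move=> tts; apply/commonP; exists t.
have vts : v \notin ts by apply: contraNN vP => /tsP.
have nbr y : nd -> y \in common f g -> G v y -> f y = i.+1.
  move=> Hnd yP Gvy; have [-> cy] := common_eq vf vg yP.
  by rewrite -gw -gvw (valid_nonadj vg Hnd Gvy).
have mv : movable nd f v i.
  rewrite /movable vts /=; apply/implyP => Hnd; apply/allP => y /tsP yP.
  by apply/implyP => Gvy; rewrite (nbr y).
move=> x /orP [xP|/eqP ->]; last by rewrite /seed_label eqxx mv gvw gw.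
have neq_xv : (x == v) = false by apply: contraNF vP => /eqP <-.
have [fx cx] := common_eq vf vg xP.
rewrite /seed_label neq_xv /= -fx.
case: ifP => [/and4P [Hnd Gvx]|_]; first by rewrite (nbr x) ?eqxx.
case: ifP => // /andP [_ /eqP fxk].
by move: cx; rewrite /classed -fx fxk ltnn andbF.
Qed.

(** The seed [h] coincides with [g] on P(f) and [v], so the paths that witness P(f), prolonged to
    [v], have constant [h]-labels. They are therefore anchored for [h], and [f'] keeps them. *)
Lemma common_extends f g f' w v i : valid nd f -> valid nd g ->
  w \in common f g -> v \notin common f g -> G w v -> g v = g w -> g w = i.+1 ->
  extends nd f' (seed_label nd f v i) -> v |: common f g \subset common f' g.
Proof.
move=> vf vg wP vP Gwv gvw gw [vf' f'h]; set h := seed_label nd f v i in f'h.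
have hg x : (x \in common f g) || (x == v) -> h x = g x.
  exact: seed_label_common vf vg wP vP Gwv gvw gw x.
pose c x := [exists t in ts, connect (agree h g) t x].
have cP x : x \in common f g -> c x.
  move=> /commonP [t tts tx]; apply/exists_inP; exists t => //.
  have Pt : t \in common f g by apply/commonP; exists t.
  have [u v' uP uv|] // := connect_inv (e' := agree h g) _ Pt tx.
  have {}uP : u \in common f g by [].
  have v'P : v' \in common f g.
    have /commonP [t' t'ts t'u] := uP; apply/commonP; exists t' => //.
    exact: connect_trans t'u (connect1 uv).
  split=> //; case/and3P: uv => Guv _ /eqP guv.
  have hu : h u = g u by apply: hg; rewrite uP.
  have hv : h v' = g v' by apply: hg; rewrite v'P.
  by rewrite /agree /= Guv hu hv guv eqxx.
have cv : c v.
  have /exists_inP [t tts tw] := cP _ wP; apply/exists_inP; exists t => //.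
  apply: (connect_trans tw (connect1 _)).
  have hw : h w = g w by apply: hg; rewrite wP.
  have hv : h v = g v by apply: hg; rewrite eqxx orbT.
  by rewrite /agree /= Gwv hw hv gvw eqxx.
have c_sub x : c x -> x \in common f' g.
  move=> /exists_inP [t tts tx]; apply/commonP; exists t => //.
  have ht : connect (same h) t t by apply: connect0.
  have [u v' tu uv|] // := connect_inv (e' := agree f' g) _ ht tx.
  have [Guv /eqP huv /eqP guv] := and3P uv.
  have tv' : connect (same h) t v'.
    by apply: (connect_trans tu (connect1 _)); rewrite /same /= Guv huv eqxx.
  split=> //; rewrite /agree /= Guv guv eqxx andbT !f'h ?huv ?eqxx //.
    by apply/anchoredP; exists t.
  by apply/anchoredP; exists t.
apply/subsetP => x; rewrite !inE -/(common f g) => /orP [/eqP ->|xP]; apply/exists_inP.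
  by apply/commonP/c_sub.
by apply/commonP/c_sub/cP; rewrite inE.
Qed.

(** In the node version a cut vertex of [g] touches two classes of [g], which are contained in those
    of [f], hence it is blocked in [f] too. A class of [f] cannot be larger, because leaving a class
    of [g] means entering the cut of [g]. *)
Lemma common_all f g : 0 < k -> valid nd f -> valid nd g ->
  (forall x, classed g x -> x \in common f g) -> f =1 g.
Proof.
move=> k_gt0 vf vg all_common.
have fg x : classed g x -> f x = g x.
  by move=> /all_common xP; have [] := common_eq vf vg xP.
case: nd vf vg fg => vf vg fg x; last first.
  by apply: fg; apply: valid_edge_classed.
have cut_sub y : g y = k.+1 -> f y = k.+1.
  move=> gy; have [a [b [[Gya Gyb] ca cb neq_ab]]] := valid_blocked vg isT gy.
  have cfa : classed f a by rewrite /classed fg.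
  have cfb : classed f b by rewrite /classed fg.
  have fy : f y != 0 by apply: (valid_out vf _ cfa); rewrite adjC.
  apply/eqP; case: (boolP (f y == _)) => // fyk.
  have cfy : classed f y by apply: nodeC_classed; rewrite ?inE.
  case: neq_ab; rewrite -!fg // -(valid_nonadj vf _ Gya) //.
  by rewrite (valid_nonadj vf _ Gyb).
have fg' y : classed f y -> classed g y.
  move=> cy; have /anchoredP [t tts ty] := valid_anchored vf cy.
  have Pt : [pred z | classed f z & classed g z] t.
    by rewrite /= (classed_ts vf) // (classed_ts vg).
  have [u v /andP [cfu cgu] /andP [Guv /eqP fuv]|/andP []] // :=
    connect_inv (e' := G) _ Pt ty.
  have cfv : classed f v by rewrite /classed -fuv.
  split=> //; rewrite /= cfv; apply: nodeC_classed (valid_out vg Guv cgu) _ => //.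
  rewrite inE; apply/eqP => /cut_sub fv.
  by move: cfv; rewrite /classed fv ltnn andbF.
case: (boolP (classed g x)) => [/fg //|ncg].
have [/eqP gxk|gxk] := boolP (g x == k.+1); first by rewrite gxk cut_sub.
have gx0 : g x = 0.
  by apply/eqP; apply: contraNT ncg => gx; apply: nodeC_classed; rewrite ?inE.
rewrite gx0; apply/eqP; apply: contraNT ncg => fx0.
have [fxk|fxk] := eqVneq (f x) k.+1; last first.
  by apply: fg'; apply: nodeC_classed; rewrite ?inE.
have [a [_ [[Gxa _] /fg' ca _ _]]] := valid_blocked vf isT fxk.
by have := valid_out vg (x := a) (y := x); rewrite gx0 adjC => /(_ Gxa ca).
Qed.

(** Induction on the number of vertices outside P(f). The family [K] stands for the solutions that
    the program has stored. *)
Lemma reachable (K : ('I_n -> nat) -> Prop) f0 g : 0 < k ->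
  K f0 -> (forall f, K f -> valid nd f) ->
  (forall f v i, K f -> i < k ->
     exists2 f', K f' & extends nd f' (seed_label nd f v i)) ->
  valid nd g -> exists2 f, K f & f =1 g.
Proof.
move=> k_gt0 Kf0 Kvalid Ksucc vg.
have [m] := ubnP (#|~: common f0 g|); elim: m f0 Kf0 => // m IH f Kf ltm.
have vf := Kvalid _ Kf.
have [all_common|] := boolP [forall x, classed g x ==> (x \in common f g)].
  exists f => //; apply: common_all => // x cx.
  by have /forallP /(_ x) := all_common; rewrite cx.
rewrite negb_forall => /existsP [x]; rewrite negb_imply => /andP [cx xP].
have /anchoredP [t tts tx] := valid_anchored vg cx.
(* The path from the terminal [t], in P(f), to [x], outside P(f), runs inside a class of [g]; one of
   its edges leaves P(f). *)
have [w [v [wP vP /andP [Gwv /eqP gwv]]]] :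
    exists w v, [/\ w \in common f g, v \notin common f g & same g w v].
  case: (pickP [pred p | [&& p.1 \in common f g, p.2 \notin common f g & same g p.1 p.2]]).
    by move=> [w v] /and3P [wP vP wv]; exists w, v.
  move=> none; case/negP: xP; have tP : t \in common f g by apply/commonP; exists t.
  have [u v uP uv|] // := connect_inv (e' := G) _ tP tx; split; last by case/andP: uv.
  have {}uP : u \in common f g by [].
  by apply/negPn/negP => vP; have := none (u, v); rewrite /= uP vP uv.
have [_ /andP [gw_gt0 gw_le]] := common_eq vf vg wP.
have gwE : g w = (g w).-1.+1 by rewrite prednK.
have [|f' Kf' ext] := Ksucc f v (g w).-1 Kf; first by rewrite -gwE.
apply: (IH f' Kf'); apply: leq_trans _ (ltm : _ <= m).
have sub := common_extends vf vg wP vP Gwv (esym gwv) gwE ext.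
apply: proper_card; rewrite properC; apply/properP; split.
  by apply: subset_trans sub; apply: subsetUr.
by exists v => //; apply: (subsetP sub); rewrite setU11.
Qed.

End Reachability.

End Labels.

(** * Breadth-first growth of the classes *)

Lemma foldl_inv (A : eqType) (S : Type) (J : seq A -> S -> Prop) (op : S -> A -> S) l st :
  (forall d y st', y \in l -> J d st' -> J (rcons d y) (op st' y)) ->
  J [::] st -> J l (foldl op st l).
Proof.
move=> step J0; elim/last_ind: l step => [|l y IH] // step; rewrite foldl_rcons.
apply: (step); first by rewrite mem_rcons mem_head.
apply: IH => d z st' zl; apply: step; by rewrite mem_rcons inE zl orbT.
Qed.

Section Search.

Variables (n : nat) (G : graph n) (ts : seq 'I_n) (nbrs : 'I_n -> seq 'I_n).
Hypothesis mem_nbrs : forall w y, (y \in nbrs w) = G w y.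
Local Notation k := (size ts).
Local Notation term_label := (term_label ts).
Local Notation anchored := (anchored G ts).
Local Notation same := (same G).
Local Notation classed := (classed ts).

(* The labels and the queue of the vertices that have been given one. *)
Definition state := (('I_n -> nat) * seq 'I_n)%type.

Implicit Types (st : state) (f h : 'I_n -> nat) (q : seq 'I_n).

Definition set_label f y v : 'I_n -> nat := fun z => if z == y then v else f z.

Definition visit_seed h w st y : state :=
  if (st.1 y == 0) && (h y == st.1 w) then (set_label st.1 y (st.1 w), rcons st.2 y)
  else st.

Definition visit_grow (nd : bool) w st y : state :=
  if st.1 y == 0 then (set_label st.1 y (st.1 w), rcons st.2 y)
  else if nd && (st.1 y != st.1 w) then (set_label st.1 y k.+1, st.2) else st.

(** A blocked vertex, of label [k.+1], stays in the queue but does not propagate. *)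
Definition scan (visit : 'I_n -> state -> 'I_n -> state) w st :=
  if st.1 w <= k then foldl (visit w) st (nbrs w) else st.

(** * Restriction of the seed classes to the components of their terminals *)

Section Seed.

Variables (nd : bool) (h : 'I_n -> nat).
Hypothesis seedh : seed G ts nd h.

Lemma anchored_classed x : anchored h x -> classed h x.
Proof.
move=> /anchoredP [t tts /same_label hx].
by rewrite /classed -hx seedh.1 // term_label_gt0 // term_label_le.
Qed.

(** The first [j] entries of the queue have been scanned, and the queue consists of exactly the
    labelled vertices. *)
Record seed_inv st j : Prop := SeedInv {
  si_uniq : uniq st.2;
  si_mem : forall x, (x \in st.2) = (st.1 x != 0);
  si_val : forall x, x \in st.2 -> st.1 x = h x /\ anchored h x;
  si_ts : {subset ts <= st.2};
  si_done : forall w y, w \in take j st.2 -> G w y -> h y = h w -> y \in st.2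
}.

Lemma seed_inv_init : uniq ts -> seed_inv (term_label, ts) 0.
Proof.
move=> uts; split=> //= [x|x xts|w y]; last by rewrite take0.
  by rewrite term_label0 negbK.
rewrite seedh.1 //; split=> //; apply/anchoredP; exists x => //; exact: connect0.
Qed.

Lemma seed_inv_scan st j w : seed_inv st j -> j < size st.2 -> nth w st.2 j = w ->
  seed_inv (scan (visit_seed h) w st) j.+1.
Proof.
move=> inv ltj nthj.
have wq : w \in st.2 by rewrite -nthj mem_nth.
have [fw /anchored_classed cw] := si_val inv wq.
rewrite /scan fw; have [_ ->] := andP cw.
pose J (d : seq 'I_n) (st' : state) := [/\ seed_inv st' j, j < size st'.2, nth w st'.2 j = w &
  forall y, y \in d -> h y = h w -> y \in st'.2].
have [{}inv {}ltj {}nthj all_done] :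
    J (nbrs w) (foldl (visit_seed h w) st (nbrs w)).
  apply: foldl_inv => // d y [f q] ynb [inv' ltj' nthj' dP].
  have wq' : w \in q by rewrite -nthj' mem_nth.
  have {}ynb : G w y by rewrite -mem_nbrs.
  have [/= fw' aw] := si_val inv' wq'.
  rewrite /visit_seed /= fw'; case: (eqVneq (f y) 0) => /= [fy|fy]; last first.
    split=> // z; rewrite mem_rcons inE => /orP [/eqP -> _|]; last exact: dP.
    by rewrite (si_mem inv').
  have yq : y \notin q by rewrite (si_mem inv') /= fy.
  case: eqVneq => [hy|/eqP hy]; last first.
    by split=> // z; rewrite mem_rcons inE => /orP [/eqP ->|] //; exact: dP.
  split=> /=.
  - split=> /= [|x|x|x /(si_ts inv') xq|v z].
    + by rewrite rcons_uniq yq (si_uniq inv').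
    + rewrite mem_rcons inE /set_label; case: eqP => [_|_] /=; last exact: (si_mem inv').
      by have /anchored_classed /andP [+ _] := aw; rewrite lt0n => ->.
    + rewrite mem_rcons inE /set_label; case: eqP => [-> _|_] /=; last exact: (si_val inv').
      rewrite hy; split=> //; have /anchoredP [t tts tw] := aw.
      apply/anchoredP; exists t => //; apply: (connect_trans tw (connect1 _)).
      by rewrite /same /= ynb hy eqxx.
    + by rewrite mem_rcons inE xq orbT.
    + rewrite -cats1 takel_cat 1?ltnW // cats1 => vq Gvz hz.
      by rewrite mem_rcons inE (si_done inv' vq Gvz hz) orbT.
  - by rewrite size_rcons ltnW.
  - by rewrite nth_rcons ltj'.
  - move=> z; rewrite !mem_rcons !inE => /orP [-> //|zd /(dP _ zd) ->].
    by rewrite orbT.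
case: inv => uq mq vq tq dq; split=> // v y.
rewrite (take_nth w) // nthj mem_rcons inE => /orP [/eqP ->|]; last exact: dq.
by rewrite -mem_nbrs; apply: all_done.
Qed.

Lemma seed_inv_end st : seed_inv st (size st.2) -> forall x, (x \in st.2) = anchored h x.
Proof.
move=> inv x; apply/idP/anchoredP => [/(si_val inv) [_ /anchoredP //]|[t /(si_ts inv) tq tx]].
have [u v uq /andP [Guv /eqP huv]|] // :=
  connect_inv (e' := G) (P := [pred x | x \in st.2]) _ tq tx.
by split=> //; apply: (si_done inv _ Guv); rewrite ?take_size.
Qed.

(** * Greedy growth with blocking *)

Section Grow.

Variable q0 : seq 'I_n.
Hypothesis mem_q0 : forall x, (x \in q0) = anchored h x.

(* The classes of the settled vertices are final. *)
Definition settled q a x := (x \in q0) || (x \in take a q).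

Definition same_settled f q a : rel 'I_n :=
  [rel x y | [&& settled q a x, settled q a y & same f x y]].

Record grow_inv st a j : Prop := GrowInv {
  gi_uniq : uniq st.2;
  gi_mem : forall x, (x \in st.2) = (st.1 x != 0);
  gi_pre : exists r, st.2 = q0 ++ r;
  gi_le : forall x, st.1 x <= k + nd;
  gi_seed : forall x, x \in q0 -> st.1 x = h x;
  gi_done : forall w y, w \in take j st.2 -> st.1 w <= k -> G w y ->
    st.1 y != 0 /\ (nd -> st.1 y <> st.1 w -> st.1 y = k.+1);
  gi_anch : forall x, settled st.2 a x -> st.1 x <= k ->
    exists2 t, t \in ts & connect (same_settled st.1 st.2 a) t x;
  gi_parent : forall x, x \in st.2 -> st.1 x <= k -> ~~ settled st.2 a x ->
    exists w, [/\ settled st.2 a w, G w x & st.1 w = st.1 x];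
  gi_blocked : nd -> forall x, st.1 x = k.+1 -> exists y z,
    [/\ settled st.2 a y /\ settled st.2 a z, G x y /\ G x z,
        st.1 y <= k /\ st.1 z <= k & st.1 y <> st.1 z]
}.

Lemma grow_inv_init f : (forall x, (x \in q0) = (f x != 0)) -> uniq q0 ->
  (forall x, x \in q0 -> f x = h x) -> grow_inv (f, q0) 0 0.
Proof.
move=> mem_f uq fh.
have fk x : f x <= k.
  case: (boolP (x \in q0)) => xq; last by move: xq; rewrite mem_f negbK => /eqP ->.
  by rewrite fh //; move: xq; rewrite mem_q0 => /anchored_classed /andP [].
have setE x : settled q0 0 x = (x \in q0) by rewrite /settled take0 orbF.
split=> //= [|x|w y|x|x|_ x fx].
- by exists [::]; rewrite cats0.
- by rewrite (leq_trans (fk x)) ?leq_addr.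
- by rewrite take0.
- rewrite setE mem_q0 => /anchoredP [t tts tx] _; exists t => //.
  have [u v hu uv|] // := connect_inv (e' := same_settled f q0 0) _ (connect0 (same h) t) tx.
  have hv := connect_trans hu (connect1 uv).
  have uq0 : u \in q0 by rewrite mem_q0; apply/anchoredP; exists t.
  have vq0 : v \in q0 by rewrite mem_q0; apply/anchoredP; exists t.
  by split=> //; rewrite /same_settled /same /= !setE uq0 vq0 !fh.
- by move=> xq _; rewrite setE xq.
- by have := fk x; rewrite fx ltnn.
Qed.

Lemma settled_mem st a j x : grow_inv st a j -> settled st.2 a x -> x \in st.2.
Proof.
move=> inv /orP [xq0|/mem_take //].
by have [r ->] := gi_pre inv; rewrite mem_cat xq0.
Qed.

Lemma settled_rcons q a x y : a <= size q -> settled (rcons q y) a x = settled q a x.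
Proof. by move=> lea; rewrite /settled -cats1 takel_cat. Qed.

(** When its turn comes, [w] inherits an anchoring path from its settled parent, unless it was
    already settled as a seed. *)
Lemma grow_inv_settle st j w : grow_inv st j j -> j < size st.2 -> nth w st.2 j = w ->
  grow_inv st j.+1 j.
Proof.
move=> inv ltj nthj.
have setS x : settled st.2 j.+1 x = (x == w) || settled st.2 j x.
  by rewrite /settled (take_nth w) // nthj mem_rcons inE orbCA.
have wq : w \in st.2 by rewrite -nthj mem_nth.
have up x : settled st.2 j x -> settled st.2 j.+1 x by rewrite setS orbC => ->.
have upc t x : connect (same_settled st.1 st.2 j) t x -> connect (same_settled st.1 st.2 j.+1) t x.
  apply: connect_sub => u v /and3P [su sv suv]; apply: connect1.
  by rewrite /same_settled /= !up.
case: (inv) => uq mq pq leq sq dq aq papaq bq; split=> // [x sx fx|x xq fx|Hnd x fx].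
- case: (boolP (settled st.2 j x)) => [/aq /(_ fx) [t tts tx]|nsx].
    by exists t => //; apply: upc.
  have Dx : x = w by move: sx; rewrite setS (negPf nsx) orbF => /eqP.
  have [|u [su Gux fux]] := papaq x _ fx nsx; first by rewrite Dx.
  have [|t tts tu] := aq u su; first by rewrite fux.
  exists t => //; apply: (connect_trans (upc _ _ tu) (connect1 _)).
  by rewrite /same_settled /same /= sx up //= Gux fux eqxx.
- rewrite setS negb_or => /andP [_ /(papaq x xq fx)] [u [su Gux fux]].
  by exists u; rewrite up.
- have [y [z [[sy sz] Gxyz fyz neq]]] := bq Hnd x fx.
  by exists y, z; rewrite !up.
Qed.

(** A newly labelled vertex gets [w] as its parent. The delicate case is blocking, which would break
    anchoring paths if it hit a settled vertex. *)
Lemma grow_inv_visit st j w y : grow_inv st j.+1 j -> j < size st.2 ->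
  nth w st.2 j = w -> st.1 w <= k -> G w y ->
  grow_inv (visit_grow nd w st y) j.+1 j.
Proof.
case: st => f q /= inv ltj nthj fwk Gwy.
have wq : w \in q by rewrite -nthj mem_nth.
have fw0 : f w != 0 by rewrite -(gi_mem inv).
have sw : settled q j.+1 w.
  by rewrite /settled (take_nth w) // nthj mem_rcons mem_head orbT.
have neq_yw : y != w by apply: contraTneq Gwy => ->; rewrite (adj_irr G).
have done_settled x : x \in take j q -> settled q j.+1 x.
  by rewrite /settled (take_nth w) // mem_rcons inE => ->; rewrite !orbT.
have set_connect f' : (forall x, settled q j.+1 x -> f' x = f x) ->
    connect (same_settled f' q j.+1) =2 connect (same_settled f q j.+1).
  move=> f'f; apply: eq_connect => u v; rewrite /same_settled /=.
  by case: (boolP (settled q j.+1 u)) => su //=; case: (boolP (settled q j.+1 v)) => sv //=;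
    rewrite /same /= !f'f.
rewrite /visit_grow /=; have [fy|fy] := eqVneq (f y) 0.
  have yq : y \notin q by rewrite (gi_mem inv) /= fy.
  have set_neq x : settled q j.+1 x -> (x == y) = false.
    by move/(settled_mem inv) => /= xq; apply: contraNF yq => /eqP <-.
  pose f' := set_label f y (f w).
  have f'f x : settled q j.+1 x -> f' x = f x by rewrite /f' /set_label => /set_neq ->.
  have setE x : settled (rcons q y) j.+1 x = settled q j.+1 x by rewrite settled_rcons.
  have relE t x : connect (same_settled f' (rcons q y) j.+1) t x = connect (same_settled f q j.+1) t x.
    rewrite -(set_connect f') //; apply: eq_connect => u v.
    by rewrite /same_settled /= !setE.
  split=> /=; rewrite -?/f'.
  - by rewrite rcons_uniq yq (gi_uniq inv).
  - move=> x; rewrite mem_rcons inE /f' /set_label; case: (x =P y) => //= _; exact: (gi_mem inv).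
  - by have [r /= ->] := gi_pre inv; exists (rcons r y); rewrite rcons_cat.
  - move=> x; rewrite /f' /set_label; case: eqP => _; last exact: (gi_le inv).
    by rewrite (leq_trans fwk) ?leq_addr.
  - move=> x xq0; rewrite f'f; first exact: (gi_seed inv).
    by rewrite /settled xq0.
  - move=> v z; rewrite -cats1 takel_cat; last exact: ltnW.
    move=> vq; rewrite f'f ?done_settled // => fv Gvz.
    have [/= fz0 fzP] := gi_done inv vq fv Gvz.
    by rewrite /f' /set_label; case: (z =P y) => // Dz; rewrite Dz fy in fz0.
  - move=> x; rewrite setE => sx; rewrite f'f // => fx.
    by have [t tts tx] := gi_anch inv sx fx; exists t => //; rewrite relE.
  - move=> x; rewrite mem_rcons inE setE /f' /set_label.
    case: eqP => [-> _ _ nsy|_ /= xq fx nsx].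
      by exists w; rewrite setE eq_sym (negPf neq_yw).
    have [u [su Gux fux]] := gi_parent inv xq fx nsx.
    by exists u; rewrite setE -/f' set_neq.
  - move=> Hnd x; rewrite {1}/f' /set_label; case: eqP => [_ fwE|_ fx].
      by rewrite fwE ltnn in fwk.
    have [u [v [[su sv] Gxuv fuv neq]]] := gi_blocked inv Hnd fx.
    by exists u, v; rewrite !setE !f'f.
case: ifP => // /andP [Hnd neq_f].
have [fyk|fyk] := eqVneq (f y) k.+1.
  suff -> : set_label f y k.+1 = f by [].
  by apply: functional_extensionality => x; rewrite /set_label; case: eqP => // ->.
have yk : f y <= k by have := gi_le inv y; rewrite Hnd addn1 leq_eqVlt (negPf fyk).
(* Had [y] been scanned already, its neighbour [w], whose label differs, would be blocked by
   [gi_done], against [fwk]. There remains the case of a seed [y] still waiting. *)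
have nsy : ~~ settled q j.+1 y.
  apply/negP; rewrite /settled (take_nth w) // nthj mem_rcons inE (negPf neq_yw) /=.
  case: (boolP (y \in take j q)) => [ytake _|ytake].
    have [|/= _ /(_ Hnd) fwE] := gi_done inv (y := w) ytake yk; first by rewrite adjC.
    by move: fwk; rewrite fwE ?ltnn //; apply/eqP; rewrite eq_sym.
  (* The queue is first-in first-out: if the seed [y] is still to be scanned,
     then [w] is a seed too. *)
  rewrite orbF => yq0; case/eqP: neq_f.
  have wq0 : w \in q0.
    have [r /= Dq] := gi_pre inv.
    suff ltj0 : j < size q0 by rewrite -nthj Dq nth_cat ltj0 mem_nth.
    rewrite ltnNge; apply: contraNN ytake => le0j.
    by rewrite Dq take_cat ltnNge le0j /= mem_cat yq0.
  have [/= -> ->] := (gi_seed inv yq0, gi_seed inv wq0).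
  have nz x : x \in q0 -> h x != 0.
    by rewrite mem_q0 => /anchored_classed /andP [+ _]; rewrite lt0n.
  by apply: seedh.2; rewrite ?nz // adjC.
have set_neq x : settled q j.+1 x -> (x == y) = false.
  by move=> sx; apply: contraNF nsy => /eqP <-.
pose f' := set_label f y k.+1.
have f'f x : settled q j.+1 x -> f' x = f x by rewrite /f' /set_label => /set_neq ->.
have yq : y \in q by rewrite (gi_mem inv).
split=> /=; rewrite -?/f'.
- exact: gi_uniq inv.
- move=> x; rewrite /f' /set_label; case: (x =P y) => [->|_] /=; first by rewrite yq.
  exact: (gi_mem inv).
- exact: gi_pre inv.
- move=> x; rewrite /f' /set_label Hnd addn1; case: eqP => _ //.
  by have := gi_le inv x; rewrite Hnd addn1.
- move=> x xq0; rewrite f'f; first exact: (gi_seed inv).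
  by rewrite /settled xq0.
- move=> v z vq; rewrite f'f ?done_settled // => fv Gvz.
  have [/= fz0 fzP] := gi_done inv vq fv Gvz.
  by rewrite /f' /set_label; case: (z =P y).
- move=> x sx; rewrite f'f // => fx.
  have [t tts tx] := gi_anch inv sx fx; exists t => //.
  by rewrite (set_connect f').
- move=> x xq; rewrite {1 3}/f' /set_label; case: eqP => [_|_ fx nsx]; first by rewrite ltnn.
  have [u [su Gux fux]] := gi_parent inv xq fx nsx.
  by exists u; rewrite f'f.
(* The two classes that meet at [y] are shown by [w] and by the parent of [y], which still carries
   the label that [y] loses. *)
- move=> _ x; rewrite {1}/f' /set_label; case: eqP => [-> _|_ fx].
    have [u [su Guy /= fuy]] := gi_parent inv yq yk nsy.
    exists w, u; rewrite !f'f // !(adjC G y) Gwy Guy fwk; split=> //.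
      by rewrite fuy.
    by rewrite fuy; apply/eqP; rewrite eq_sym.
  have [u [v [[su sv] Gxuv fuv neq]]] := gi_blocked inv Hnd fx.
  by exists u, v; rewrite !f'f.
Qed.

(** While [w] is scanned, a neighbour that has been dealt with remains so, and [w] keeps its label
    since [y] differs from it. *)
Lemma visit_grow_mono w st y z : st.1 w <= k -> st.1 w != 0 -> y != w ->
  let st' := visit_grow nd w st y in
  let good (s : state) x := s.1 x != 0 /\ (nd -> s.1 x <> s.1 w -> s.1 x = k.+1) in
  [/\ st'.1 w = st.1 w, good st' y & good st z -> good st' z].
Proof.
case: st => f q /= fwk fw neq_yw; rewrite /visit_grow /=.
have neq_wy : (w == y) = false by rewrite eq_sym (negPf neq_yw).
have [fy|fy] := eqVneq (f y) 0.
  rewrite /= /set_label eqxx neq_wy; split=> // [[fz zP]].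
  by case: (z =P y) => // Dz; rewrite Dz fy in fz.
case: ifP => [_|cond] /=.
  rewrite /set_label eqxx neq_wy; split=> // [[fz zP]].
  by case: (z =P y).
by split=> //; split=> // Hnd /eqP neq; rewrite Hnd neq in cond.
Qed.

Lemma visit_grow_queue w st y : exists r, (visit_grow nd w st y).2 = st.2 ++ r.
Proof.
rewrite /visit_grow; case: ifP => _ /=; first by exists [:: y]; rewrite cats1.
by case: ifP => _ /=; exists [::]; rewrite cats0.
Qed.

Lemma grow_inv_scan st j w : grow_inv st j j -> j < size st.2 -> nth w st.2 j = w ->
  grow_inv (scan (visit_grow nd) w st) j.+1 j.+1.
Proof.
move=> inv ltj nthj; have inv' := grow_inv_settle inv ltj nthj.
pose good (s : state) x := s.1 x != 0 /\ (nd -> s.1 x <> s.1 w -> s.1 x = k.+1).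
have close s : grow_inv s j.+1 j -> j < size s.2 -> nth w s.2 j = w ->
    (s.1 w <= k -> forall y, G w y -> good s y) -> grow_inv s j.+1 j.+1.
  move=> [uq mq pq leq sq dq aq paq bq] lts nths gs; split=> // v y.
  rewrite (take_nth w) // nths mem_rcons inE => /orP [/eqP -> fw|]; last exact: dq.
  exact: gs.
rewrite /scan; case: (leqP (st.1 w) k) => fwk; last first.
  by apply: close => //; rewrite leqNgt fwk.
have fw0 : st.1 w != 0 by rewrite -(gi_mem inv) -nthj mem_nth.
pose J (d : seq 'I_n) (s : state) := [/\ grow_inv s j.+1 j, j < size s.2 /\ nth w s.2 j = w, s.1 w = st.1 w &
  forall y, y \in d -> good s y].
have [{}inv' [{}ltj {}nthj] _ all_good] : J (nbrs w) (foldl (visit_grow nd w) st (nbrs w)).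
  apply: foldl_inv => // d y s ynb [invs [lts nths] fws dP].
  have {}ynb : G w y by rewrite -mem_nbrs.
  have neq_yw : y != w by apply: contraTneq ynb => ->; rewrite (adj_irr G).
  have [r Dr] := visit_grow_queue w s y.
  split.
  - by apply: grow_inv_visit => //; rewrite fws.
  - by rewrite Dr size_cat ltn_addr // nth_cat lts.
  - by rewrite -fws; have [] // := @visit_grow_mono w s y y; rewrite fws.
  - move=> z; rewrite mem_rcons inE => /orP [/eqP ->|/dP zP].
      by have [] // := @visit_grow_mono w s y y; rewrite fws.
    by have [|||_ _ mono] // := @visit_grow_mono w s y z; rewrite ?fws //; apply: mono.
by apply: close => // _ y; rewrite -mem_nbrs; apply: all_good.
Qed.

(** Once the queue is exhausted all its vertices are settled, and the fields of the invariant turn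
    into those of [valid]. *)
Lemma grow_inv_end st : let m := size st.2 in
  grow_inv st m m -> extends G ts nd st.1 h.
Proof.
case: st => f q /= inv.
have setE x : settled q (size q) x = (x \in q).
  apply/idP/idP => [|xq]; last by rewrite /settled take_size xq orbT.
  exact: (settled_mem inv).
have classedE x : classed f x -> x \in q by case/andP; rewrite (gi_mem inv) /= lt0n.
split=> [|x]; last by rewrite -mem_q0 => /(gi_seed inv).
split=> [x|t tts|x cx|x y Gxy cx|Hnd x y Gxy cx cy|Hnd x fx].
- exact: (gi_le inv).
- have tq0 : t \in q0 by rewrite mem_q0; apply/anchoredP; exists t => //; exact: connect0.
  by have /= -> := gi_seed inv tq0; apply: seedh.1.
- have [||t tts tx] := gi_anch inv (x := x); rewrite ?setE ?classedE //.
    by case/andP: cx.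
  apply/anchoredP; exists t => //; apply: connect_sub tx => u v /and3P [_ _ uv].
  exact: connect1.
- have [||fy _] // := gi_done inv (w := x) _ _ Gxy; first by rewrite take_size classedE.
  by case/andP: cx.
- have [||_ /(_ Hnd) /= H] := gi_done inv (w := x) _ _ Gxy.
  + by rewrite take_size classedE.
  + by case/andP: cx.
  + apply/eqP; apply: contraTT cy => /eqP neq.
    by rewrite /classed H ?ltnn ?andbF // => /esym.
- have [y [z [[sy sz] Gxyz [fy fz] neq]]] := gi_blocked inv Hnd fx.
  exists y, z; rewrite /classed fy fz !lt0n -!(gi_mem inv); split=> //.
    by rewrite -setE sy.
  by rewrite -setE sz.
Qed.

End Grow.
End Seed.
End Search.

(** * The program *)

(* Arrays 0 to 3 hold the input. Row [w] of [aNbr], of width [m], lists the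
   neighbours of [w], and row [r] of [aRow], of width [n], the labels of the
   [r]-th solution. *)
Local Notation aSize := 0.
Local Notation aSrc := 1.
Local Notation aDst := 2.
Local Notation aTerm := 3.
Local Notation aDeg := 4.
Local Notation aNbr := 5.
Local Notation aTl := 6.
Local Notation aNear := 7.
Local Notation aQ := 8.
Local Notation aQt := 9.
Local Notation aQh := 10.
Local Notation aW := 11.
Local Notation aD := 12.
Local Notation aY := 13.
Local Notation aSeed := 14.
Local Notation aX := 15.
Local Notation aV := 16.
Local Notation aI := 17.
Local Notation aBad := 18.
Local Notation aChild := 19.
Local Notation aCount := 20.
Local Notation aCur := 21.
Local Notation aNew := 22.
Local Notation aRow := 23.
Local Notation aRows := 24.
Local Notation aHead := 25.
Local Notation aJ := 26.

Local Notation var a := (Get a (Num 0)).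
Local Notation "a ::= e" := (Assign a (Num 0) e) (at level 70).
Local Notation "e1 +' e2" := (Bin Add e1 e2) (at level 50, left associativity).
Local Notation "e1 *' e2" := (Bin Mul e1 e2) (at level 40, left associativity).
Local Notation "c1 ;; c2" := (Seq c1 c2) (at level 75, right associativity).
Local Notation eN := (Get aSize (Num 0)).
Local Notation eM := (Get aSize (Num 1)).
Local Notation eK := (Get aSize (Num 2)).

Definition link eu ev :=
  Assign aNbr (eu *' eM +' Get aDeg eu) ev ;;
  Assign aDeg eu (Get aDeg eu +' Num 1).

Definition build_nbrs :=
  For aJ eM (link (Get aSrc (var aJ)) (Get aDst (var aJ)) ;;
             link (Get aDst (var aJ)) (Get aSrc (var aJ))).

Definition build_labels :=
  For aJ eK (Assign aTl (Get aTerm (var aJ)) (var aJ +' Num 1)).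

Definition visit_new :=
  Assign aNear (var aY) (Get aNear (var aW)) ;;
  Assign aQ (var aQt) (var aY) ;;
  aQt ::= var aQt +' Num 1.

Definition visit_seed_cmd :=
  If (Get aNear (var aY)) Skip
    (If (Bin Eq (Get aSeed (var aY)) (Get aNear (var aW))) visit_new Skip).

Definition visit_grow_cmd (nd : bool) :=
  If (Get aNear (var aY))
    (if nd then
       If (Bin Eq (Get aNear (var aY)) (Get aNear (var aW))) Skip
         (Assign aNear (var aY) (eK +' Num 1))
     else Skip)
    visit_new.

Definition search visit :=
  aQh ::= Num 0 ;;
  While (Bin Lt (var aQh) (var aQt))
    ((aW ::= Get aQ (var aQh) ;; aQh ::= var aQh +' Num 1) ;;
     If (Bin Lt (Get aNear (var aW)) (eK +' Num 1))
       (For aD (Get aDeg (var aW))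
          (aY ::= Get aNbr (var aW *' eM +' var aD) ;; visit))
       Skip).

(** The second search rewinds the queue left by the first one: it then holds precisely the anchored
    seed vertices, with their labels in [aNear]. *)
Definition extend (nd : bool) :=
  For aX eN (Assign aNear (var aX) (Num 0)) ;;
  For aJ eK (Assign aNear (Get aTerm (var aJ)) (var aJ +' Num 1) ;;
             Assign aQ (var aJ) (Get aTerm (var aJ))) ;;
  aQt ::= eK ;;
  search visit_seed_cmd ;;
  search (visit_grow_cmd nd).

Definition row_entry ex := Get aRow (var aHead *' eN +' ex).

Definition copy_row (nd : bool) :=
  let e := row_entry (var aX) in
  For aX eN (Assign aSeed (var aX)
    (if nd then Bin Sub e (Bin Eq e (eK +' Num 1) *' e) else e)).

Definition detach :=
  For aD (Get aDeg (var aV))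
    (aY ::= Get aNbr (var aV *' eM +' var aD) ;;
     If (Bin Eq (row_entry (var aY)) (var aI +' Num 1)) Skip
       (If (Get aTl (var aY)) (aBad ::= Num 1) (Assign aSeed (var aY) (Num 0)))).

(** Before the last test, [aBad] is nonzero exactly when the move of [v] is not [movable]. *)
Definition make_seed (nd : bool) :=
  copy_row nd ;;
  aBad ::= Get aTl (var aV) ;;
  (if nd then detach else Skip) ;;
  If (var aBad) Skip (Assign aSeed (var aV) (var aI +' Num 1)).

Definition child := var aCur *' (eK +' Num 2) +' var aJ.

Definition insert_step :=
  aJ ::= Get aNear (var aX) ;;
  If (Get aChild child) Skip
    (aCount ::= var aCount +' Num 1 ;;
     Assign aChild child (var aCount) ;;
     aNew ::= Num 1) ;;
  aCur ::= Get aChild child.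

(** [aNew] records that the descent created a node. As all words have length [n], this happens
    exactly when the word is new. *)
Definition insert :=
  (aCur ::= Num 0 ;; aNew ::= Num 0) ;;
  For aX eN insert_step ;;
  If (var aNew)
    (For aX eN (Assign aRow (var aRows *' eN +' var aX) (Get aNear (var aX))) ;;
     aRows ::= var aRows +' Num 1)
    Skip.

Definition neighbour nd := make_seed nd ;; extend nd ;; insert.

Definition process nd := For aV eN (For aI eK (neighbour nd)).

Definition output (nd : bool) :=
  if nd then For aX eN (If (Bin Eq (row_entry (var aX)) (eK +' Num 1)) (Out (var aX)) Skip)
  else For aJ eM (If (Bin Eq (Bin Eq (row_entry (Get aSrc (var aJ)))
                                     (row_entry (Get aDst (var aJ)))) (Num 0))
                    (Out (var aJ)) Skip).

Definition check (nd : bool) :=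
  if nd then
    For aJ eM (If (Get aTl (Get aSrc (var aJ)))
                 (If (Get aTl (Get aDst (var aJ))) (aBad ::= Num 1) Skip) Skip)
  else Skip.

Definition start nd :=
  For aX eN (Assign aSeed (var aX) (Get aTl (var aX))) ;; extend nd ;; insert.

(** The stored rows are themselves the queue of the traversal: [aHead] points to the next solution
    to print and [process] appends the new ones. *)
Definition main_loop nd :=
  While (Bin Lt (var aHead) (var aRows))
    (output nd ;; End ;; process nd ;; aHead ::= var aHead +' Num 1).

Definition multiway_cuts nd :=
  If (Bin Lt (Num 1) eK)
    ((build_nbrs ;; build_labels ;; check nd) ;;
     If (var aBad) Skip (start nd ;; main_loop nd))
    End.

Lemma slow_multiway_cuts nd : slow (multiway_cuts nd).
Proof. by case: nd. Qed.

Lemma addr_inj w r x r' x' : x < w -> x' < w ->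
  (r * w + x == r' * w + x') = (r == r') && (x == x').
Proof.
move=> ltx ltx'; apply/eqP/andP => [eq_a|[/eqP -> /eqP -> //]].
have w_gt0 : 0 < w by apply: leq_ltn_trans ltx.
have := congr1 (divn^~ w) eq_a; have := congr1 (modn^~ w) eq_a.
by rewrite /= !modnMDl !divnMDl // !modn_small // !divn_small // !addn0 => -> ->.
Qed.

(** * Linear-time searches and extension of a seed *)

Section Correctness.

Variables (n : nat) (G : graph n) (es : seq ('I_n * 'I_n)) (ts : seq 'I_n).
Hypothesis uniq_ts : uniq ts.
Local Notation k := (size ts).
Local Notation m := (size es).
Local Notation tl := (term_label ts).
Implicit Types (s : store) (f h : 'I_n -> nat) (x y v w : 'I_n).

(** Each list is in the order in which [build_nbrs] appends the neighbours. *)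
Definition nbrs_in (ps : seq ('I_n * 'I_n)) w : seq 'I_n :=
  flatten [seq (if p.1 == w then [:: p.2] else [::]) ++
               (if p.2 == w then [:: p.1] else [::]) | p <- ps].

Local Notation nbrs := (nbrs_in es).
Hypothesis mem_nbrs : forall w y, (y \in nbrs w) = G w y.

Lemma nbrs_rcons ps p w : nbrs_in (rcons ps p) w =
  nbrs_in ps w ++ (if p.1 == w then [:: p.2] else [::]) ++
                  (if p.2 == w then [:: p.1] else [::]).
Proof. by rewrite /nbrs_in map_rcons flatten_rcons. Qed.

Lemma sum_nbrs ps : \sum_w size (nbrs_in ps w) = (size ps).*2.
Proof.
elim/last_ind: ps => [|ps p IH]; first by rewrite big1.
have one v : \sum_w (v == w) = 1 :> nat.
  by rewrite (bigD1 v) //= eqxx big1 // => w /negPf; rewrite eq_sym => ->.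
rewrite size_rcons doubleS -IH -addn2.
transitivity (\sum_w (size (nbrs_in ps w) + ((p.1 == w) + (p.2 == w)))).
  by apply: eq_bigr => w _; rewrite nbrs_rcons !size_cat; do 2!case: ifP.
by rewrite !big_split /= !one.
Qed.

(** The input and the tables derived from it occupy the arrays 0 to 6. They are final after the
    set-up, since all later commands write to arrays from 7 on. *)
Record static s : Prop := Static {
  s_n : s aSize 0 = n;
  s_m : s aSize 1 = m;
  s_k : s aSize 2 = k;
  s_edges : forall j p, j < m -> s aSrc j = (nth p es j).1 /\ s aDst j = (nth p es j).2;
  s_terms : forall i x, i < k -> s aTerm i = nth x ts i;
  s_deg : forall w, s aDeg w = size (nbrs w);
  s_nbr : forall w d x, d < size (nbrs w) -> s aNbr (w * m + d) = nth x (nbrs w) d;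
  s_tl : forall x, s aTl x = tl x
}.

Lemma static_frame l s s' : (forall a, a \notin l -> s' a = s a) ->
  all (leq 7) l -> static s -> static s'.
Proof.
move=> fr /allP l7 [sn sm sk se st sd sb sl].
have fr' a : a < 7 -> s' a = s a.
  by rewrite ltnNge => a7; apply: fr; apply: contraNN a7 => /l7.
by split; rewrite ?fr'.
Qed.

Lemma static_upd s a i u : 6 < a -> static s -> static (upd s a i u).
Proof.
move=> a7; apply: (static_frame (l := [:: a])); last by rewrite /= a7.
move=> b; rewrite inE => /negPf ab.
by apply: functional_extensionality => j; rewrite /upd ab.
Qed.

Definition labels a s f := forall x, s a x = f x.

Definition represents (st : state n) s :=
  [/\ labels aNear s st.1, s aQt 0 = size st.2 &
      forall i x, i < size st.2 -> s aQ i = nth x st.2 i].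

Section SearchSpec.

Variables (vc : cmd) (visit : 'I_n -> state n -> 'I_n -> state n).
Variables (h : 'I_n -> nat) (Inv : state n -> nat -> Prop).

Hypothesis vc_written : all (mem [:: aNear; aQ; aQt]) (written vc).
Hypothesis vc_spec : forall s st w y, static s -> labels aSeed s h ->
  represents st s -> s aW 0 = w -> s aY 0 = y ->
  wp vc (represents (visit w st y)) s.
Hypothesis visit_queue : forall w st y, exists r, (visit w st y).2 = st.2 ++ r.
Hypothesis Inv_uniq : forall st j, Inv st j -> uniq st.2.
Hypothesis Inv_scan : forall st j w, Inv st j -> j < size st.2 -> nth w st.2 j = w ->
  Inv (scan ts nbrs visit w st) j.+1.

Lemma vc_out a : a \notin [:: aNear; aQ; aQt] -> a \notin written vc.
Proof. by apply: contraNN => /(allP vc_written). Qed.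

Let K := straight_cost vc + 8.

(** Amortised analysis: the budget [rest] grants [K * (1 + deg w)] to each vertex [w] not scanned
    yet. The queue has no duplicates, so a vertex pays once, and the degrees sum to 2m. *)
Lemma search_spec s st : static s -> labels aSeed s h -> represents st s -> Inv st 0 ->
  runs (search vc) (fun s' => exists2 st', represents st' s' & Inv st' (size st'.2))
    (2 + K * (n + m.*2)) s.
Proof.
move=> Ss Bs Rs I0.
pose rest (q : seq 'I_n) j := \sum_(w | w \notin take j q) K * (1 + size (nbrs w)).
pose J b s := exists st j, [/\ static s /\ labels aSeed s h, represents st s,
  Inv st j, s aQh 0 = j /\ j <= size st.2 & b = 1 + rest st.2 j].
have rest0 q : rest q 0 = K * (n + m.*2).
  rewrite /rest take0 -big_distrr /= big_split /= sum1_card sum_nbrs.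
  by rewrite (eq_card (_ : _ =i 'I_n)) ?card_ord.
rewrite -[2]/(1 + 1) -addnA; apply: (runs_seq (R := J (1 + rest st.2 0))); last first.
  move=> s1 J1; rewrite -(rest0 st.2); apply: (runs_while (I := J)) J1.
    move=> b s2 [st2 [j [[S2 B2] R2 I2 [Qh2 lej] ->]]] /=.
    have [N2 Qt2 Q2] := R2; rewrite Qh2 Qt2 eqb0 negbK => ltj.
    have [w nthj] : exists w, nth w st2.2 j = w.
      case: (st2.2) ltj => // w0 q' ltj; exists (nth w0 (w0 :: q') j).
      by apply: set_nth_default.
    have wq : w \in st2.2 by rewrite -nthj mem_nth.
    have rest_S : rest st2.2 j = K * (1 + size (nbrs w)) + rest st2.2 j.+1.
      rewrite /rest (bigD1 w) /=; last first.
        rewrite -nthj in_take_leq ?index_uniq ?(Inv_uniq I2) ?ltnn //; exact: ltnW.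
      congr (_ + _); apply: eq_bigl => x.
      by rewrite (take_nth w) // nthj mem_rcons inE negb_or andbC.
    exists (2 + (3 + size (nbrs w) * (straight_cost vc + 3))), (1 + rest st2.2 j.+1).
    split; first by rewrite rest_S /K; nia.
    pose R s3 := [/\ static s3, labels aSeed s3 h, represents st2 s3, s3 aW 0 = w & s3 aQh 0 = j.+1].
    apply: (runs_seq (R := R)) => [|s3 [S3 B3 R3 W3 Qh3]].
      apply: (@runs_wp (_ ;; _)) => /=; split.
      - by do 2!apply: static_upd => //.
      - exact: B2.
      - exact: R2.
      - by rewrite /upd /= Qh2 (Q2 _ w) // nthj.
      - by rewrite /upd /= Qh2 addn1.
    pose Q s' := exists2 st', represents st' s' /\ s' aQh 0 = j.+1 &
      st' = scan ts nbrs visit w st2.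
    suff : runs (If (Bin Lt (Get aNear (var aW)) (eK +' Num 1))
       (For aD (Get aDeg (var aW))
          (aY ::= Get aNbr (var aW *' eM +' var aD) ;; vc)) Skip) Q
       (3 + size (nbrs w) * (straight_cost vc + 3)) s3.
      move=> run; apply: runs_mono (runs_frame_in (l := [:: aD; aY; aNear; aQ; aQt]) run _) _ _ => //.
        rewrite /= cats0 all_cat /= andbT; apply: sub_all vc_written => a.
        by rewrite /= !inE => ->; rewrite !orbT.
      move=> s4 [[st4 [R4 Qh4] Dst4] fr4].
      have I4 := Inv_scan I2 ltj nthj; rewrite -Dst4 in I4.
      have [r Dr] : exists r, st4.2 = st2.2 ++ r.
        rewrite Dst4 /scan; case: ifP => _; last by exists [::]; rewrite cats0.
        elim/last_ind: (nbrs w) => [|l y [r IH]]; first by exists [::]; rewrite cats0.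
        rewrite foldl_rcons; have [r' ->] := visit_queue w (foldl (visit w) st2 l) y.
        by exists (r ++ r'); rewrite IH catA.
      exists st4, j.+1; split=> //.
      - by split; [exact: (static_frame fr4 isT S3) | move=> x; rewrite fr4].
      - by rewrite Dr size_cat (leq_trans ltj) ?leq_addr.
      - by rewrite /rest Dr takel_cat.
    apply: runs_if => /=; have [N3 _ _] := R3; rewrite W3 N3 (s_k S3) addn1 ltnS eqb0 negbK.
    rewrite /Q /scan; case: ifP => fwk; last first.
      by apply: runs_skip; exists st2.
    have runF := @runs_for aD (Get aDeg (var aW)) (aY ::= Get aNbr (var aW *' eM +' var aD) ;; vc)
      (fun d s' => represents (foldl (visit w) st2 (take d (nbrs w))) s')
      (size (nbrs w)) (straight_cost vc).+1 s3.
    have Qh_out : aQh \notin aD :: aY :: written vc by rewrite !inE /= vc_out.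
    have D_out : aD \notin aY :: written vc by rewrite !inE /= vc_out.
    have stat l : l = aD :: aY :: written vc -> all (leq 7) l.
      move=> ->; apply/allP => a; rewrite !inE => /or3P [/eqP ->|/eqP ->|/(allP vc_written)] //.
      by rewrite !inE => /or3P [] /eqP ->.
    have runW : runs (For aD (Get aDeg (var aW)) (aY ::= Get aNbr (var aW *' eM +' var aD) ;; vc))
        (represents (foldl (visit w) st2 (nbrs w))) (2 + size (nbrs w) * (straight_cost vc + 3)) s3.
      rewrite addn3 -{1}[nbrs w]take_size; apply: runF => //.
      - move=> d s4 _ fr; have S4 := static_frame fr (stat _ erefl) S3.
        by rewrite /= (fr aW) ?W3 ?(s_deg S4) // !inE /= vc_out.
      - by rewrite take0.
      - move=> d s4 ltd D4 fr R4; have S4 := static_frame fr (stat _ erefl) S3.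
        apply: (runs_wp (c := aY ::= _ ;; vc)) => /=.
        rewrite (fr aW) ?W3 ?D4 ?(s_m S4) ?(s_nbr S4 w) // ?inE /= ?vc_out //.
        rewrite (take_nth w) // foldl_rcons; set y := nth w (nbrs w) d.
        apply: vc_spec => //; first exact: static_upd.
          by move=> x; rewrite /upd /= fr ?B3 // !inE /= vc_out.
        by rewrite /upd /= (fr aW) // !inE /= vc_out.
    apply: runs_mono (runs_frame runW) _ _ => // s4 [R4 fr4].
    exists (foldl (visit w) st2 (nbrs w)) => //; split=> //.
    by rewrite fr4 //= !inE mem_cat inE /= orbF vc_out.
  move=> b s2 [st2 [j [[S2 B2] R2 I2 [Qh2 lej] ->]]] /=.
  have [_ Qt2 _] := R2; rewrite Qh2 Qt2; case: ltnP => // gej _; split=> //.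
  by exists st2 => //; have -> : size st2.2 = j by apply/eqP; rewrite eqn_leq lej gej.
apply: (@runs_wp (_ ::= _)) => /=; exists st, 0; split=> //.
by split=> //; apply: static_upd.
Qed.

End SearchSpec.

Lemma visit_new_spec s f q w y : represents (f, q) s -> s aW 0 = w -> s aY 0 = y ->
  wp visit_new (represents (set_label f y (f w), rcons q y)) s.
Proof.
move=> [N /= Qt Q] W Y /=; split=> /=.
- move=> x; rewrite /upd /= W Y N /set_label; have -> : (x == y :> nat) = (x == y) by [].
  by case: ifP => // _; rewrite N.
- by rewrite /upd /= size_rcons Qt addn1.
- move=> i x; rewrite size_rcons nth_rcons ltnS /upd /= Y Qt leq_eqVlt.
  by case: ltngtP => //= lti _; apply: Q.
Qed.

Lemma visit_seed_spec h s st w y : static s -> labels aSeed s h ->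
  represents st s -> s aW 0 = w -> s aY 0 = y ->
  wp visit_seed_cmd (represents (visit_seed h w st y)) s.
Proof.
case: st => f q _ Bs Rs W Y; rewrite /visit_seed [(f, q).1]/= [(f, q).2]/=; have [N _ _] := Rs.
apply: (wp_if (b := f y != 0)); first by rewrite /= Y N.
case: eqP => // _; apply: (wp_if (b := h y == f w)).
  by rewrite /= Y W N Bs eqb0 negbK.
by case E: (h y == f w); rewrite ?E //; exact: (visit_new_spec Rs W Y).
Qed.

Lemma visit_grow_spec nd h s st w y : static s -> labels aSeed s h ->
  represents st s -> s aW 0 = w -> s aY 0 = y ->
  wp (visit_grow_cmd nd) (represents (visit_grow ts nd w st y)) s.
Proof.
case: st => f q Ss _ Rs W Y; rewrite /visit_grow [(f, q).1]/= [(f, q).2]/=; have [N Qt Q] := Rs.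
apply: (wp_if (b := f y != 0)); first by rewrite /= Y N.
case: eqP => [_|_]; first exact: (visit_new_spec Rs W Y).
case: nd => //=; rewrite Y W !N eqb0 negbK /=; case: (eqVneq (f y) (f w)) => //= _.
split=> //= x; rewrite /upd /= /set_label; have -> : (x == y :> nat) = (x == y) by [].
by case: ifP => // _; rewrite ?N // (s_k Ss) addn1.
Qed.

Lemma size_ts_le : k <= n.
Proof. by have := max_card (mem ts); rewrite card_ord (card_uniqP uniq_ts). Qed.

Definition partial_label j x := if index x ts < j then (index x ts).+1 else 0.

Lemma partial_labelS j x t : j < k -> 
  partial_label j.+1 x = if x == nth t ts j then j.+1 else partial_label j x.
Proof.
move=> ltj; rewrite /partial_label; case: (eqVneq x (nth t ts j)) => [->|neq].
  by rewrite index_uniq // ltnS leqnn.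
rewrite ltnS leq_eqVlt; case: (eqVneq (index x ts) j) => //= eqj.
by case/eqP: neq; rewrite -eqj nth_index // -index_mem eqj.
Qed.

Lemma partial_label_all x : partial_label k x = tl x.
Proof. by rewrite /partial_label index_mem. Qed.

Lemma exists_term j : j < k -> exists t : 'I_n, t \in ts.
Proof. by case: (ts) => // t ts' _; exists t; rewrite mem_head. Qed.

(** Common to all loops that write [n] consecutive cells; a nonzero [base] serves to append a row to
    [aRow]. *)
Lemma fill_spec a ei e base (g : nat -> nat) s : a != aX -> 6 < a -> static s ->
  (forall s' j, j < n -> s' aX 0 = j -> (forall b, b \notin [:: aX; a] -> s' b = s b) ->
     eval s' ei = base + j /\ eval s' e = g j) ->
  runs (For aX eN (Assign a ei e))
    (fun s' => forall i, s' a i = if base <= i < base + n then g (i - base) else s a i)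
    (2 + n * 3) s.
Proof.
move=> neq_a a7 Ss ev.
apply: (@runs_for _ _ _ (fun j s' => forall i,
    s' a i = if base <= i < base + j then g (i - base) else s a i)).
- by rewrite inE eq_sym.
- by move=> j s' v H i; rewrite /upd (negPf neq_a) H.
- move=> j s' _ fr; rewrite -(s_n Ss) /= fr // !inE /=.
  by case: (a) a7.
- by move=> i; rewrite addn0; case: ltnP => // lei; rewrite ltnNge lei.
- move=> j s' ltj X fr H; have [Ei E] := ev s' j ltj X fr.
  apply: (@runs_wp (Assign _ _ _)) => i; rewrite Ei E /upd eqxx /= H.
  case: (eqVneq i (base + j)) => [->|neq_i]; first by rewrite leq_addr addnS ltnS leqnn addKn.
  by rewrite addnS ltnS (leq_eqVlt i) (negPf neq_i).
Qed.

Lemma seat_terms_spec s : static s ->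
  (forall x, s aNear x = 0) ->
  runs (For aJ eK (Assign aNear (Get aTerm (var aJ)) (var aJ +' Num 1) ;;
                   Assign aQ (var aJ) (Get aTerm (var aJ))))
    (fun s' => labels aNear s' tl /\ forall i x, i < k -> s' aQ i = nth x ts i)
    (2 + k * 4) s.
Proof.
move=> Ss N0.
have runF := @runs_for aJ eK (Assign aNear (Get aTerm (var aJ)) (var aJ +' Num 1) ;;
                   Assign aQ (var aJ) (Get aTerm (var aJ)))
  (fun j s' => labels aNear s' (partial_label j) /\ forall i x, i < j -> s' aQ i = nth x ts i)
  k 2 s.
apply: (runs_mono (runF _ _ _ _ _)) => // [j s' _ fr|j s' ltj J fr [N Q]|s' [N Q]].
- by rewrite -(s_k Ss) /= fr.
- have S' := static_frame fr isT Ss.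
  apply: (@runs_wp (_ ;; _)) => /=; rewrite /upd /= J addn1.
  have [t0 _] := exists_term ltj; split.
    move=> x; rewrite (partial_labelS x t0 ltj) (s_terms S' t0 ltj) N.
    by rewrite /= -val_eqE.
  move=> i x; rewrite /= ltnS leq_eqVlt; case: eqP => [-> _|_ /=]; last exact: Q.
  exact: s_terms.
- by split=> // x; rewrite N partial_label_all.
Qed.

(** The constant is 4 + 5 + 1 + 30 + 30: clearing the labels, seating the terminals, setting the
    tail of the queue, and two searches of cost at most 14(n + 2m) + 2 each. *)
Lemma extend_spec nd h s : static s -> labels aSeed s h -> seed G ts nd h ->
  runs (extend nd) (fun s' => exists2 f, labels aNear s' f & extends G ts nd f h)
    (70 * (n + m).+1) s.
Proof.
move=> Ss Bs seedh; have le_kn := size_ts_le.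
have carry c (Q : store -> Prop) b s' : static s' -> labels aSeed s' h -> runs c Q b s' ->
    all (mem [:: aX; aJ; aNear; aQ; aQt; aQh; aW; aD; aY]) (written c) ->
    runs c (fun s'' => [/\ Q s'', static s'' & labels aSeed s'' h]) b s'.
  move=> S' B' run wc; apply: runs_mono (runs_frame_in run wc) _ _ => // s'' [Q'' fr].
  by split=> //; [exact: (static_frame fr isT S') | move=> x; rewrite fr].
have run1 := fill_spec (a := aNear) (ei := var aX) (e := Num 0) (base := 0) (g := fun=> 0) isT isT Ss.
apply: (runs_seq_le (b2 := 66 * (n + m).+1) (carry _ _ _ _ Ss Bs (run1 _) isT)) => [//||].
  by lia.
move=> s1 [N1 S1 B1].
have run2 := seat_terms_spec S1.
apply: (runs_seq_le (b2 := 61 * (n + m).+1) (carry _ _ _ _ S1 B1 (run2 _) isT)) => [x||].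
- by rewrite N1 add0n ltn_ord.
- by lia.
move=> s2 [[N2 Q2] S2 B2].
have S2' := static_upd (a := aQt) 0 k isT S2.
apply: (runs_seq_le (b1 := 1) (b2 := 60 * (n + m).+1)
    (R := fun s3 => [/\ represents (tl, ts) s3, static s3 & labels aSeed s3 h])).
- by apply: (@runs_wp (_ ::= _)); rewrite /= (s_k S2); split=> //; split.
- by lia.
move=> s3 [R3 S3 B3].
have run3 := search_spec (vc := visit_seed_cmd) (visit := visit_seed h)
  (Inv := fun st j => seed_inv G ts h st j) isT _ _ _ _ S3 B3 R3 (seed_inv_init seedh uniq_ts).
apply: (runs_seq_le (b2 := 30 * (n + m).+1) (carry _ _ _ _ S3 B3 (run3 _ _ _ _) isT)).
- by move=> *; apply: visit_seed_spec.
- move=> w st y; rewrite /visit_seed; case: ifP => _; first by exists [:: y]; rewrite cats1.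
  by exists [::]; rewrite cats0.
- by move=> st j; apply: si_uniq.
- by move=> st j w inv ltj nthj; exact: (seed_inv_scan mem_nbrs seedh).
- by rewrite /=; lia.
move=> s4 [[st4 R4 I4] S4 B4].
have mem4 := seed_inv_end I4.
(* The final queue of the first search plays the role of [q0] in the second one. *)
have I0 : grow_inv G ts nd h st4.2 st4 0 0.
  case: st4 R4 I4 mem4 => f q R4 I4 mem4; apply: (grow_inv_init seedh) => //=.
  - exact: si_mem I4.
  - exact: si_uniq I4.
  - by move=> x /(si_val I4) [].
have run4 := search_spec (vc := visit_grow_cmd nd) (visit := visit_grow ts nd)
  (Inv := fun st j => grow_inv G ts nd h st4.2 st j j) _ _ _ _ _ S4 B4 R4 I0.
apply: (runs_mono (run4 _ _ _ _ _)).
- by case: (nd).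
- by move=> *; apply: visit_grow_spec.
- exact: visit_grow_queue.
- by move=> st j; apply: gi_uniq.
- by move=> st j w inv ltj nthj; exact: (grow_inv_scan mem_nbrs seedh mem4).
- move=> s5 [[f q] [N5 _ _] I5]; exists f => //.
  exact: (grow_inv_end seedh mem4 I5).
- by case: (nd) => /=; lia.
Qed.

Lemma size_nbrs w : size (nbrs w) <= m.*2.
Proof. by rewrite -sum_nbrs (bigD1 w) //= leq_addr. Qed.

(** * Construction of the seed of a neighbour *)

Definition current_row s f := forall x, s aRow (s aHead 0 * n + x) = f x.

Lemma copy_row_spec nd s f : static s -> current_row s f ->
  runs (copy_row nd)
    (labels aSeed^~ (fun x => if nd && (f x == k.+1) then 0 else f x)) (2 + n * 3) s.
Proof.
move=> Ss Rs.
pose r j := s aRow (s aHead 0 * n + j).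
have run := @fill_spec aSeed (var aX) _ 0 (fun j => if nd && (r j == k.+1) then 0 else r j) s
  isT isT Ss.
rewrite /copy_row; apply: (runs_mono (run _ _)) => // [s' j ltj X fr|s' H x].
  have S' := static_frame fr isT Ss; split=> //; rewrite -/(r j).
  have rE : eval s' (row_entry (var aX)) = r j by rewrite /= X (s_n S') !fr.
  case: (nd) => //=; rewrite -![s' aRow _]/(eval s' (row_entry (var aX))) rE (s_k S') addn1.
  by case: eqP => _; rewrite ?mul1n ?subnn ?subn0.
by rewrite H ltn_ord subn0 /r Rs.
Qed.

(** The form in which [detach] tests it, looking for a conflicting terminal among the neighbours of
    [v]. *)
Lemma not_movable f v i : ~~ movable G ts true f v i =
  (v \in ts) || has (fun y => (f y != i.+1) && (y \in ts)) (nbrs v).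
Proof.
rewrite negb_and negbK /=; congr (_ || _); rewrite -has_predC.
apply/hasP/hasP => [] [y y_in /=].
  by rewrite negb_imply => /andP [Gvy fy]; exists y; rewrite ?mem_nbrs // fy.
by rewrite mem_nbrs in y_in * => /andP [fy yts]; exists y; rewrite // negb_imply y_in.
Qed.

Lemma detach_spec s f base v i : static s -> current_row s f ->
  s aV 0 = v -> s aI 0 = i -> labels aSeed s base ->
  (s aBad 0 != 0) = (v \in ts) ->
  runs detach (fun s' =>
      labels aSeed s' (fun x => if [&& G v x, f x != i.+1 & x \notin ts] then 0 else base x) /\
      (s' aBad 0 != 0) = ~~ movable G ts true f v i)
    (2 + m.*2 * 7) s.
Proof.
move=> Ss Rs Vs Is Bs bads.
have runF := @runs_for aD (Get aDeg (var aV)) (aY ::= Get aNbr (var aV *' eM +' var aD) ;;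
     If (Bin Eq (row_entry (var aY)) (var aI +' Num 1)) Skip
       (If (Get aTl (var aY)) (aBad ::= Num 1) (Assign aSeed (var aY) (Num 0))))
  (fun d s' =>
    labels aSeed s' (fun x => if [&& x \in take d (nbrs v), f x != i.+1 & x \notin ts] then 0 else base x) /\
    (s' aBad 0 != 0) = (v \in ts) || has (fun y => (f y != i.+1) && (y \in ts)) (take d (nbrs v)))
  (size (nbrs v)) 5 s.
apply: (runs_mono (runF _ _ _ _ _)) => // [j s' _ fr||d s' ltd D fr [B bad]|s' [B bad]|].
- have S' := static_frame fr isT Ss; by rewrite /= (fr aV) // Vs (s_deg S').
- by rewrite take0 /= orbF.
- have S' := static_frame fr isT Ss.
  apply: (runs_wp (c := _ ;; _)) => /=; rewrite (take_nth v) //; set y := nth v _ _.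
  have [Vs' Is' Hs' Rw'] : [/\ s' aV = s aV, s' aI = s aI, s' aHead = s aHead & s' aRow = s aRow].
    by split; apply: fr.
  rewrite Vs' Vs D (s_m S') (s_nbr S' v ltd) -/y /upd /= Is' Is Hs' Rw' (s_n S') (Rs y) eqb0 negbK addn1.
  rewrite (s_tl S') term_label0 negbK.
  have hasE : has (fun y => (f y != i.+1) && (y \in ts)) (rcons (take d (nbrs v)) y) =
      ((f y != i.+1) && (y \in ts)) || has (fun y => (f y != i.+1) && (y \in ts)) (take d (nbrs v)).
    by rewrite -cats1 has_cat /= orbF orbC.
  rewrite hasE; case: (eqVneq (f y) i.+1) => fy /=.
    split=> [x|]; last exact: bad.
    by rewrite /= B mem_rcons inE; case: (x =P y) => //= ->; rewrite fy eqxx /= andbF.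
  case: (boolP (y \in ts)) => yts /=.
    split=> [x|]; last by rewrite orbT.
    by rewrite /= B mem_rcons inE; case: (x =P y) => //= ->; rewrite yts /= !andbF.
  split=> [x|]; last exact: bad.
  rewrite /= mem_rcons inE B; have -> : (x == y :> nat) = (x == y) by [].
  by case: (x =P y) => //= ->; rewrite fy yts.
- split=> [x|]; last by rewrite bad take_size not_movable.
  by rewrite B take_size mem_nbrs.
- by have := size_nbrs v; lia.
Qed.

Lemma make_seed_spec nd s f v i : static s -> current_row s f ->
  s aV 0 = v -> s aI 0 = i ->
  runs (make_seed nd) (labels aSeed^~ (seed_label G ts nd f v i)) (20 * (n + m).+1) s.
Proof.
move=> Ss Rs Vs Is.
apply: (runs_seq_le (b2 := 17 * (n + m).+1) (runs_frame (copy_row_spec nd Ss Rs))); first by lia.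
set base := fun x => _ in |- *.
move=> s1 [B1 fr1]; have wr1 : written (copy_row nd) = [:: aX; aSeed; aX] by case: (nd).
rewrite wr1 in fr1; have S1 := static_frame fr1 isT Ss.
have R1 : current_row s1 f by move=> x; rewrite !fr1.
pose s2 := upd s1 aBad 0 (tl v).
have S2 : static s2 by apply: static_upd.
apply: (runs_seq_le (b1 := 1) (b2 := 16 * (n + m).+1) (R := eq s2)).
- by apply: (@runs_wp (_ ::= _)); rewrite /= (fr1 aV) // Vs (s_tl S1).
- by lia.
move=> _ <-.
apply: (runs_seq_le (b2 := 2) (R := fun s3 => [/\ static s3, s3 aV 0 = v, s3 aI 0 = i,
  (s3 aBad 0 != 0) = ~~ movable G ts nd f v i & labels aSeed s3 (fun x =>
     if nd && [&& G v x, f x != i.+1 & x \notin ts] then 0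
     else if nd && (f x == k.+1) then 0 else f x)]) (b1 := 2 + m.*2 * 7)).
- have bad2 : (s2 aBad 0 != 0) = (v \in ts) by rewrite /s2 /upd /= term_label0 negbK.
  have [V2 I2] : s2 aV 0 = v /\ s2 aI 0 = i by rewrite /s2 /upd /= !fr1.
  have R2 : current_row s2 f by move=> x; rewrite /s2 /upd /= !fr1.
  have B2 : labels aSeed s2 base by exact: B1.
  rewrite /base in B2; case: (nd) B2 => B2; last first.
    by apply: runs_skip; split=> //; rewrite bad2 /movable andbT negbK.
  apply: runs_mono (runs_frame (detach_spec S2 R2 V2 I2 B2 bad2)) _ _ => //.
  move=> s3 [[B3 bad3] fr3]; split=> //; first exact: (static_frame fr3 isT S2).
    by rewrite fr3.
  by rewrite fr3.
- by lia.
move=> s3 [S3 V3 I3 bad3 B3]; apply: (runs_wp (c := If _ _ _)) => /=; rewrite bad3 V3 I3 addn1.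
rewrite /seed_label; case: ifP => mv x.
  by rewrite B3 (negPf mv) andbF.
rewrite /upd /= -/(f x); have -> : (x == v :> nat) = (x == v) by [].
by rewrite (negbFE mv) andbT; case: ifP => // _; rewrite B3.
Qed.

(** * The trie of the solutions met so far *)

Local Notation width := (k + 2).

(* Cell [p * width + c] of [ch] is the rank of the child of the [p]-th node along
   the letter [c], and [0] when there is none, as the root is not a child. *)
Record trie (nodes : seq (seq nat)) (count : nat) (ch : nat -> nat) : Prop := Trie {
  t_uniq : uniq nodes;
  t_root : nth [::] nodes 0 = [::];
  t_size : size nodes = count.+1;
  t_child : forall p c, p < size nodes -> c < width ->
    let q := ch (p * width + c) in
    if q == 0 then rcons (nth [::] nodes p) c \notin nodes : Prop
    else q < size nodes /\ nth [::] nodes q = rcons (nth [::] nodes p) c;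
  t_free : forall a, size nodes * width <= a -> ch a = 0;
  t_closed : forall u c, rcons u c \in nodes -> u \in nodes
}.

Lemma trie_root : trie [:: [::]] 0 (fun _ => 0).
Proof.
by split=> // [[|p] c // _ _ /=|[|c u] d] /=; rewrite ?inE //; case: (u).
Qed.

(** The row of the new node lies beyond the rows in use, hence is zero by [t_free]. This is correct,
    because a child of the new node in the trie would, by [t_closed], have put this node there
    before. *)
Lemma trie_add nodes count ch p c : trie nodes count ch ->
  p < size nodes -> c < width -> rcons (nth [::] nodes p) c \notin nodes ->
  trie (rcons nodes (rcons (nth [::] nodes p) c)) count.+1
    (fun a => if a == p * width + c then count.+1 else ch a).
Proof.
move=> [uq rt sz child free closed] ltp ltc new; set u := nth [::] nodes p in new *.
have nth_old q : q < size nodes -> nth [::] (rcons nodes (rcons u c)) q = nth [::] nodes q.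
  by move=> ltq; rewrite nth_rcons ltq.
split.
- by rewrite rcons_uniq new uq.
- by rewrite nth_old // sz.
- by rewrite size_rcons sz.
- move=> q d; rewrite size_rcons ltnS leq_eqVlt => leq ltd /=.
  rewrite addr_inj //; case/orP: leq => [/eqP ->|ltq].
    have -> /= : (size nodes == p) && (d == c) = false by rewrite eqn_leq leqNgt ltp.
    rewrite free ?leq_addr //= nth_rcons ltnn eqxx mem_rcons inE negb_or; apply/andP; split.
      by apply/eqP => /(congr1 size) /eqP; rewrite !size_rcons -addn1 -[X in _ == X]addn0 eqn_add2l.
    by apply: contraNN new => /closed.
  rewrite nth_old //; case: andP => [[/eqP -> /eqP ->]|neq] /=.
    by rewrite -sz ltnS leqnn nth_rcons ltnn eqxx.
  have /= := child q d ltq ltd; case: ifP => [_ notin|_ [ltch Dch]]; last first.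
    by rewrite ltnW // nth_old.
  rewrite mem_rcons inE (negPf notin) orbF; apply/eqP => eq_r; case: neq.
  have [equ ->] := rcons_inj eq_r; split=> //.
  by rewrite -(nth_uniq [::] ltq ltp uq) equ.
- move=> a; rewrite size_rcons mulSn => lea; case: eqP => [Da|_].
    have lep : p * width <= size nodes * width by rewrite leq_mul2r (ltnW ltp) orbT.
    by move: lea; rewrite Da; lia.
  by apply: free; apply: leq_trans lea; rewrite leq_addl.
- move=> v d; rewrite !mem_rcons !inE => /orP [/eqP /rcons_inj [-> _]|/closed ->].
    by rewrite mem_nth ?orbT.
  by rewrite orbT.
Qed.

Definition word f := [seq f x | x <- enum 'I_n].

Lemma size_word f : size (word f) = n.
Proof. by rewrite size_map size_enum_ord. Qed.

Lemma nth_word f x : nth 0 (word f) x = f x.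
Proof. by rewrite (nth_map x) ?size_enum_ord // nth_ord_enum. Qed.

Lemma take_wordS f x : take x.+1 (word f) = rcons (take x (word f)) (f x).
Proof. by rewrite (take_nth 0) ?nth_word // size_word. Qed.

Definition stored_rows (RS : seq (seq nat)) s :=
  s aRows 0 = size RS /\
  forall r x, r < size RS -> x < n -> s aRow (r * n + x) = nth 0 (nth [::] RS r) x.

(** The trie also contains the proper prefixes; only its nodes of depth [n] stand for solutions. *)
Definition stored_words (RS : seq (seq nat)) s :=
  exists2 nodes, trie nodes (s aCount 0) (s aChild) &
    forall u, size u = n -> (u \in nodes) = (u \in RS).

Definition prefixes_added (nodes0 nodes : seq (seq nat)) (L : seq nat) (j : nat) :=
  {subset nodes0 <= nodes} /\
  forall u, u \in nodes -> u \in nodes0 \/ exists2 j' : nat, j' <= j & u = take j' L.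

(** As [nodes0] is closed under prefixes, once a prefix of the word is missing from it all longer
    ones are, so the flag [aNew] never has to be reset during a descent. *)
Lemma insert_step_spec (nodes0 : seq (seq nat)) s f x :
  (forall u c, rcons u c \in nodes0 -> u \in nodes0) ->
  static s -> labels aNear s f -> f x < width -> s aX 0 = x ->
  (exists nodes, [/\ trie nodes (s aCount 0) (s aChild), s aCur 0 < size nodes,
     nth [::] nodes (s aCur 0) = take x (word f),
     (s aNew 0 != 0) = (take x (word f) \notin nodes0) &
     prefixes_added nodes0 nodes (word f) x]) ->
  wp insert_step (fun s => exists nodes, [/\ trie nodes (s aCount 0) (s aChild), s aCur 0 < size nodes,
     nth [::] nodes (s aCur 0) = take x.+1 (word f),
     (s aNew 0 != 0) = (take x.+1 (word f) \notin nodes0) &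
     prefixes_added nodes0 nodes (word f) x.+1]) s.
Proof.
move=> closed0 Ss Ns ltf X [nodes [tr ltc Dc new [sub pre]]].
have preS u : u \in nodes -> u \in nodes0 \/ exists2 x', x' <= x.+1 & u = take x' (word f).
  by move=> /pre [|[x' lex' ->]]; [left | right; exists x' => //; exact: leqW].
have child := t_child tr ltc ltf; rewrite /= Dc -take_wordS in child.
(* The nodes added so far are prefixes of length at most [x], so a prefix of length [x.+1] can only
   be an old node. *)
have clash : take x.+1 (word f) \in nodes -> take x.+1 (word f) \in nodes0.
  case/pre => // -[x' lex' /(congr1 size)].
  rewrite !size_takel ?size_word ?ltn_ord //; last first.
    by apply: leq_trans lex' _; exact: ltnW.
  by move=> eqx; rewrite -eqx ltnn in lex'.
have up0 : take x.+1 (word f) \in nodes0 -> take x (word f) \in nodes0.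
  by rewrite take_wordS; exact: closed0.
rewrite /= {1 2 3}/upd /= X Ns (s_k Ss); case: ifP => ch0 /=.
  rewrite /upd /= (s_k Ss); move: child; rewrite (negPf ch0) => -[ltq Dq].
  have Lin : take x.+1 (word f) \in nodes by rewrite -Dq mem_nth.
  by exists nodes; split=> //; rewrite (clash Lin) new up0 ?clash.
move: child; rewrite (negbFE ch0) => Lnew.
have := trie_add tr ltc ltf; rewrite Dc -take_wordS => /(_ Lnew) tr'.
rewrite /upd /= (s_k Ss) !eqxx !addn1.
exists (rcons nodes (take x.+1 (word f))); split=> //.
- by rewrite size_rcons (t_size tr).
- by rewrite nth_rcons (t_size tr) ltnn eqxx.
- by apply/esym; apply: contraNN Lnew => /sub.
split=> [u /sub|u]; rewrite mem_rcons inE; first by move=> ->; rewrite orbT.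
by case/orP => [/eqP ->|/preS //]; right; exists x.+1.
Qed.

Lemma insert_spec RS s f : 0 < n -> static s -> labels aNear s f ->
  (forall x, f x < width) -> stored_rows RS s -> stored_words RS s ->
  runs insert (fun s' => exists RS', [/\ RS' = if word f \in RS then RS else rcons RS (word f),
      stored_rows RS' s' & stored_words RS' s']) (20 * (n + m).+1) s.
Proof.
move=> n_gt0 Ss Ns ltf [Rs Rw] [nodes0 tr0 full0].
pose Inv j s' := exists nodes, [/\ trie nodes (s' aCount 0) (s' aChild), s' aCur 0 < size nodes,
     nth [::] nodes (s' aCur 0) = take j (word f),
     (s' aNew 0 != 0) = (take j (word f) \notin nodes0) &
     prefixes_added nodes0 nodes (word f) j].
have lt0nodes : 0 < size nodes0 by rewrite (t_size tr0).
have root0 : [::] \in nodes0 by rewrite -(t_root tr0) mem_nth.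
pose carried s' := [/\ static s', labels aNear s' f & stored_rows RS s'].
apply: (runs_seq_le (b1 := 2) (b2 := 18 * (n + m).+1) (R := fun s' => Inv 0 s' /\ carried s')).
- apply: (@runs_wp (_ ;; _)) => /=; split; last first.
    by split=> //; do 2!apply: static_upd => //.
  exists nodes0; split=> //=; first by rewrite take0 (t_root tr0).
    by rewrite take0 root0.
  by split=> // u; left.
- by lia.
move=> s1 [I1 [S1 N1 [Rs1 Rw1]]].
have runF := @runs_for aX eN insert_step Inv n 6 s1.
apply: (runs_seq_le (b2 := 8 * (n + m).+1) (runs_frame (runF _ _ _ _ _))) => //.
- by move=> j s' _ fr; rewrite /= fr // (s_n S1).
- move=> j s' ltj X fr; have S' := static_frame fr isT S1.
  have N' : labels aNear s' f by move=> x; rewrite fr.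
  by move/(insert_step_spec (x := Ordinal ltj) (t_closed tr0) S' N' (ltf _) X)/runs_wp.
- by lia.
move=> s2 [[nodes [tr2 ltc Dc new [sub pre]]] fr2].
have S2 := static_frame fr2 isT S1.
have [Rs2 Rw2] : stored_rows RS s2 by rewrite /stored_rows !fr2.
have N2 : labels aNear s2 f by move=> x; rewrite fr2.
move: Dc new pre; rewrite -{1 2 3}(size_word f) take_size => Dc new pre.
have word_in : word f \in nodes by rewrite -Dc mem_nth.
(* Of the prefixes that were added, only the whole word has length [n]. *)
have full u : size u = n -> (u \in nodes) = (u == word f) || (u \in RS).
  move=> szu; rewrite -(full0 _ szu); apply/idP/orP => [/pre [|[j lej Du]]|[/eqP -> //|/sub //]].
    by right.
  left; apply/eqP; rewrite Du take_oversize // size_word leqNgt; apply/negP => ltj.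
  by move: szu; rewrite Du size_takel ?size_word; lia.
set Q := fun s' => _.
suff run : runs (If (var aNew)
    (For aX eN (Assign aRow (var aRows *' eN +' var aX) (Get aNear (var aX))) ;;
     aRows ::= var aRows +' Num 1)
    Skip) Q (2 + n * 3 + 1).+1 s2 by apply: runs_mono run _ _ => //; lia.
rewrite /Q {Q}; apply: runs_if; rewrite /= new full0 ?size_word //; case: ifP => /= [newf|/negbFE oldf]; last first.
  apply: runs_skip; exists RS; rewrite oldf; split=> //.
  by exists nodes => // u szu; rewrite full //; case: eqP => // ->.
have runR := @fill_spec aRow (var aRows *' eN +' var aX) (Get aNear (var aX)) (size RS * n)
  (fun j => nth 0 (word f) j) s2 isT isT S2.
apply: (runs_seq_le (b2 := 1) (runs_frame (runR _))) => // [s' j ltj X fr|s3 [R3 fr3]].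
  by rewrite /= X !fr // Rs2 (s_n S2) (N2 (Ordinal ltj)) -(nth_word f (Ordinal ltj)).
have S3 := static_frame fr3 isT S2.
apply: (@runs_wp (_ ::= _)) => /=; exists (rcons RS (word f)); rewrite (negPf newf); split=> //.
  split; first by rewrite /upd /= fr3 // Rs2 size_rcons addn1.
  move=> r x ltr ltx; rewrite /upd /= R3 nth_rcons; move: ltr; rewrite size_rcons ltnS leq_eqVlt.
  case: ltngtP => //= [ltr|->] _; last by rewrite leq_addr ltn_add2l ltx addKn.
  rewrite ifF ?Rw2 //; apply/negbTE; rewrite negb_and -ltnNge; apply/orP; left.
  by apply: leq_trans (_ : r.+1 * n <= _); [rewrite mulSn addnC ltn_add2r | rewrite leq_mul2r ltr orbT].
exists nodes; first by rewrite /upd /= !fr3.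
by move=> u szu; rewrite full // mem_rcons inE.
Qed.

(** * Computing and storing the neighbours of a solution *)

Section Neighbours.

Variable nd : bool.
Hypothesis n_gt0 : 0 < n.

Definition row_label (u : seq nat) : 'I_n -> nat := fun x => nth 0 u x.

Lemma row_label_word f : row_label (word f) = f.
Proof. by apply: functional_extensionality => x; rewrite /row_label nth_word. Qed.

Definition valid_rows (RS : seq (seq nat)) :=
  uniq RS /\ forall u, u \in RS -> size u = n /\ valid G ts nd (row_label u).

Definition stored RS s := [/\ stored_rows RS s, stored_words RS s & valid_rows RS].

(** The neighbour of [u] for the move of [v] to the class [i] is stored. Since rows are only
    appended, this persists. *)
Definition served (RS : seq (seq nat)) u v i := exists2 u', u' \in RS &
  extends G ts nd (row_label u') (seed_label G ts nd (row_label u) v i).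

Lemma served_cat RS RS' u v i : served RS u v i -> served (RS ++ RS') u v i.
Proof. by move=> [u' u'R ext]; exists u'; rewrite // mem_cat u'R. Qed.

Lemma extend_insert_spec RS s h : static s -> labels aSeed s h -> seed G ts nd h ->
  stored RS s ->
  runs (extend nd ;; insert) (fun s' => exists RS', stored (RS ++ RS') s' /\
    exists2 u, u \in RS ++ RS' & extends G ts nd (row_label u) h) (90 * (n + m).+1) s.
Proof.
move=> Ss Bs seedh [Rs Ws [uR vR]].
have runE := runs_frame_in (l := [:: aX; aJ; aNear; aQ; aQt; aQh; aW; aD; aY])
  (extend_spec Ss Bs seedh).
apply: (runs_seq_le (b2 := 20 * (n + m).+1) (runE _)); first by case: (nd).
  by lia.
move=> s1 [[f N1 ext] fr1]; have S1 := static_frame fr1 isT Ss.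
have ltf x : f x < width.
  by have := valid_le ext.1 x; rewrite addn2 ltnS => /leq_trans; apply; rewrite -addn1 leq_add2l; case: (nd).
have R1 : stored_rows RS s1 by rewrite /stored_rows !fr1.
have W1 : stored_words RS s1 by rewrite /stored_words !fr1.
apply: runs_mono (insert_spec n_gt0 S1 N1 ltf R1 W1) _ _ => // s2 [RS' [DRS' R2 W2]].
have [r Dr] : exists r, RS' = RS ++ r.
  by rewrite DRS'; case: ifP => _; [exists [::]; rewrite cats0 | exists [:: word f]; rewrite cats1].
exists r; rewrite -Dr; split; last first.
  exists (word f); last by rewrite row_label_word.
  by rewrite DRS'; case: ifP => // _; rewrite mem_rcons mem_head.
split=> //; rewrite DRS'; case: ifP => // fR; split; first by rewrite rcons_uniq fR uR.
move=> u; rewrite mem_rcons inE => /orP [/eqP ->|/vR //].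
by rewrite size_word row_label_word; split=> //; exact: ext.1.
Qed.

Lemma neighbour_spec RS s j v i : static s -> stored RS s -> s aHead 0 = j ->
  j < size RS -> s aV 0 = v -> s aI 0 = i ->
  runs (neighbour nd) (fun s' => exists RS', stored (RS ++ RS') s' /\
    served (RS ++ RS') (nth [::] RS j) v i) (110 * (n + m).+1) s.
Proof.
move=> Ss [Rs Ws vR] Hj ltj Vs Is; set u := nth [::] RS j.
have uR : u \in RS by rewrite mem_nth.
have cur : current_row s (row_label u) by move=> x; rewrite Hj (Rs.2 _ _ ltj).
have runM := runs_frame_in (l := [:: aX; aD; aY; aBad; aSeed]) (make_seed_spec nd Ss cur Vs Is).
apply: (runs_seq_le (b2 := 90 * (n + m).+1) (runM _)); first by case: (nd).
  by lia.
move=> s1 [B1 fr1]; have S1 := static_frame fr1 isT Ss.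
apply: extend_insert_spec => //.
  by apply: seed_seed_label; exact: (vR.2 _ uR).2.
by split=> //; rewrite /stored_rows /stored_words !fr1.
Qed.

Lemma process_spec RS s j : static s -> stored RS s -> s aHead 0 = j -> j < size RS ->
  runs (process nd) (fun s' => exists RS', stored (RS ++ RS') s' /\
    forall v i, i < k -> served (RS ++ RS') (nth [::] RS j) v i)
    (2 + n * (2 + k * (110 * (n + m).+1).+2).+2) s.
Proof.
move=> Ss Rs Hj ltj; set u := nth [::] RS j.
(* The predicate [P] selects the moves already performed; it advances lexicographically in the
   vertex, then in the class. *)
pose before s' (P : 'I_n -> nat -> Prop) := exists RS', stored (RS ++ RS') s' /\
  forall v i, i < k -> P v i -> served (RS ++ RS') u v i.
have statN l (s1 s' : store) : (forall d, d \notin l -> s' d = s1 d) ->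
    all (leq 7) l && (aHead \notin l) -> static s1 -> static s' /\ s' aHead = s1 aHead.
  by move=> fr /andP [l7 lH] S1; split; [exact: (static_frame fr) | exact: fr].
have runF := @runs_for aV eN (For aI eK (neighbour nd))
  (fun p s' => before s' (fun v i => v < p)) n (2 + k * (110 * (n + m).+1).+2) s.
apply: (runs_mono (runF _ _ _ _ _)) => // [|p s' _ fr||p s' ltp V fr [RS' [st serv]]|s' [RS' [st serv]]].
- by case: (nd).
- have [|S' _] := statN _ _ _ fr _ Ss; first by case: (nd).
  by rewrite /= (s_n S').
- by exists [::]; rewrite cats0.
- have [|S' H'] := statN _ _ _ fr _ Ss; first by case: (nd).
  pose v := Ordinal ltp.
  have runG := @runs_for aI eK (neighbour nd)
    (fun q s'' => before s'' (fun v' i => v' < p \/ v' = v /\ i < q)) k (110 * (n + m).+1) s'.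
  apply: (runs_mono (runG _ _ _ _ _)) => // [|q s'' _ fr'||q s'' ltq I fr' [RS'' [st'' serv'']]|].
  + by case: (nd).
  + have [|S'' _] := statN _ _ _ fr' _ S'; first by case: (nd).
    by rewrite /= (s_k S'').
  + by exists RS'; split=> // v' i ltk [ltv|[]] //; apply: serv.
  + have [|S'' H''] := statN _ _ _ fr' _ S'; first by case: (nd).
    have Hj'' : s'' aHead 0 = j by rewrite H'' H'.
    have V'' : s'' aV 0 = v by rewrite fr' //; case: (nd).
    have ltj'' : j < size (RS ++ RS'') by rewrite size_cat ltn_addr.
    apply: runs_mono (neighbour_spec S'' st'' Hj'' ltj'' V'' I) _ _ => // s3 [R3].
    rewrite -catA nth_cat ltj -/u => -[st3 serv3].
    exists (RS'' ++ R3); split=> // v' i ltk [ltv'|[Dv' ]].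
      by rewrite catA; apply: served_cat; apply: serv''; auto.
    rewrite ltnS leq_eqVlt => /orP [/eqP ->|lti]; first by rewrite Dv'.
    by rewrite catA; apply: served_cat; apply: serv''; auto.
  + move=> s3 [R3 [st3 serv3]]; exists R3; split=> // v' i ltk.
    rewrite ltnS leq_eqVlt => /orP [/eqP Dv'|ltv']; apply: serv3 => //; last by left.
    by right; split=> //; apply: val_inj.
- by exists RS'; split=> // v i ltk; apply: serv.
Qed.

End Neighbours.

(** * Set-up of the tables and first solution *)

Definition keeps_input s := forall a, a < 4 -> s a = input es ts a.

Lemma keeps_input_frame l s s' : (forall a, a \notin l -> s' a = s a) ->
  all (leq 4) l -> keeps_input s -> keeps_input s'.
Proof.
move=> fr /allP l4 inp a a4; rewrite fr ?inp //.
by rewrite ltnNge in a4; apply: contraNN a4 => /l4.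
Qed.

Section Input.

Variable s0 : store.
Hypothesis inp : keeps_input s0.

Lemma input_size : [/\ s0 aSize 0 = n, s0 aSize 1 = m & s0 aSize 2 = k].
Proof. by rewrite inp. Qed.

Lemma input_edge j p : j < m -> s0 aSrc j = (nth p es j).1 /\ s0 aDst j = (nth p es j).2.
Proof. by move=> ltj; rewrite !inp // /input /= !(nth_map p). Qed.

Lemma input_term i x : i < k -> s0 aTerm i = nth x ts i.
Proof. by move=> lti; rewrite inp // /input /= (nth_map x). Qed.

End Input.

Definition stored_nbrs (A : 'I_n -> seq 'I_n) s := forall w,
  s aDeg w = size (A w) /\
  forall d x, d < size (A w) -> s aNbr (w * m + d) = nth x (A w) d.

(** The bound [m] on the rows keeps them from overlapping. [eu] must be stable under writes to
    [aNbr], because it is evaluated again to update the degree. *)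
Lemma link_spec A s eu ev u v : keeps_input s -> stored_nbrs A s ->
  (forall w, size (A w) <= m) -> size (A u) < m -> eval s ev = v ->
  (forall s', (forall b, b != aNbr -> s' b = s b) -> eval s' eu = u) ->
  runs (link eu ev) (stored_nbrs (fun w => if w == u then rcons (A u) v else A w)) 2 s.
Proof.
move=> inp As szA ltu evv evu; have [_ sm _] := input_size inp.
apply: (@runs_wp (_ ;; _)) => /=; rewrite !evu //; last first.
  by move=> b nb; apply: functional_extensionality => i; rewrite /upd (negPf nb).
rewrite evv sm /upd /= (As u).1 addn1 => w /=.
have -> : (w == u :> nat) = (w == u) by [].
have [Dw Nw] := As w; split=> [|d x ltd].
  by case: eqP => _; rewrite ?size_rcons.
have ltdm : d < m.
  apply: leq_trans ltd _; case: eqP => [_|_] //; by rewrite size_rcons.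
rewrite addr_inj //; have -> : (w == u :> nat) = (w == u) by [].
case: eqP ltd => [Dwu|_] /= ltd; last exact: Nw.
rewrite size_rcons ltnS leq_eqVlt in ltd; rewrite nth_rcons.
case: ltngtP ltd => //= ltd _; rewrite -Dwu; apply: Nw; by rewrite Dwu.
Qed.

Hypothesis loopless : forall p, p \in es -> p.1 != p.2.

(** An edge that is not a loop adds at most one entry to a given row. *)
Lemma size_nbrs_in ps w : {subset ps <= es} -> size (nbrs_in ps w) <= size ps.
Proof.
elim/last_ind: ps => // ps p IH sub; rewrite nbrs_rcons size_cat size_rcons -addn1 leq_add //.
  by apply: IH => q qps; apply: sub; rewrite mem_rcons inE qps orbT.
have /loopless neq : p \in es by apply: sub; rewrite mem_rcons mem_head.
rewrite size_cat; case: (p.1 =P w) => [<-|_]; last by case: ifP.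
by rewrite eq_sym (negPf neq).
Qed.

Lemma build_nbrs_spec s : keeps_input s -> (forall w, s aDeg w = 0) ->
  runs build_nbrs (stored_nbrs nbrs) (2 + m * 6) s.
Proof.
move=> inp D0.
have runF := @runs_for aJ eM (link (Get aSrc (var aJ)) (Get aDst (var aJ)) ;;
             link (Get aDst (var aJ)) (Get aSrc (var aJ)))
  (fun j s' => stored_nbrs (nbrs_in (take j es)) s') m 4 s.
apply: (runs_mono (runF _ _ _ _ _)) => // [j s' _ fr||j s' ltj J fr As|s' As].
- by have [_ sm _] := input_size inp; rewrite -sm /= fr.
- by move=> w; rewrite take0 D0.
- have inp' := keeps_input_frame fr isT inp.
  have [[u v] Dp] : exists p, nth p es j = p.
    by case: (es) ltj => // p0 ps ltj; exists (nth p0 (p0 :: ps) j); apply: set_nth_default.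
  have p_in : (u, v) \in es by rewrite -Dp mem_nth.
  have neq_uv := loopless p_in; rewrite /= in neq_uv.
  have [Eu Ev] := input_edge inp' (u, v) ltj; rewrite Dp /= in Eu Ev.
  have szA w : size (nbrs_in (take j es) w) <= j.
    by rewrite -{2}(size_takel (ltnW ltj)) size_nbrs_in // => q /mem_take.
  have run1 : runs (link (Get aSrc (var aJ)) (Get aDst (var aJ)))
      (stored_nbrs (fun w => if w == u then rcons (nbrs_in (take j es) u) v
                             else nbrs_in (take j es) w)) 2 s'.
    apply: link_spec => //=; rewrite ?J //.
    + by move=> w; apply: leq_trans (szA w) (ltnW ltj).
    + exact: leq_ltn_trans (szA u) ltj.
    + by move=> s'' fr''; rewrite !fr'' // J.
  apply: (runs_seq_le (b2 := 2) (runs_frame run1)) => // s1 [A1 fr1].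
  have inp1 := keeps_input_frame fr1 isT inp'.
  apply: (@runs_mono _ _ _ 2 2); [|move=> s2 A2 w|by []].
  apply: (link_spec inp1 A1 (u := v) (v := u)) => /=.
  + move=> w; case: eqP => _; last exact: leq_trans (szA w) (ltnW ltj).
    by rewrite size_rcons; exact: leq_ltn_trans (szA u) ltj.
  + by rewrite eq_sym (negPf neq_uv); exact: leq_ltn_trans (szA v) ltj.
  + by rewrite !fr1 // J.
  + by move=> s'' fr''; rewrite !fr'' // !fr1 // J.
  have -> : nbrs_in (take j.+1 es) w = if w == v then
      rcons (if v == u then rcons (nbrs_in (take j es) u) v else nbrs_in (take j es) v) u
    else if w == u then rcons (nbrs_in (take j es) u) v else nbrs_in (take j es) w.
    rewrite (take_nth (u, v)) // Dp nbrs_rcons /=; case: (w =P v) => [->|/eqP wv].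
      by rewrite eqxx (eq_sym v u) (negPf neq_uv) /= cats1.
    rewrite [v == w]eq_sym (negPf wv) cats0 [u == w]eq_sym.
    by case: (w =P u) => [->|_]; rewrite ?cats1 ?cats0.
  exact: A2.
- by rewrite take_size in As.
Qed.

Lemma build_labels_spec s : keeps_input s -> (forall x, s aTl x = 0) ->
  runs build_labels (labels aTl^~ tl) (2 + k * 3) s.
Proof.
move=> inp T0.
have runF := @runs_for aJ eK (Assign aTl (Get aTerm (var aJ)) (var aJ +' Num 1))
  (fun j s' => labels aTl s' (partial_label j)) k 1 s.
apply: (runs_mono (runF _ _ _ _ _)) => // [j s' _ fr|j s' ltj J fr T|s' T x].
- by have [_ _ sk] := input_size inp; rewrite -sk /= fr.
- have inp' := keeps_input_frame fr isT inp.
  apply: (@runs_wp (Assign _ _ _)) => /= x; have [t0 _] := exists_term ltj.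
  rewrite (partial_labelS x t0 ltj) /upd /= J addn1 (input_term inp' t0 ltj) T.
  by rewrite -val_eqE.
- by rewrite T partial_label_all.
Qed.

Definition terminal_edge (p : 'I_n * 'I_n) := (p.1 \in ts) && (p.2 \in ts).

Lemma check_spec nd s : static s -> s aBad 0 = 0 ->
  runs (check nd) (fun s' => (s' aBad 0 != 0) = nd && has terminal_edge es) (2 + m * 5) s.
Proof.
move=> Ss bad0; case: nd; last by apply: runs_skip; rewrite bad0.
have runF := @runs_for aJ eM (If (Get aTl (Get aSrc (var aJ)))
                 (If (Get aTl (Get aDst (var aJ))) (aBad ::= Num 1) Skip) Skip)
  (fun j s' => (s' aBad 0 != 0) = has terminal_edge (take j es)) m 3 s.
apply: (runs_mono (runF _ _ _ _ _)) => // [j s' _ fr||j s' ltj J fr bad|s' bad].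
- by rewrite -(s_m Ss) /= fr.
- by rewrite bad0 take0.
- have S' := static_frame fr isT Ss.
  have [[u v] Dp] : exists p, nth p es j = p.
    by case: (es) ltj => // p0 ps ltj; exists (nth p0 (p0 :: ps) j); apply: set_nth_default.
  have [Eu Ev] := s_edges S' (u, v) ltj; rewrite Dp /= in Eu Ev.
  apply: (@runs_wp (If _ _ _)) => /=; rewrite J Eu Ev !(s_tl S') !term_label0 !negbK.
  rewrite (take_nth (u, v)) // Dp -cats1 has_cat /= orbF.
  rewrite [terminal_edge (u, v)]/((u \in ts) && (v \in ts)).
  case: (u \in ts) => /=; last by rewrite bad orbF.
  by case: (v \in ts) => /=; rewrite ?orbT // bad orbF.
- by rewrite bad take_size.
Qed.

Lemma setup_spec nd : let s := input es ts in
  runs (build_nbrs ;; build_labels ;; check nd) (fun s' =>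
      [/\ static s', (s' aBad 0 != 0) = nd && has terminal_edge es &
          forall a, 18 < a -> a != aJ -> forall i, s' a i = 0])
    (20 * (n + m).+1) s.
Proof.
move=> s; have le_kn := size_ts_le.
have inp : keeps_input s by [].
have zero a i : 3 < a -> s a i = 0.
  by move=> a3; rewrite /s /input (nth_default [::]) ?nth_nil.
have D0 (w : 'I_n) : s aDeg w = 0 by apply: zero.
have run1 := runs_frame_in (l := [:: aJ; aNbr; aDeg]) (build_nbrs_spec inp D0) isT.
apply: (runs_seq_le (b2 := 14 * (n + m).+1) run1); first by lia.
move=> s1 [A1 fr1]; have inp1 := keeps_input_frame fr1 isT inp.
have T1 x : s1 aTl x = 0 by rewrite fr1 ?zero.
have run2 := runs_frame_in (l := [:: aJ; aTl]) (build_labels_spec inp1 T1) isT.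
apply: (runs_seq_le (b2 := 10 * (n + m).+1) run2); first by lia.
move=> s2 [T2 fr2]; have inp2 := keeps_input_frame fr2 isT inp1.
have [sn sm sk] := input_size inp2.
have S2 : static s2.
  split=> // [j p|i x|w|w d x ltd].
  - exact: input_edge.
  - exact: input_term.
  - by rewrite fr2 //; exact: (A1 w).1.
  - by rewrite fr2 //; exact: (A1 w).2.
have bad2 : s2 aBad 0 = 0 by rewrite fr2 // fr1 // zero.
apply: runs_mono (runs_frame_in (l := [:: aJ; aBad]) (check_spec nd S2 bad2) _) _ _; last by lia.
  by case: (nd).
move=> s3 [bad3 fr3]; split=> //; first exact: (static_frame fr3).
move=> a a18 aJ' i; have a3 : 3 < a by apply: leq_trans a18.
have out l : all (fun b => b <= 18) l -> a \notin aJ :: l.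
  move=> /allP l18; rewrite inE negb_or aJ' /=; apply/negP => /l18; by rewrite leqNgt a18.
by rewrite fr3 ?out // fr2 ?out // fr1 ?out // zero.
Qed.

Lemma start_spec (nd : bool) s : 0 < n -> static s -> (nd -> ~~ has terminal_edge es) ->
  (forall a, 18 < a -> a != aJ -> forall i, s a i = 0) ->
  runs (start nd) (fun s' => exists RS, [/\ stored nd RS s', RS != [::] & s' aHead 0 = 0])
    (93 * (n + m).+1) s.
Proof.
move=> n_gt0 Ss noadj zero.
have run1 := @fill_spec aSeed (var aX) (Get aTl (var aX)) 0 (s aTl) s isT isT Ss.
apply: (runs_seq_le (b2 := 90 * (n + m).+1) (runs_frame (run1 _))).
- by move=> s' j ltj X fr; rewrite /= X !fr.
- by lia.
move=> s1 [B1 fr1]; have S1 := static_frame fr1 isT Ss.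
have {}B1 : labels aSeed s1 tl by move=> x; rewrite B1 ltn_ord subn0 (s_tl Ss).
(* The bare terminals form a seed: in the node version the check has ensured that no two of them are
   adjacent. *)
have seed1 : seed G ts nd tl.
  split=> // Hnd x y Gxy; rewrite !term_label0 !negbK => xts yts.
  case/negP: (noadj Hnd); move: Gxy; rewrite -mem_nbrs => /flattenP [l /mapP [p pes ->]].
  rewrite mem_cat => /orP []; case: eqP => // px; rewrite inE => /eqP yp;
    apply/hasP; exists p => //; by rewrite /terminal_edge px -yp xts yts.
(* The initial trie holds only the empty word, which is not a solution since [n] is positive. *)
have empty : stored nd [::] s1.
  split=> //; first by rewrite /stored_rows fr1 // zero.
  exists [:: [::]]; last by move=> u szu; rewrite !inE -size_eq0 szu eqn0Ngt n_gt0.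
  rewrite !fr1 // zero // (_ : s aChild = fun _ => 0); first exact: trie_root.
  by apply: functional_extensionality => i; rewrite zero.
have H1 : s1 aHead 0 = 0 by rewrite fr1 // zero.
apply: runs_mono (runs_frame (extend_insert_spec n_gt0 S1 B1 seed1 empty)) _ _ => //.
move=> s2 [[RS [st [u uRS _]]] fr2]; exists RS; split=> //; first by apply/eqP => RS0; rewrite RS0 in uRS.
by rewrite fr2 //; case: (nd).
Qed.

End Correctness.

(** * Enumeration *)

(** [runs] remembers only the length of the trace. As its contents matter for the output, the trace
    is built explicitly, with at most two tests, a print and a write per iteration. *)
Lemma exec_print_loop a lim e e' N (p : pred nat) (g : nat -> nat) s :
  (forall j s', s' a 0 = j -> (forall b, b != a -> s' b = s b) -> eval s' lim = N /\
     (j < N -> (eval s' e != 0) = p j /\ eval s' e' = g j)) ->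
  exists tr s', [/\ exec (For a lim (If e (Out e') Skip)) s tr s',
    size tr <= 2 + N * 4, ~~ has is_complete tr &
    printed tr = [seq g j | j <- iota 0 N & p j]].
Proof.
move=> ev.
have loop r s1 : r <= N -> s1 a 0 = N - r -> (forall b, b != a -> s1 b = s b) ->
    exists tr s', [/\ exec (While (Bin Lt (var a) lim)
        (Seq (If e (Out e') Skip) (a ::= var a +' Num 1))) s1 tr s',
      size tr <= 1 + r * 4, ~~ has is_complete tr &
      printed tr = [seq g j | j <- iota (N - r) r & p j]].
  elim: r s1 => [|r IH] s1 ler a1 fr.
    have [limE _] := ev _ _ a1 fr; exists [:: Test], s1; split=> //.
    by apply: ExecWhileStop; rewrite /= limE a1 subn0 ltnn.
  have [limE] := ev _ _ a1 fr; have ltN : N - r.+1 < N by lia.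
  move=> /(_ ltN) [eE e'E].
  pose s2 := upd s1 a 0 (N - r).
  have [||tr [s' [ex sz nc pr]]] := IH s2 (ltnW ler).
  - by rewrite /s2 /upd !eqxx.
  - move=> b ba; rewrite -fr //; apply: functional_extensionality => i.
    by rewrite /s2 /upd (negPf ba).
  pose o := if p (N - r.+1) then [:: Print (g (N - r.+1))] else [::].
  exists (Test :: ((Test :: o) ++ [:: Write (N - r)]) ++ tr), s'; split.
  - apply: ExecWhileStep ex; first by rewrite /= limE a1 ltN.
    apply: (ExecSeq (s2 := s1)).
      apply: ExecIf; rewrite eE /o; case: ifP => _; last exact: ExecSkip.
      by rewrite -e'E; apply: ExecOut.
    have -> : N - r = eval s1 (var a +' Num 1) by rewrite /= a1; lia.
    by have := ExecAssign a (Num 0) (var a +' Num 1) s1; rewrite /s2 /= a1; have -> : N - r.+1 + 1 = N - r by lia.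
  - by rewrite /= !size_cat /= /o; case: ifP => _ /=; lia.
  - by rewrite /= !has_cat /= negb_or nc /o; case: ifP.
  - have -> : iota (N - r.+1) r.+1 = (N - r.+1) :: iota (N - r) r.
      by rewrite /=; congr (_ :: iota _ _); lia.
    rewrite -(cat1s Test (_ ++ tr)) -(cat1s Test o) !printed_cat pr /o /=.
    by case: ifP.
have [||tr [s' [ex sz nc pr]]] := loop N (upd s a 0 0) (leqnn N).
- by rewrite /upd !eqxx subnn.
- by move=> b ba; apply: functional_extensionality => i; rewrite /upd (negPf ba).
exists ([:: Write 0] ++ tr), s'; split=> //.
- by apply: ExecSeq ex; exact: (ExecAssign a (Num 0) (Num 0) s).
- by rewrite printed_cat pr subnn.
Qed.

Section Emits.

Variables (X : finType) (code : X -> nat).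
Implicit Types (Ms : seq {set X}) (tr : seq event).

(* The first block takes [d1] steps at most, the others [d] steps. *)
Fixpoint emits (d1 d : nat) Ms tr : Prop :=
  if Ms is M :: Ms' then
    exists b tr', [/\ tr = rcons b Complete ++ tr', size b < d1, ~~ has is_complete b,
      lists code M (printed b) & emits d d Ms' tr']
  else [/\ size tr <= d1, ~~ has is_complete tr & printed tr = [::]].

Lemma emits_prepend d1 d Ms tr0 tr : ~~ has is_complete tr0 -> printed tr0 = [::] ->
  emits d1 d Ms tr -> emits (size tr0 + d1) d Ms (tr0 ++ tr).
Proof.
move=> nc0 pr0; case: Ms => [|M Ms] /=.
  move=> [sz nc pr]; split; first by rewrite size_cat leq_add2l.
    by rewrite has_cat negb_or nc0 nc.
  by rewrite printed_cat pr0 pr.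
move=> [b [tr' [-> szb ncb lb em]]]; exists (tr0 ++ b), tr'; split=> //.
- by rewrite rcons_cat catA.
- by rewrite size_cat -addnS leq_add2l.
- by rewrite has_cat negb_or nc0 ncb.
- by rewrite printed_cat pr0.
Qed.

Lemma emits_mono d1 d d1' d' Ms tr : d1 <= d1' -> d <= d' ->
  emits d1 d Ms tr -> emits d1' d' Ms tr.
Proof.
elim: Ms d1 d1' tr => [|M Ms IH] d1 d1' tr le1 le /=.
  by move=> [sz nc pr]; split=> //; apply: leq_trans le1.
move=> [b [tr' [-> szb ncb lb em]]]; exists b, tr'; split=> //.
  exact: leq_trans le1.
exact: IH em.
Qed.

Lemma emits_enumerates d Ms (sol : pred {set X}) tr : emits d d Ms tr -> uniq Ms ->
  (forall M, (M \in Ms) = sol M) -> enumerates_with_delay code sol d tr.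
Proof.
move=> em uM solM.
have [blocks [tail [-> nc al prt szb]]] : exists blocks tail,
    [/\ tr = flatten [seq rcons b Complete | b <- blocks] ++ tail,
        ~~ has is_complete (flatten blocks ++ tail),
        all2 (lists code) Ms [seq printed b | b <- blocks], printed tail = [::] &
        all (fun b => size (rcons b Complete) <= d) blocks && (size tail <= d)].
  elim: Ms tr em {uM solM} => [|M Ms IH] tr /=.
    by move=> [sz nc pr]; exists [::], tr; split=> //=; rewrite sz.
  move=> [b [tr' [-> szb ncb lb em]]].
  have [blocks [tail [-> nc al prt szs]]] := IH _ em.
  exists (b :: blocks), tail; split=> //=; first by rewrite catA.
  - by rewrite -catA has_cat negb_or ncb nc.
  - by rewrite lb al.
  - by rewrite size_rcons szb.
by exists Ms, blocks, tail; split=> //; case/andP: szb.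
Qed.

End Emits.

Section Enumeration.

Variables (n : nat) (G : graph n) (es : seq ('I_n * 'I_n)) (ts : seq 'I_n) (nd : bool).
Hypothesis uniq_ts : uniq ts.
Hypothesis mem_nbrs : forall w y, (y \in nbrs_in es w) = G w y.
Hypothesis loopless : forall p, p \in es -> p.1 != p.2.
Hypothesis k_gt1 : 1 < size ts.
Local Notation k := (size ts).
Local Notation m := (size es).

Variables (X : finType) (code : X -> nat) (cut : ('I_n -> nat) -> {set X}).
Variable sol : pred {set X}.
Hypothesis cut_sol : forall f, valid G ts nd f -> sol (cut f).
Hypothesis cut_surj : forall M, sol M -> exists2 f, valid G ts nd f & cut f = M.
Hypothesis cut_inj : forall f g, valid G ts nd f -> valid G ts nd g -> cut f = cut g -> f =1 g.
Hypothesis no_sol : nd -> has (terminal_edge ts) es -> forall M, ~~ sol M.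
Hypothesis output_spec : forall s f, static es ts s -> current_row s f ->
  exists tr s', [/\ exec (output nd) s tr s', size tr <= 2 + (n + m) * 4,
    ~~ has is_complete tr & lists code (cut f) (printed tr)].

Let n_gt0 : 0 < n.
Proof. exact: leq_trans (ltnW k_gt1) (size_ts_le uniq_ts). Qed.

Definition row_cut (u : seq nat) := cut (row_label u).

Lemma uniq_row_cuts RS : valid_rows G ts nd RS -> uniq [seq row_cut u | u <- RS].
Proof.
move=> [uR vR]; rewrite map_inj_in_uniq // => u u' /vR [szu vu] /vR [szu' vu'].
move/(cut_inj vu vu') => eq_uu'; apply: (@eq_from_nth _ 0) => [|j ltj]; first by rewrite szu szu'.
by rewrite szu in ltj; have := eq_uu' (Ordinal ltj).
Qed.

Lemma output_frame s tr s' a : exec (output nd) s tr s' -> a != aX -> a != aJ -> s' a = s a.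
Proof.
move=> ex aX' aJ'; apply: (exec_frame ex).
by case: (nd); rewrite /= !inE ?(negPf aX') ?(negPf aJ').
Qed.

Lemma quiet_process : quiet (process nd).
Proof. by case: (nd). Qed.

Definition process_cost := 2 + n * (2 + k * (110 * (n + m).+1).+2).+2.
Definition print_cost := (n + m) * 4 + 8.

(** Induction on the number of subsets of [X] not accounted for by the [j] processed rows: distinct
    rows have distinct cuts, so the rows cannot outnumber the subsets and the loop ends. By then
    every row has been processed, and the rows are closed under all moves. *)
Lemma main_loop_spec RS s j : static es ts s -> stored G ts nd RS s ->
  s aHead 0 = j -> j <= size RS ->
  (forall j', j' < j -> forall v i, i < k -> served G ts nd RS (nth [::] RS j') v i) ->
  exists RS' tr s', let RSf := RS ++ RS' in
    [/\ exec (main_loop nd) s tr s',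
        emits code print_cost (process_cost + 1 + print_cost) [seq row_cut u | u <- drop j RSf] tr,
        valid_rows G ts nd RSf &
        forall u, u \in RSf -> forall v i, i < k -> served G ts nd RSf u v i].
Proof.
have [b] := ubnP (#|{: {set X}}| - j); elim: b RS s j => // b IH RS s j ltb Ss st Hj lej closed.
have [Rs Ws vR] := st.
have [eqj|neqj] := eqVneq j (size RS).
  exists [::], [:: Test], s => /=; rewrite cats0; split=> //.
  - by apply: ExecWhileStop; rewrite /= Hj Rs.1 eqj ltnn.
  - by rewrite eqj drop_size /=; split=> //; rewrite /print_cost addnC.
  - by move=> u uR v i lti; have := closed (index u RS); rewrite nth_index // eqj index_mem; apply.
have ltj : j < size RS by rewrite ltn_neqAle neqj.
set u := nth [::] RS j; have uR : u \in RS by rewrite mem_nth.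
have cur : current_row s (@row_label n u) by move=> x; rewrite Hj (Rs.2 _ _ ltj).
have [tr1 [s1 [ex1 sz1 nc1 l1]]] := output_spec Ss cur.
have fr1 a : a \notin [:: aX; aJ] -> s1 a = s a.
  by rewrite !inE negb_or => /andP [aX' aJ']; exact: output_frame ex1 aX' aJ'.
have S1 := static_frame fr1 isT Ss.
have st1 : stored G ts nd RS s1 by split=> //; rewrite /stored_rows /stored_words !fr1.
have H1 : s1 aHead 0 = j by rewrite fr1.
have [tr2 [s2 [ex2 sz2 [RS2 [st2 serv2]]]]] := process_spec uniq_ts mem_nbrs n_gt0 S1 st1 H1 ltj.
have fr2 a : a \notin written (process nd) -> s2 a = s1 a by exact: exec_frame ex2.
have S2 : static es ts s2 by apply: (static_frame fr2) S1; case: (nd).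
have H2 : s2 aHead 0 = j by rewrite fr2 ?H1 //; case: (nd).
have [pr2 nc2] := exec_quiet ex2 quiet_process.
pose s3 := upd s2 aHead 0 j.+1.
have le_card : size (RS ++ RS2) <= #|{: {set X}}|.
  have [_ _ /uniq_row_cuts/card_uniqP] := st2; rewrite size_map => <-; exact: max_card.
have ltb' : #|{: {set X}}| - j.+1 < b.
  by move: le_card; rewrite size_cat; lia.
have S3 : static es ts s3 by apply: static_upd.
have H3 : s3 aHead 0 = j.+1 by [].
have lej3 : j.+1 <= size (RS ++ RS2) by rewrite size_cat ltn_addr.
have closed3 j' : j' < j.+1 -> forall v i, i < k ->
    served G ts nd (RS ++ RS2) (nth [::] (RS ++ RS2) j') v i.
  rewrite ltnS leq_eqVlt nth_cat => /orP [/eqP ->|ltj'] v i lti.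
    by rewrite ltj; exact: serv2.
  by rewrite (ltn_trans ltj' ltj); apply: served_cat; exact: closed.
have [RS' [tr3 [s4 [ex3 em3 vR3 cl3]]]] := IH _ s3 _ ltb' S3 st2 H3 lej3 closed3.
exists (RS2 ++ RS'), (Test :: (tr1 ++ ([:: Complete] ++ (tr2 ++ [:: Write j.+1]))) ++ tr3), s4.
rewrite /= catA; split=> //.
- apply: ExecWhileStep ex3; first by rewrite /= Hj Rs.1 ltj.
  apply: ExecSeq ex1 _; apply: (@ExecSeq _ _ _ s1 _ [:: Complete]); first exact: ExecEnd.
  apply: ExecSeq ex2 _.
  have := ExecAssign aHead (Num 0) (var aHead +' Num 1) s2.
  by rewrite /= H2 addn1.
- rewrite (drop_nth [::]); last by rewrite !size_cat -addnA ltn_addr.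
  rewrite !nth_cat size_cat ltn_addr // ltj /=.
  exists (Test :: tr1), ((tr2 ++ [:: Write j.+1]) ++ tr3); split=> //.
  + by rewrite cat_rcons /= -(catA tr1).
  + by rewrite /print_cost /=; move: sz1; lia.
  (* The continuation starts with the processing of row [j], which is thus charged to the next
     block, or to the tail after the last solution. *)
  + have := emits_prepend (tr0 := tr2 ++ [:: Write j.+1]) _ _ em3.
    rewrite has_cat printed_cat pr2 negb_or nc2 => /(_ isT erefl).
    by apply: emits_mono => //; rewrite size_cat leq_add2r leq_add2r.
Qed.

Lemma enumerates_spec : exists tr s, exec (multiway_cuts nd) (input es ts) tr s /\
  enumerates_with_delay code sol (500 * (k * n * m)) tr.
Proof.
(* There are two distinct terminals and the graph is connected, so no vertex is isolated. Summing
   the degrees then gives n <= 2m. *)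
have sz_nbrs (w : 'I_n) : 0 < size (nbrs_in es w).
  have [y neq_yw] : exists y : 'I_n, y != w.
    case: (ts) k_gt1 uniq_ts => [|t1 [|t2 ts']] // _ /= /andP [+ _].
    rewrite inE negb_or => /andP [neq12 _].
    by have [tw|] := eqVneq t1 w; [exists t2; rewrite -tw eq_sym | exists t1].
  have /connectP [[|z p] /= ] := adj_conn G w y; first by move=> _ Dy; rewrite Dy eqxx in neq_yw.
  by case/andP => Gwz _ _; move: Gwz; rewrite -mem_nbrs; case: (nbrs_in es w).
have le_n : n <= m.*2.
  rewrite -sum_nbrs -[X in X <= _](card_ord n) -sum1_card; apply: leq_sum => w _.
  exact: sz_nbrs.
have le_kn := size_ts_le uniq_ts.
have m_gt0 : 0 < m by lia.
set D := 500 * _.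
have knm : 2 * n * m <= k * n * m by rewrite leq_mul2r leq_mul2r k_gt1 !orbT.
have nm : 2 * m <= n * m by rewrite leq_mul2r (leq_trans k_gt1) ?orbT.
have cost1 : 120 * (n + m).+1 + print_cost <= D.
  by rewrite /print_cost /D; nia.
have cost2 : process_cost + 1 + print_cost <= D.
  rewrite /process_cost /print_cost /D.
  (* With n <= 2m and 1 <= m, the expression 110(n + m + 1) + 2 is at most (220 + 110 + 112)m =
     442m. The remaining 58 of the constant 500 absorb loop overheads and printing. *)
  have : n * (k * (110 * (n + m).+1).+2) <= 442 * (k * n * m) by nia.
  by nia.
have [tr1 [s1 [ex1 sz1 [S1 bad1 zero1]]]] := setup_spec uniq_ts loopless nd.
have [pr1 nc1] : printed tr1 = [::] /\ ~~ has is_complete tr1.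
  by apply: (exec_quiet ex1); case: (nd).
have run_all tr s : exec (if eval s1 (var aBad) != 0 then Skip else start nd ;; main_loop nd) s1 tr s ->
    exec (multiway_cuts nd) (input es ts) (Test :: (tr1 ++ (Test :: tr))) s.
  move=> ex; apply: ExecIf; rewrite /= k_gt1; apply: ExecSeq ex1 _; exact: ExecIf.
case bad: (s1 aBad 0 != 0).
  exists (Test :: (tr1 ++ [:: Test])), s1; split; first by apply: run_all; rewrite /= bad; apply: ExecSkip.
  apply: (@emits_enumerates _ _ D [::]) => //=.
    split; last by rewrite /printed /= -/(printed _) printed_cat pr1.
      by rewrite size_cat /=; move: cost1; rewrite /print_cost; lia.
    by rewrite has_cat negb_or nc1.
  move=> M; rewrite in_nil; apply/esym/negbTE; apply: no_sol.
    by move: bad; rewrite bad1 => /andP [].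
  by move: bad; rewrite bad1 => /andP [].
have noadj : nd -> ~~ has (terminal_edge ts) es by move=> Hnd; apply: contraFN bad => adj; rewrite bad1 Hnd adj.
have [tr2 [s2 [ex2 sz2 [RS [st2 RS0 H2]]]]] := start_spec uniq_ts mem_nbrs n_gt0 S1 noadj zero1.
have [pr2 nc2] : printed tr2 = [::] /\ ~~ has is_complete tr2.
  by apply: (exec_quiet ex2); case: (nd).
have fr2 a : a \notin written (start nd) -> s2 a = s1 a by exact: exec_frame ex2.
have S2 : static es ts s2 by apply: (static_frame fr2) S1; case: (nd).
have [|RS' [tr3 [s3 /= [ex3 em3 vR cl]]]] := main_loop_spec S2 st2 H2 (leq0n _); first by [].
exists (Test :: (tr1 ++ (Test :: (tr2 ++ tr3)))), s3; split.
  by apply: run_all; rewrite /= bad; apply: ExecSeq ex2 ex3.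
rewrite drop0 in em3; apply: (@emits_enumerates _ _ D [seq row_cut u | u <- RS ++ RS']).
- have := emits_prepend (tr0 := Test :: (tr1 ++ (Test :: tr2))) _ _ em3.
  rewrite /= has_cat /printed /= -/(printed _) printed_cat pr1 /printed /= -/(printed _) pr2.
  rewrite negb_or nc1 nc2 => /(_ isT erefl); rewrite -catA; apply: emits_mono => //.
  by rewrite size_cat /=; move: cost1; lia.
- exact: uniq_row_cuts.
move=> M; apply/mapP/idP => [[u /(vR.2 u) [_ vu] ->]|/cut_surj [g vg <-]]; first exact: cut_sol.
(* The rows stored at the end are closed under the moves, so [reachable] finds every target [g]
   among them. *)
pose K (f : 'I_n -> nat) := exists2 u, u \in RS ++ RS' & row_label u = f.
have [f0 K0] : exists f0, K f0.
  case: (RS) RS0 @K => // u RS'' _ K; exists (row_label u), u => //; exact: mem_head.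
have [|f v i [u uR <-] lti|f [u uR <-] eq_f] := reachable (ltnW k_gt1) K0 _ _ vg.
- by move=> f [u /(vR.2 u) [_ vu] <-].
- by have [u' u'R ext] := cl _ uR v i lti; exists (row_label u') => //; exists u'.
- by exists u => //; rewrite /row_cut; congr cut; apply/esym/functional_extensionality.
Qed.

End Enumeration.

Lemma enumerates_le (X : finType) (code : X -> nat) (sol : pred {set X}) d d' tr :
  d <= d' -> enumerates_with_delay code sol d tr -> enumerates_with_delay code sol d' tr.
Proof.
move=> le [Ms [blocks [tail [solMs eqtr nc al [sz szt]]]]].
exists Ms, blocks, tail; split=> //; split; last exact: leq_trans le.
by apply: sub_all sz => b szb; apply: leq_trans le.
Qed.

Lemma minset_set0 (X : finType) (P : pred {set X}) M : P set0 -> minset P M = (M == set0).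
Proof.
move=> P0; apply/idP/eqP => [/minsetP [_ minM]|->]; first by rewrite -(minM set0) ?sub0set.
by apply/minsetP; split=> // B _; rewrite subset0 => /eqP.
Qed.

Lemma separates_le1 n (e : rel 'I_n) (T : {set 'I_n}) : #|T| <= 1 -> separates e (all_pairs T).
Proof. by move=> /card_le1_eqP T1; apply/separatesP => s t sT tT _; apply: T1. Qed.

Lemma input_le n (es : seq ('I_n * 'I_n)) ts a i : size ts <= n ->
  input es ts a i <= n + size es.
Proof.
move=> le_kn; have bound (l : seq nat) : all (leq^~ (n + size es)) l -> nth 0 l i <= n + size es.
  by case: (ltnP i (size l)) => [lti /all_nthP -> //|lei _]; rewrite nth_default.
rewrite /input; case: a => [|[|[|[|a]]]] /=; last by rewrite nth_default ?nth_default.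
- apply: bound; rewrite /= leq_addr leq_addl andbT; exact: leq_trans (leq_addr _ _).
- by apply: bound; apply/allP => _ /mapP [p _ ->]; rewrite ltnW // ltn_addr.
- by apply: bound; apply/allP => _ /mapP [p _ ->]; rewrite ltnW // ltn_addr.
- by apply: bound; apply/allP => _ /mapP [p _ ->]; rewrite ltnW // ltn_addr.
Qed.

(** * Application to the lists that present an instance *)

Section Instance.

Variables (n : nat) (G : graph n) (T : {set 'I_n}) (es : seq ('I_n * 'I_n)) (ts : seq 'I_n).
Hypothesis es_edges : edge_list G es.
Hypothesis ts_terms : terminal_list T ts.
Local Notation k := (size ts).
Local Notation m := (size es).
Local Notation pairs := [seq [set p.1; p.2] | p <- es].

Lemma terminal_list_uniq : uniq ts.
Proof. by rewrite (perm_uniq ts_terms) enum_uniq. Qed.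

Lemma terminal_list_mem : ts =i T.
Proof. by move=> x; rewrite (perm_mem ts_terms) mem_enum. Qed.

Lemma terminal_list_size : k = #|T|.
Proof. by rewrite (perm_size ts_terms) -cardE. Qed.

Lemma edge_list_size : m = #|edges G|.
Proof. by rewrite -(size_map (fun p => [set p.1; p.2])) (perm_size es_edges) -cardE. Qed.

Lemma edge_list_uniq : uniq pairs.
Proof. by rewrite (perm_uniq es_edges) enum_uniq. Qed.

Lemma edge_list_mem e : (e \in pairs) = (e \in edges G).
Proof. by rewrite (perm_mem es_edges) mem_enum. Qed.

Lemma edge_list_adj p : p \in es -> G p.1 p.2.
Proof. by move=> pes; rewrite -mem_edges -edge_list_mem; apply/mapP; exists p. Qed.

Lemma edge_list_loopless p : p \in es -> p.1 != p.2.
Proof. by move/edge_list_adj; apply: contraTneq => ->; rewrite (adj_irr G). Qed.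

Lemma edge_list_nbrs w y : (y \in nbrs_in es w) = G w y.
Proof.
apply/flattenP/idP => [[l /mapP [p /edge_list_adj Gp ->]]|].
  rewrite mem_cat => /orP []; case: eqP => // <-; rewrite inE => /eqP -> //.
  by rewrite adjC.
rewrite -mem_edges -edge_list_mem => /mapP [p pes] /set2_inj wy.
exists ((if p.1 == w then [:: p.2] else [::]) ++ (if p.2 == w then [:: p.1] else [::])).
  by apply/mapP; exists p.
by rewrite mem_cat; case: wy => [] [-> ->]; rewrite eqxx mem_head ?orbT.
Qed.

Lemma node_output_spec s f : static es ts s -> current_row s f ->
  exists tr s', [/\ exec (output true) s tr s', size tr <= 2 + (n + m) * 4,
    ~~ has is_complete tr & lists (@node_code n) (node_cut ts f) (printed tr)].
Proof.
move=> Ss cur.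
pose p j := s aRow (s aHead 0 * n + j) == k.+1.
have [|tr [s' [ex sz nc pr]]] := @exec_print_loop aX eN
    (Bin Eq (row_entry (var aX)) (eK +' Num 1)) (var aX) n p id s.
  move=> j s' Xj fr /=; have S' : static es ts s'.
    by apply: (static_frame (l := [:: aX])) Ss => // a; rewrite inE; exact: fr.
  by rewrite Xj (s_n S') (s_k S') !fr // addn1 eqb0 negbK.
exists tr, s'; split=> //; first by apply: leq_trans sz _; lia.
rewrite /lists pr map_id -val_enum_ord filter_map; apply: perm_map.
apply: uniq_perm; [exact: filter_uniq (enum_uniq _) | exact: enum_uniq | move=> x].
by rewrite mem_filter !mem_enum !inE andbT /= /p cur.
Qed.

Lemma edge_output_spec s f : static es ts s -> current_row s f ->
  exists tr s', [/\ exec (output false) s tr s', size tr <= 2 + (n + m) * 4,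
    ~~ has is_complete tr & lists (edge_code es) (edge_cut G f) (printed tr)].
Proof.
move=> Ss cur.
pose row v := s aRow (s aHead 0 * n + v).
pose p j := row (s aSrc j) != row (s aDst j).
have [|tr [s' [ex sz nc pr]]] := @exec_print_loop aJ eM
    (Bin Eq (Bin Eq (row_entry (Get aSrc (var aJ))) (row_entry (Get aDst (var aJ)))) (Num 0))
    (var aJ) m p id s.
  move=> j s' Jj fr /=; have S' : static es ts s'.
    by apply: (static_frame (l := [:: aJ])) Ss => // a; rewrite inE; exact: fr.
  by rewrite Jj (s_n S') (s_m S') !fr // eqb0 negbK eqb0.
exists tr, s'; split=> //; first by apply: leq_trans sz _; lia.
have pE q : q \in es -> p (index [set q.1; q.2] pairs) = (f q.1 != f q.2).
  move=> qes; have q_in : [set q.1; q.2] \in pairs by apply/mapP; exists q.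
  have lti : index [set q.1; q.2] pairs < m by rewrite -index_mem size_map in q_in.
  have [E1 E2] := s_edges Ss q lti; rewrite /p E1 E2 /row !cur.
  have := nth_index (q.1 |: [set q.2]) q_in; rewrite (nth_map q) //.
  by move=> /set2_inj [] [-> ->]; rewrite // eq_sym.
have cut_pairs e : e \in edge_cut G f -> e \in pairs.
  rewrite edge_list_mem => /imsetP [[x y]].
  by rewrite inE /= => /andP [Gxy _] ->; rewrite mem_edges.
rewrite /lists pr map_id; apply: uniq_perm; first by rewrite filter_uniq ?iota_uniq.
  rewrite map_inj_in_uniq ?enum_uniq // => e e'; rewrite !mem_enum => eM' e'M.
  exact: (index_inj set0 (cut_pairs _ eM') (cut_pairs _ e'M)).
move=> j; rewrite mem_filter mem_iota /= add0n; apply/andP/mapP => [[pj ltj]|[e]].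
  have [q Dq] : exists q, nth q es j = q.
    by case: (es) ltj => // q0 qs ltj; exists (nth q0 (q0 :: qs) j); apply: set_nth_default.
  have qes : q \in es by rewrite -Dq mem_nth.
  have Dj : index [set q.1; q.2] pairs = j.
    have -> : [set q.1; q.2] = nth set0 pairs j by rewrite (nth_map q) // Dq.
    by rewrite index_uniq ?size_map // edge_list_uniq.
  exists [set q.1; q.2]; last by rewrite /edge_code Dj.
  by rewrite mem_enum mem_edge_cut edge_list_adj // -pE // Dj.
rewrite mem_enum => eM' ->.
have /mapP [q qes De] := cut_pairs _ eM'.
move: eM'; rewrite De mem_edge_cut /edge_code pE // => /andP [_ ->]; split=> //.
by rewrite -(size_map (fun p => [set p.1; p.2])) index_mem; apply/mapP; exists q.
Qed.

Section Run.

Variables (nd : bool) (X : finType) (code : X -> nat) (cut : ('I_n -> nat) -> {set X}).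
Variables (sol : pred {set X}) (delay : nat).
Hypothesis cut_sol : 1 < #|T| -> forall f, valid G ts nd f -> sol (cut f).
Hypothesis cut_surj : 1 < #|T| ->
  forall M, sol M -> exists2 f, valid G ts nd f & cut f = M.
Hypothesis cut_inj : 1 < #|T| ->
  forall f g, valid G ts nd f -> valid G ts nd g -> cut f = cut g -> f =1 g.
Hypothesis no_sol : 1 < #|T| -> nd -> has (terminal_edge ts) es -> forall M, ~~ sol M.
Hypothesis sol_trivial : #|T| <= 1 -> forall M, sol M = (M == set0).
Hypothesis delayE : 1 < #|T| -> #|T| * n * #|edges G| <= delay.
Hypothesis output_spec : forall s f, static es ts s -> current_row s f ->
  exists tr s', [/\ exec (output nd) s tr s', size tr <= 2 + (n + m) * 4,
    ~~ has is_complete tr & lists code (cut f) (printed tr)].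

Lemma run_multiway_cuts : exists tr s,
  [/\ exec (multiway_cuts nd) (input es ts) tr s,
      word_bounded 500 (n + #|edges G|) tr
    & enumerates_with_delay code sol (500 * delay.+1) tr].
Proof.
suff [tr [s [ex en]]] : exists tr s, exec (multiway_cuts nd) (input es ts) tr s /\
    enumerates_with_delay code sol (500 * delay.+1) tr.
  exists tr, s; split=> //; rewrite -edge_list_size.
  (* The value 498 makes the word bound [K.+2] equal to 500, the constant of the delay. *)
  apply: (exec_word_bounded (K := 498) ex (slow_multiway_cuts nd)) => // a i.
  apply: leq_trans (leq_addr _ _); apply: input_le; exact: size_ts_le terminal_list_uniq.
case: (ltnP 1 #|T|) => T1.
  have k1 : 1 < k by rewrite terminal_list_size.
  have [tr [s [ex en]]] := enumerates_spec terminal_list_uniq edge_list_nbrs edge_list_loopless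
    k1 (cut_sol T1) (cut_surj T1) (cut_inj T1) (no_sol T1) output_spec.
  exists tr, s; split=> //; apply: enumerates_le en.
  rewrite leq_mul2l /=; apply: leq_trans (leqnSn _).
  by rewrite terminal_list_size edge_list_size delayE.
(* With at most one terminal, completing a solution on which nothing was printed outputs the empty
   set. *)
exists [:: Test; Complete], (input es ts); split.
  apply: ExecIf; have -> : eval (input es ts) (Bin Lt (Num 1) eK) = (1 < k) by [].
  rewrite terminal_list_size ltnNge T1; exact: ExecEnd.
apply: (@emits_enumerates _ _ _ [:: set0]) => // [|M].
  exists [:: Test], [::]; split=> //; first by rewrite mulnS.
  by rewrite /lists enum_set0.
by rewrite inE sol_trivial.
Qed.

End Run.

Lemma run_node_multiway_cuts : exists tr s,
  [/\ exec (multiway_cuts true) (input es ts) tr s,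
      word_bounded 500 (n + #|edges G|) tr
    & enumerates_with_delay (@node_code n) (minset (node_multiway_cut G T))
        (500 * (#|terminals (all_pairs T)| * n * #|edges G|).+1) tr].
Proof.
have k1 : 1 < #|T| -> 1 < k by rewrite terminal_list_size.
apply: (run_multiway_cuts (cut := node_cut ts)) => [T1 f|T1 M|_ f g|T1 _ adj M|T1 M|T1|].
- exact: (node_cut_minimal terminal_list_uniq terminal_list_mem (k1 T1)).
- exact: (node_cut_surj terminal_list_uniq terminal_list_mem (k1 T1)).
- exact: node_cut_inj.
(* An edge between two terminals survives the deletion of any node multiway cut, as such a cut
   avoids the terminals. *)
- apply/negP => /minsetP [/andP [MT /separatesP sep] _].
  have /hasP [p pes /andP [p1 p2]] := adj; rewrite !terminal_list_mem in p1 p2.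
  rewrite terminals_all_pairs // in MT.
  have tM t : t \in T -> t \notin M by apply: contraL => /(subsetP MT); rewrite inE.
  case/eqP: (edge_list_loopless pes); apply: sep => //; apply: connect1.
  by rewrite /del_nodes /= edge_list_adj // !tM.
- apply: minset_set0; rewrite /node_multiway_cut /node_multicut sub0set.
  exact: separates_le1.
- by rewrite terminals_all_pairs.
- exact: node_output_spec.
Qed.

Lemma run_edge_multiway_cuts : exists tr s,
  [/\ exec (multiway_cuts false) (input es ts) tr s,
      word_bounded 500 (n + #|edges G|) tr
    & enumerates_with_delay (edge_code es) (minset (edge_multiway_cut G T))
        (500 * (#|terminals (all_pairs T)| * n * #|edges G| ^ 2).+1) tr].
Proof.
have k1 : 1 < #|T| -> 1 < k by rewrite terminal_list_size.
apply: (run_multiway_cuts (cut := edge_cut G)) => [T1 f|T1 M|T1 f g||T1 M|T1|] //.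
- exact: (edge_cut_minimal terminal_list_mem (k1 T1)).
- exact: (edge_cut_surj terminal_list_mem (k1 T1)).
- exact: (edge_cut_inj (ltnW (k1 T1))).
- apply: minset_set0; rewrite /edge_multiway_cut /edge_multicut sub0set.
  exact: separates_le1.
- by rewrite terminals_all_pairs // leq_mul2l; case: #|edges G| => [|q]; rewrite ?orbT // leq_pmulr ?orbT.
- exact: edge_output_spec.
Qed.

End Instance.

Theorem theorem1 :
  enumeration_algorithm (X := fun n => 'I_n)
    (fun n _ => @node_code n)
    (fun n G T => minset (node_multiway_cut G T))
    (fun n G T => #|terminals (all_pairs T)| * n * #|edges G|)
  /\
  enumeration_algorithm (X := fun n => {set 'I_n})
    (fun n es => edge_code es)
    (fun n G T => minset (edge_multiway_cut G T))
    (fun n G T => #|terminals (all_pairs T)| * n * #|edges G| ^ 2).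
Proof.
split; [exists (multiway_cuts true), 500 | exists (multiway_cuts false), 500]
  => n G T es ts es_edges ts_terms.
  exact: run_node_multiway_cuts.
exact: run_edge_multiway_cuts.
Qed.
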